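(* Let $(R,\mathfrak m)$ be a two-dimensional regular local ring with infinite residue field and let $I$ be an integrally closed $\mathfrak m$-primary ideal of $R$. Then there exists an indecomposable integrally closed finitely generated torsion-free $R$-module $M$ of rank two with $I(M)=I$ if and only if $I$ satisfies one of the following conditions: (1) $\mathrm{ord}(I)\ge 3$; (2) $\mathrm{ord}(I)=2$ and $I$ is a simple integrally closed ideal; (3) $\mathrm{ord}(I)=2$ and $I$ is a product $I=JK$ of simple integrally closed ideals $J$ and $K$ with $J+K\ne\mathfrak m$.
   Context: The order $\mathrm{ord}(I)$ of an ideal $I$ is the largest non-negative integer $k$ with $I\subseteq\mathfrak m^k$. An ideal is simple if it is a nonzero proper ideal that is not the product of two proper ideals. For a finitely generated torsion-free $R$-module $M$ of rank $r$, the double dual $F=M^{**}$ is free of rank $r$, and $M$ is regarded as a submodule of $F\cong R^r$, generated by the columns of a matrix with $r$ rows; $I(M)$ denotes the ideal of maximal ($r\times r$) minors of this matrix (it does not depend on the choices; it is $\mathfrak m$-primary, or all of $R$ if $M$ is free). Regard elements of $F$ as linear forms in $R[X_1,\dots,X_r]$ and let $S$ be the $R$-subalgebra generated by the elements of $M$; an element $v\in F$ is integral over $M$ if its linear form is integral over the ring $S$. The integral closure of $M$ is the set of all elements of $F$ integral over $M$, and $M$ is integrally closed if it equals its integral closure. $M$ is indecomposable if it is nonzero and not a direct sum of two nonzero submodules. *)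

(* Defs.v *)
From HB Require Import structures.
From mathcomp Require Import all_boot all_order all_algebra.
From mathcomp Require Import boolp classical_sets functions cardinality.
From mathcomp Require Import -(notations) mpoly.

Set Implicit Arguments.
Unset Strict Implicit.
Unset Printing Implicit Defensive.

Import GRing.Theory.

Local Open Scope classical_set_scope.
Local Open Scope ring_scope.

Section Submodules.
Variables (R : comNzRingType) (V : lmodType R).
Implicit Types (N P : set V).

Definition submodule N := submod_closed [in N].

Definition submod_span (X : set V) : set V := smallest submodule X.

Definition set_add N P : set V := [set x + y | x in N & y in P].

Definition direct_sum N P := set_add N P = setT /\ N `&` P = [set 0].

Definition indecomposable :=
  [set: V] <> [set 0] /\
  ~ exists N P, [/\ submodule N /\ N <> [set 0],
                    submodule P /\ P <> [set 0] & direct_sum N P].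

Definition finitely_generated := exists n (e : 'I_n -> V), submod_span (range e) = setT.

(* the notion for modules over a domain, such as a regular local ring *)
Definition torsion_free := forall (a : R) (x : V), a *: x = 0 -> a = 0 \/ x = 0.

Definition lin_indep n (e : 'I_n -> V) :=
  forall c : 'I_n -> R, \sum_(i < n) c i *: e i = 0 -> forall i, c i = 0.

(* over a domain, the dimension of the module after extension of scalars to
   the fraction field: maximal number of linearly independent elements *)
Definition has_rank r :=
  (exists e : 'I_r -> V, lin_indep e) /\
  (forall n (e : 'I_n -> V), lin_indep e -> (n <= r)%N).

End Submodules.

Arguments indecomposable {R} V.
Arguments finitely_generated {R} V.
Arguments torsion_free {R} V.
Arguments has_rank {R} V r.

Section Ideals.
Variable R : comNzRingType.
Implicit Types (I J K m : set R).

(* not necessarily proper, contrary to idealr_closed *)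
Definition ideal I := submodule (I : set R^o).

Definition ideal_proper I := ideal I /\ I <> setT.

Definition ideal_span (X : set R) : set R := submod_span (X : set R^o).

Definition ideal_add I J : set R := set_add (I : set R^o) J.

Definition ideal_mul I J : set R := ideal_span [set x * y | x in I & y in J].

Definition ideal_exp I n : set R := iter n (ideal_mul I) setT.

Definition prime_ideal I := idealr_closed [in I] /\ prime_idealr_closed [in I].

Definition maximal_ideal I :=
  ideal_proper I /\ forall J, ideal_proper J -> I `<=` J -> J = I.

Definition radical I : set R := [set x | exists n, I (x ^+ n)].

Definition primary_ideal I :=
  ideal_proper I /\ forall x y, I (x * y) -> I x \/ radical I y.

Definition primary_to m I := primary_ideal I /\ radical I = m.

Definition simple_ideal I :=
  [/\ ideal_proper I, I <> [set 0] &
      ~ exists J K, [/\ ideal_proper J, ideal_proper K & I = ideal_mul J K]].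

Definition integral_over_ideal I (x : R) :=
  exists2 n, (0 < n)%N &
    exists2 a : nat -> R, (forall i, (0 < i <= n)%N -> ideal_exp I i (a i)) &
      x ^+ n + \sum_(1 <= i < n.+1) a i * x ^+ (n - i) = 0.

Definition integrally_closed_ideal I :=
  ideal I /\ [set x | integral_over_ideal I x] = I.

Definition is_order m I k :=
  I `<=` ideal_exp m k /\ forall j, I `<=` ideal_exp m j -> (j <= k)%N.

Definition noetherian :=
  forall I, ideal I -> exists n (e : 'I_n -> R), I = ideal_span (range e).

Definition local_ring m :=
  maximal_ideal m /\ forall J, maximal_ideal J -> J = m.

Definition prime_chain n (P : 'I_n.+1 -> set R) :=
  (forall i, prime_ideal (P i)) /\
  (forall i j : 'I_n.+1, (i < j)%N -> P i `<` P j).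

Definition krull_dim d :=
  (exists P : 'I_d.+1 -> set R, prime_chain P) /\
  (forall n (P : 'I_n.+1 -> set R), prime_chain P -> (n <= d)%N).

Definition regular_local_ring m d :=
  [/\ noetherian, local_ring m, krull_dim d &
      exists e : 'I_d -> R, m = ideal_span (range e)].

Definition infinite_residue_field m :=
  infinite_set (range (fun x : R => [set y | m (y - x)])).

Definition max_minors_ideal r n (A : 'M[R]_(r, n)) : set R :=
  ideal_span [set d | exists2 f : 'I_r -> 'I_n,
    {homo f : i j / (i < j)%N} & d = \det (colsub f A)].

End Ideals.

Arguments noetherian : clear implicits.
Arguments krull_dim : clear implicits.

Section Dual.
Variables (R : comNzRingType) (M : lmodType R).

Definition dual : Type := {linear M -> R^o}.

(* application of a functional, kept as a projection so that the operations on
   {linear M -> R^o} and those on dual M are not confused *)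
Definition dual_app (f : dual) : {linear M -> R^o} := f.

Lemma dualP (f g : dual) : (forall x, dual_app f x = dual_app g x) -> f = g.
Proof.
move=> fg; suff: dual_app f = dual_app g by [].
move: (dual_app f) (dual_app g) fg => {f g} f g /funext fg.
case: f g fg => [f [[f1] [f2]]] [g [[g1] [g2]]] /= fg; subst g.
by rewrite (Prop_irrelevance g1 f1) (Prop_irrelevance g2 f2).
Qed.

HB.instance Definition _ := gen_eqMixin dual.
HB.instance Definition _ := gen_choiceMixin dual.

Definition dual_zero : dual := \0 : {linear M -> R^o}.
Definition dual_opp (f : dual) : dual :=
  GRing.opp \o dual_app f : {linear M -> R^o}.
Definition dual_add (f g : dual) : dual :=
  dual_app f \+ dual_app g : {linear M -> R^o}.
Definition dual_scale (a : R) (f : dual) : dual :=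
  a \*: dual_app f : {linear M -> R^o}.

Lemma dual_addA : associative dual_add.
Proof. by move=> f g h; apply: dualP => x; apply: addrA. Qed.
Lemma dual_addC : commutative dual_add.
Proof. by move=> f g; apply: dualP => x; apply: addrC. Qed.
Lemma dual_add0 : left_id dual_zero dual_add.
Proof. by move=> f; apply: dualP => x; apply: add0r. Qed.
Lemma dual_addN : left_inverse dual_zero dual_opp dual_add.
Proof. by move=> f; apply: dualP => x; apply: addNr. Qed.

HB.instance Definition _ :=
  GRing.isZmodule.Build dual dual_addA dual_addC dual_add0 dual_addN.

Lemma dual_scaleA a b f : dual_scale a (dual_scale b f) = dual_scale (a * b) f.
Proof. by apply: dualP => x; apply: scalerA. Qed.
Lemma dual_scale1 : left_id 1 dual_scale.
Proof. by move=> f; apply: dualP => x; apply: scale1r. Qed.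
Lemma dual_scaleDr : right_distributive dual_scale +%R.
Proof. by move=> a f g; apply: dualP => x; apply: scalerDr. Qed.
Lemma dual_scaleDl f : {morph dual_scale^~ f : a b / a + b}.
Proof. by move=> a b; apply: dualP => x; apply: scalerDl. Qed.

HB.instance Definition _ := GRing.Zmodule_isLmodule.Build R dual
  dual_scaleA dual_scale1 dual_scaleDr dual_scaleDl.

Definition dual_eval (x : M) (f : dual) : R^o := dual_app f x.

Lemma dual_eval_is_linear x : linear (dual_eval x).
Proof. by []. Qed.

HB.instance Definition _ x :=
  GRing.isLinear.Build R dual R^o _ (dual_eval x) (dual_eval_is_linear x).

End Dual.

Section Bidual.
Variable R : comNzRingType.

Definition bidual (M : lmodType R) : lmodType R := dual (dual M).

Definition bidual_map (M : lmodType R) (x : M) : bidual M :=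
  (dual_eval x : {linear dual M -> R^o}).

Section Coordinates.
Variables (M : lmodType R) (r : nat) (phi : {linear bidual M -> 'cV[R]_r}).

(* M, regarded as a submodule of R^r through a basis of its bidual *)
Definition image_in_free : set 'cV[R]_r := range (fun x => phi (bidual_map x)).

Definition linear_form (v : 'cV[R]_r) : mpoly r R :=
  \sum_(i < r) v i 0 *: mpolyX R (mnm1 i).

Definition form_algebra : set (mpoly r R) :=
  smallest (fun S : set (mpoly r R) => subalg_closed [in S])
           (linear_form @` image_in_free).

Definition integral_over_module (v : bidual M) :=
  exists p : {poly mpoly r R},
    [/\ p \is monic, forall i, form_algebra p`_i
       & root p (linear_form (phi v))].

End Coordinates.

(* The choices of a basis of the bidual, and of a matrix A whose columns
   generate M in this basis, are immaterial. *)
Definition integrally_closed_module (M : lmodType R) (r : nat) :=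
  exists2 phi : {linear bidual M -> 'cV[R]_r}, bijective phi &
    [set v | integral_over_module phi v] = range (@bidual_map M).

Definition is_minors_ideal (M : lmodType R) (r : nat) (I : set R) :=
  exists2 phi : {linear bidual M -> 'cV[R]_r}, bijective phi &
    exists n (A : 'M[R]_(r, n)),
      submod_span (range (fun j => col j A)) = image_in_free phi /\
      I = max_minors_ideal A.

End Bidual.

(* Main.v *)
(* Write F = R^2 and det(u, v) = u_0 v_1 - u_1 v_0. Let N be a submodule of F whose
   determinants det(N, N) generate the integrally closed ideal I. By Cramer's rule and
   the determinant trick, v in F is integral over N as soon as det(v, N) lies in I, and
   conversely; hence N is integrally closed iff N = {v | det(v, N) <= I}, and the
   theorem becomes one about such N that do not split.

   Put L = I : m. Since I is contracted from R[m/x] for a general x (here an elementary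
   consequence of the infinite residue field and the ascending chain condition), m has
   generators p, q and I an element f with I = (f) + L p. Writing f = h p - g q, the
   module generated by (p, g), (q, h) and 0 x L has I as its ideal of minors and is
   integrally closed. Looking at it modulo m^2 F, it does not split if I <> m L and
   ord I >= 3, if I is simple, or if I = J K has order two with J and K tangent. If
   I = m L and ord I >= 3, the module L F + R (p, q) does the job instead.

   Conversely, if N does not split then N <= m F, so ord I >= 2. If I = J K has order
   two with J + K = m, then J = (x, y^a) and K = (y, x^b) for generators x, y of m, and
   N splits as J e + K f: isotropy cuts every x u + y v in N into x u and y v, and some
   x e, y f in N have det(e, f) invertible because x y is in I. *)

Require Import Defs.
From HB Require Import structures.
From mathcomp Require Import all_boot all_order all_algebra.
From mathcomp Require Import ring zify.
From mathcomp Require Import boolp classical_sets functions cardinality.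
From mathcomp Require Import -(notations) mpoly.

Set Implicit Arguments.
Unset Strict Implicit.
Unset Printing Implicit Defensive.

Import GRing.Theory.

Local Open Scope classical_set_scope.
Local Open Scope ring_scope.

(** * Submodules and ideals *)

(** The arithmetic of the ring rests on one fact, proved where dimension two enters: no power of a
    parameter [y] lies in [(x)], for [x] the other parameter. So [R / (x)] is a discrete valuation
    ring. Reducing modulo a line transversal to two given elements makes the order additive; hence
    [R] is a domain and parameters form a regular sequence. This extends functionals from a
    submodule of finite colength to [F] and identifies its bidual with [F]. The first module arises
    from asking that first coordinates fill [m]: orthogonality modulo [I] then leaves [L] for the
    vectors with first coordinate 0, and [g], [h] are any solution of [f = h p - g q] of the right
    order. If [I = m L], writing [f] with coefficients in [L] shows that this module is, up to a
    shear, the direct sum of [m] and [L], so it always splits; hence the other module in that case.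
    The bound three on the order comes from arguing modulo [m^2]: with [ord I = n + 1], the elements
    [g], [h] and the ideal [L] lie in [m^n], and [n] has to be at least 2. *)

Section Submodules.
Variables (R : comNzRingType) (V : lmodType R).
Implicit Types (N X : set V).

Lemma submoduleP N :
  submodule N <-> N 0 /\ forall a u v, N u -> N v -> N (a *: u + v).
Proof.
split=> -[N0 NL]; split.
- by move: N0; rewrite in_setE.
- by move=> a u v Nu Nv; have := NL a u v; rewrite !in_setE; apply.
- by rewrite in_setE.
- by move=> a u v; rewrite !in_setE; apply: NL.
Qed.

Section Closure.
Variables (N : set V) (N_sub : submodule N).

Lemma submod0 : N 0. Proof. by case/submoduleP: N_sub. Qed.

Lemma submodD u v : N u -> N v -> N (u + v).
Proof.
by move=> Nu Nv; rewrite -[u]scale1r; case/submoduleP: N_sub => _; apply.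
Qed.

Lemma submodZ a u : N u -> N (a *: u).
Proof.
move=> Nu; rewrite -[_ *: _]addr0; case/submoduleP: N_sub => N0; exact.
Qed.

Lemma submodB u v : N u -> N v -> N (u - v).
Proof. by move=> Nu Nv; rewrite -scaleN1r; apply/submodD/submodZ. Qed.

Lemma submod_sum (T : Type) (s : seq T) (P : pred T) (F : T -> V) :
  (forall i, P i -> N (F i)) -> N (\sum_(i <- s | P i) F i).
Proof. by move=> NF; apply: big_ind => //; [apply: submod0 | apply: submodD]. Qed.

End Closure.

Lemma submod_span_submodule X : submodule (submod_span X).
Proof.
apply/submoduleP; split=> [N [N_sub _]|a u v Xu Xv N NX]; first exact: submod0.
apply: submodD; [by case: NX| |exact: Xv].
by apply: submodZ; [case: NX|exact: Xu].
Qed.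

Lemma sub_submod_span X : X `<=` submod_span X.
Proof. by move=> v Xv N [_]; apply. Qed.

Lemma submod_span_min N X : submodule N -> X `<=` N -> submod_span X `<=` N.
Proof. by move=> N_sub XN v; apply. Qed.

Lemma submod_span_rangeP n (e : 'I_n -> V) v :
  submod_span (range e) v <-> exists c : 'I_n -> R, v = \sum_i c i *: e i.
Proof.
split; last first.
  case=> c ->; apply: (submod_sum (submod_span_submodule _)) => i _.
  apply: (submodZ (submod_span_submodule _)).
  by apply: sub_submod_span; exists i.
move: v; apply: submod_span_min => [|_ [i _ <-]].
  apply/submoduleP; split=> [|a _ _ [c ->] [d ->]].
    by exists (fun=> 0); rewrite big1 // => i _; rewrite scale0r.
  exists (fun i => a * c i + d i); rewrite scaler_sumr -big_split /=.
  by apply: eq_bigr => i _; rewrite scalerDl scalerA.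
exists (fun j => (j == i)%:R); rewrite (bigD1 i) //= eqxx scale1r.
by rewrite big1 ?addr0 // => j /negPf ->; rewrite scale0r.
Qed.

End Submodules.

(** * Sums, products, powers and quotients of ideals *)

Section Ideals.
Variable R : comNzRingType.
Implicit Types (I J K A B : set R).

Lemma idealP I :
  ideal I <-> I 0 /\ forall a u v, I u -> I v -> I (a * u + v).
Proof. exact: (submoduleP (I : set R^o)). Qed.

Lemma ideal0 I : ideal I -> I 0.
Proof. exact: (@submod0 _ R^o). Qed.

Lemma idealD I u v : ideal I -> I u -> I v -> I (u + v).
Proof. by move=> I_id; apply: (@submodD _ R^o). Qed.

Lemma idealM I a u : ideal I -> I u -> I (a * u).
Proof. by move=> I_id; apply: (@submodZ _ R^o). Qed.

Lemma idealMC I a u : ideal I -> I u -> I (u * a).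
Proof. by rewrite mulrC; apply: idealM. Qed.

Lemma idealB I u v : ideal I -> I u -> I v -> I (u - v).
Proof. by move=> I_id; apply: (@submodB _ R^o). Qed.

Lemma idealN I u : ideal I -> I u -> I (- u).
Proof. by move=> I_id Iu; rewrite -sub0r; apply: idealB => //; apply: ideal0. Qed.

Lemma ideal_sum I (T : Type) (s : seq T) (P : pred T) (F : T -> R) :
  ideal I -> (forall i, P i -> I (F i)) -> I (\sum_(i <- s | P i) F i).
Proof. by move=> I_id; apply: (@submod_sum _ R^o). Qed.

Lemma ideal_setT : ideal (@setT R).
Proof. exact/idealP. Qed.

Lemma ideal_spanP (X : set R) : ideal (ideal_span X).
Proof. exact: (@submod_span_submodule _ R^o). Qed.

Lemma sub_ideal_span (X : set R) : X `<=` ideal_span X.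
Proof. exact: (@sub_submod_span _ R^o). Qed.

Lemma ideal_span_min I (X : set R) : ideal I -> X `<=` I -> ideal_span X `<=` I.
Proof. exact: (@submod_span_min _ R^o). Qed.

Lemma ideal_span_rangeP n (e : 'I_n -> R) r :
  ideal_span (range e) r <-> exists c : 'I_n -> R, r = \sum_i c i * e i.
Proof. exact: (@submod_span_rangeP _ R^o). Qed.

Lemma ideal_addP I J r : ideal_add I J r <-> exists a b, [/\ I a, J b & r = a + b].
Proof.
split=> [[a Ia [b Jb <-]]|[a [b [Ia Jb ->]]]]; first by exists a, b.
by exists a => //; exists b.
Qed.

Lemma ideal_mul_ideal I J : ideal (ideal_mul I J).
Proof. exact: ideal_spanP. Qed.

Lemma mem_ideal_mul I J x y : I x -> J y -> ideal_mul I J (x * y).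
Proof. by move=> Ix Jy; apply: sub_ideal_span; exists x => //; exists y. Qed.

Lemma ideal_mul_min I J K :
  ideal K -> (forall x y, I x -> J y -> K (x * y)) -> ideal_mul I J `<=` K.
Proof. by move=> K_id IJK; apply: ideal_span_min => // _ [x Ix [y Jy <-]]; apply: IJK. Qed.

Lemma ideal_mulC I J : ideal_mul I J = ideal_mul J I.
Proof.
have sub I' J' : ideal_mul I' J' `<=` ideal_mul J' I'.
  apply: ideal_mul_min; first exact: ideal_mul_ideal.
  by move=> x y Ix Jy; rewrite mulrC; apply: mem_ideal_mul.
by apply/seteqP; split; apply: sub.
Qed.

Lemma ideal_mul_subl I J : ideal I -> ideal_mul I J `<=` I.
Proof. by move=> I_id; apply: ideal_mul_min => // x y Ix _; apply: idealMC. Qed.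

Lemma ideal_mul_subr I J : ideal J -> ideal_mul I J `<=` J.
Proof. by move=> J_id; apply: ideal_mul_min => // x y _; apply: idealM. Qed.

Lemma ideal_exp_ideal I n : ideal (ideal_exp I n).
Proof. by case: n => [|n]; [apply: ideal_setT | apply: ideal_mul_ideal]. Qed.

Lemma ideal_exp1 I : ideal I -> ideal_exp I 1 = I.
Proof.
move=> I_id; apply/seteqP; split; first exact: ideal_mul_subl.
by move=> x Ix; rewrite -[x]mulr1; apply: mem_ideal_mul.
Qed.

Lemma mem_ideal_expS I n x y :
  I x -> ideal_exp I n y -> ideal_exp I n.+1 (x * y).
Proof. exact: mem_ideal_mul. Qed.

Lemma ideal_exp_mul I i j x y :
  ideal_exp I i x -> ideal_exp I j y -> ideal_exp I (i + j) (x * y).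
Proof.
elim: i x => [|i IH] x Ix Jy; first exact: (idealM _ (ideal_exp_ideal _ _) Jy).
have L_id : ideal [set x | ideal_exp I (i.+1 + j) (x * y)].
  have E_id := ideal_exp_ideal I (i.+1 + j).
  apply/idealP; split=> [|a u v /= Hu Hv]; first by rewrite /= mul0r; apply: ideal0.
  by rewrite mulrDl -mulrA; exact: (idealD E_id (idealM _ E_id Hu) Hv).
apply: (ideal_mul_min L_id _ Ix) => a b Ia Ib /=.
by rewrite -mulrA; apply: mem_ideal_mul => //; apply: IH.
Qed.

Lemma ideal_exp_sub I i j : (i <= j)%N -> ideal_exp I j `<=` ideal_exp I i.
Proof.
move=> /subnKC <-; elim: (j - i)%N => [|k IH] x; first by rewrite addn0.
by rewrite addnS => /ideal_mul_subr - /(_ (ideal_exp_ideal _ _)); apply: IH.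
Qed.

Lemma ideal_expX I n x : I x -> ideal_exp I n (x ^+ n).
Proof. by move=> Ix; elim: n => // n IH; rewrite exprS; apply: mem_ideal_expS. Qed.

Lemma ideal_expD I n x y :
  ideal_exp I n x -> ideal_exp I n y -> ideal_exp I n (x + y).
Proof. exact: (idealD (ideal_exp_ideal I n)). Qed.

Lemma ideal_expM I n a x : ideal_exp I n x -> ideal_exp I n (a * x).
Proof. exact: (idealM a (ideal_exp_ideal I n)). Qed.

Lemma ideal1 I : ideal I -> I 1 -> I = setT.
Proof. by move=> I_id I1; apply/seteqP; split=> // x _; rewrite -[x]mulr1; apply: idealM. Qed.

Lemma proper_ideal1 I : ideal_proper I -> ~ I 1.
Proof. by case=> I_id I_prop /(ideal1 I_id). Qed.

Definition principal (x : R) : set R := [set r | exists a, r = a * x].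

Lemma principal_ideal x : ideal (principal x).
Proof.
apply/idealP; split; first by exists 0; rewrite mul0r.
by move=> a _ _ [b ->] [c ->]; exists (a * b + c); ring.
Qed.

Lemma ideal_add_ideal I J : ideal I -> ideal J -> ideal (ideal_add I J).
Proof.
move=> I_id J_id; apply/idealP; split.
  by apply/ideal_addP; exists 0, 0; split; [apply: ideal0|apply: ideal0|rewrite addr0].
move=> a _ _ /ideal_addP [u [v [Iu Jv ->]]] /ideal_addP [u' [v' [Iu' Jv' ->]]].
apply/ideal_addP; exists (a * u + u'), (a * v + v'); split; last by ring.
  by apply: idealD => //; apply: idealM.
by apply: idealD => //; apply: idealM.
Qed.

Lemma ideal_add_l I J : ideal J -> I `<=` ideal_add I J.
Proof. by move=> J_id x Ix; apply/ideal_addP; exists x, 0; rewrite addr0; split=> //; apply: ideal0. Qed.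

Lemma ideal_add_r I J : ideal I -> J `<=` ideal_add I J.
Proof. by move=> I_id x Ix; apply/ideal_addP; exists 0, x; rewrite add0r; split=> //; apply: ideal0. Qed.

Definition colon I (x : R) : set R := [set r | I (r * x)].

Lemma colon_ideal I x : ideal I -> ideal (colon I x).
Proof.
move=> I_id; apply/idealP; split; first by rewrite /colon /= mul0r; apply: ideal0.
move=> a u v; rewrite /colon /= mulrDl -mulrA => Iu Iv.
by apply: idealD => //; apply: idealM.
Qed.

End Ideals.

#[local] Hint Resolve ideal_exp_ideal : core.

(** * Noetherian local rings *)

Section Noetherian.
Variables (R : comNzRingType) (R_noeth : noetherian R).

Lemma noetherian_chain (F : nat -> set R) :
  (forall n, ideal (F n)) -> (forall n, F n `<=` F n.+1) ->
  exists N, forall n, F n `<=` F N.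
Proof.
move=> F_id F_incr.
have F_mono i j : (i <= j)%N -> F i `<=` F j.
  move=> /subnKC <-; elim: (j - i)%N => [|k IH]; first by rewrite addn0.
  by rewrite addnS => x /IH /F_incr.
pose U : set R := [set x | exists n, F n x].
have U_id : ideal U.
  apply/idealP; split; first by exists 0%N; apply: ideal0.
  move=> a u v [i Fu] [j Fv]; exists (maxn i j); apply: idealD => //.
    by apply: idealM => //; apply: F_mono Fu; apply: leq_maxl.
  by apply: F_mono Fv; apply: leq_maxr.
have [n [e Ue]] := R_noeth U_id.
have /choice[N NP] : forall i : 'I_n, exists k, F k (e i).
  by move=> i; have : U (e i) by rewrite Ue; apply: sub_ideal_span; exists i.
exists (\max_i N i)%N => k x Fx.
have : U x by exists k.
rewrite Ue; move: x {Fx}; apply: ideal_span_min => // _ [i _ <-].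
by apply: F_mono (NP i); apply: leq_bigmax.
Qed.

(** Stated for an arbitrary predicate because it serves twice: for proper ideals, and for the
    auxiliary ideal in Krull's intersection theorem. Without a maximal element, choice builds a
    chain contradicting [noetherian_chain]. *)
Lemma noetherian_max (P : set R -> Prop) (I : set R) :
  (forall J, P J -> ideal J) -> P I ->
  exists J, [/\ P J, I `<=` J & forall K, P K -> J `<=` K -> K `<=` J].
Proof.
move=> P_id PI; apply: contrapT => no_max.
pose T := {J : set R | P J /\ I `<=` J}.
have step (J : T) : exists K : T, sval J `<=` sval K /\ ~ sval K `<=` sval J.
  case: J => J [PJ IJ] /=; apply: contrapT => noK; apply: no_max.
  exists J; split=> // K PK JK; apply: contrapT => KJ; apply: noK.
  by exists (exist _ K (conj PK (subset_trans IJ JK))).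
have [f fP] := choice step.
pose F n := iter n f (exist _ I (conj PI (@subset_refl _ I))).
have [N NP] := @noetherian_chain (fun n => sval (F n))
  (fun n => P_id _ (proj1 (svalP (F n)))) (fun n => (fP (F n)).1).
exact: (fP (F N)).2 (NP N.+1).
Qed.

Lemma noetherian_fg (I : set R) : ideal I ->
  exists n (e : 'I_n -> R), (forall i, I (e i)) /\
    forall r, I r -> exists c : 'I_n -> R, r = \sum_i c i * e i.
Proof.
move=> /R_noeth [n [e ->]]; exists n, e; split=> [i|r].
  by apply: sub_ideal_span; exists i.
by move/ideal_span_rangeP.
Qed.

End Noetherian.

(** * Units and Nakayama's lemma in a noetherian local ring *)

Section Local.
Variables (R : comNzRingType) (m : set R).
Hypotheses (R_noeth : noetherian R) (R_loc : local_ring m).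

Lemma maximal_is_ideal : ideal m.
Proof. by case: R_loc => -[[]]. Qed.

Lemma maximal1 : ~ m 1.
Proof. by case: R_loc => -[m_prop _] _; apply: proper_ideal1. Qed.

Lemma proper_sub_maximal (I : set R) : ideal_proper I -> I `<=` m.
Proof.
move=> I_prop.
have [|J [J_prop IJ J_max]] := noetherian_max R_noeth (P := @ideal_proper R) _ I_prop.
  by move=> J [].
suff <- : J = m by [].
apply: (proj2 R_loc); split=> // K K_prop JK.
by apply/seteqP; split=> //; apply: J_max.
Qed.

Lemma local_unit a : ~ m a -> exists b, b * a = 1.
Proof.
move=> nma; apply: contrapT => na_unit.
apply/nma/(@proper_sub_maximal (principal a)); last by exists 1; rewrite mul1r.
split; first exact: principal_ideal.
move=> aT; have [b ba1] : principal a 1 by rewrite aT.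
by apply: na_unit; exists b.
Qed.

Lemma maximal_prime a b : m (a * b) -> m a \/ m b.
Proof.
move=> mab; case: (pselect (m a)); [by left|move=> /local_unit [c ca1]; right].
by rewrite -[b]mul1r -ca1 -mulrA; apply: idealM => //; apply: maximal_is_ideal.
Qed.

Lemma maximal_mul_cancel (B : set R) a c :
  ideal B -> m c -> B (a - c * a) -> B a.
Proof.
move=> B_id mc Bac; have m_id := maximal_is_ideal.
have [d d1] : exists d, d * (1 - c) = 1.
  apply: local_unit => m1c; apply: maximal1; rewrite -[1](subrK c).
  exact: idealD.
by rewrite -[a]mul1r -d1 -mulrA; apply: idealM => //; rewrite mulrBl mul1r.
Qed.

(** Generators of [A] are discarded one at a time. If [A] lies in [B] plus the span of the first
    [k], then the [k]-th one is, modulo [B], an [m]-combination of these; its own coefficient can be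
    moved to the left, where [1 - c] is a unit. *)
Lemma nakayama (A B : set R) : ideal A -> ideal B ->
  (forall a, A a -> exists2 b, B b & ideal_mul m A (a - b)) -> A `<=` B.
Proof.
move=> A_id B_id AB.
have m_id := maximal_is_ideal.
have [n [e [Ae eA]]] := noetherian_fg R_noeth A_id.
suff H k : (k <= n)%N -> forall a, A a -> exists c : 'I_n -> R,
    B (a - \sum_(i < n | (i < k)%N) c i * e i).
  by move=> a /(H 0%N (leq0n _)) [c]; rewrite big_pred0 ?subr0.
move=> /subKn <-; elim: (n - k)%N => [|j IH] a Aa.
  have [c ->] := eA a Aa; exists c.
  rewrite [X in _ - X](eq_bigl predT) => [|i]; last by rewrite subn0 ltn_ord.
  by rewrite subrr; apply: ideal0.
case: (leqP n j) => [nj|jn].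
  by have [c] := IH a Aa; rewrite (_ : (n - j.+1 = n - j)%N);
    [exists c | move: nj; lia].
have lt : (n - j.+1 < n)%N by move: jn; lia.
have nSj : (n - j = (n - j.+1).+1)%N by move: jn; lia.
pose i0 := Ordinal lt.
have split_sum (c : 'I_n -> R) : \sum_(i < n | (i < n - j)%N) c i * e i =
    c i0 * e i0 + \sum_(i < n | (i < n - j.+1)%N) c i * e i.
  rewrite (bigD1 i0) /=; last by rewrite nSj.
  congr (_ + _); apply: eq_bigl => i; rewrite nSj ltnS -val_eqE /=.
  by rewrite [in RHS]ltn_neqAle andbC.
(* every element of [m A] is, modulo [B], an [m]-combination of the first generators *)
have mA r : ideal_mul m A r -> exists2 c : 'I_n -> R, (forall i, m (c i)) &
    B (r - \sum_(i < n | (i < n - j)%N) c i * e i).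
  pose L := [set r | exists2 c : 'I_n -> R, (forall i, m (c i)) &
    B (r - \sum_(i < n | (i < n - j)%N) c i * e i)].
  suff L_id : ideal L.
    apply: (ideal_mul_min L_id) => x y mx Ay; have [c Bc] := IH y Ay.
    exists (fun i => x * c i) => [i|]; first exact: idealMC.
    rewrite (_ : _ - _ = x * (y - \sum_(i < n | (i < n - j)%N) c i * e i)).
      exact: idealM.
    by rewrite mulrBr mulr_sumr; congr (_ - _); apply: eq_bigr => i _; rewrite mulrA.
  apply/idealP; split.
    exists (fun=> 0) => [i|]; first exact: ideal0.
    by rewrite big1 ?subr0 => [|i _]; [apply: ideal0 | rewrite mul0r].
  move=> x u v [c mc Bc] [d md Bd]; exists (fun i => x * c i + d i) => [i|].
    by apply: idealD => //; apply: idealM.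
  rewrite (_ : _ - _ = x * (u - \sum_(i < n | (i < n - j)%N) c i * e i) +
                      (v - \sum_(i < n | (i < n - j)%N) d i * e i)).
    by apply: idealD => //; apply: idealM.
  rewrite (eq_bigr (fun i => x * (c i * e i) + d i * e i)) => [|i _]; last by ring.
  by rewrite big_split /= -mulr_sumr; ring.
have [d Bd] : exists d : 'I_n -> R,
    B (e i0 - \sum_(i < n | (i < n - j.+1)%N) d i * e i).
  have [b Bb /mA [c mc Bc]] := AB _ (Ae i0).
  have [u u1] : exists u, u * (1 - c i0) = 1.
    apply: local_unit => m1c; apply: maximal1; rewrite -[1](subrK (c i0)).
    exact: idealD.
  exists (fun i => u * c i).
  rewrite (_ : _ - _ = u * ((e i0 - b - \sum_(i < n | (i < n - j)%N) c i * e i) + b)).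
    by apply: idealM => //; apply: idealD.
  rewrite split_sum (eq_bigr (fun i => u * (c i * e i))) => [|i _]; last by ring.
  have {}u1 : u * c i0 = u - 1 by rewrite -u1; ring.
  by rewrite -mulr_sumr; ring: u1.
have [c Bc] := IH a Aa; exists (fun i => c i + c i0 * d i).
rewrite (_ : _ - _ = (a - \sum_(i < n | (i < n - j)%N) c i * e i) +
   c i0 * (e i0 - \sum_(i < n | (i < n - j.+1)%N) d i * e i)).
  by apply: idealD => //; apply: idealM.
rewrite split_sum (eq_bigr (fun i => c i * e i + c i0 * (d i * e i))) => [|i _]; last by ring.
by rewrite big_split /= -mulr_sumr; ring.
Qed.

End Local.

(** * Two-dimensional regular local rings *)

Lemma prime_idealP (R : comNzRingType) (P : set R) : prime_ideal P <->
  [/\ ideal P, ~ P 1 & forall a b, P (a * b) -> P a \/ P b].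
Proof.
split=> [[[P0 P1 PL] PM]|[P_id P1 PM]].
- split.
  + apply/idealP; split; first by move: P0; rewrite in_setE.
    by move=> a u v Pu Pv; have := PL a u v; rewrite !in_setE; apply.
  + by move=> P'1; move/negP: P1; rewrite in_setE.
  + move=> a b Pab; have := PM a b; rewrite in_setE => /(_ Pab) /orP.
    by rewrite !in_setE.
- split; first split.
  + by rewrite in_setE; apply: ideal0.
  + by apply/negP; rewrite in_setE.
  + by move=> a u v; rewrite !in_setE; apply: (proj2 (proj1 (idealP P) P_id)).
  + move=> a b; rewrite in_setE => /PM Pab; apply/orP.
    by rewrite !in_setE.
Qed.

Definition parameters (R : comNzRingType) (m : set R) (x y : R) :=
  forall r, m r <-> exists a b, r = a * x + b * y.

Section RegularLocal.
Variables (R : comNzRingType) (m : set R) (R_reg : regular_local_ring m 2).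

Let R_noeth : noetherian R. Proof. by case: R_reg. Qed.
Let R_loc : local_ring m. Proof. by case: R_reg. Qed.
Let m_id : ideal m. Proof. exact: maximal_is_ideal R_loc. Qed.

Local Notation mpow := (ideal_exp m).
Local Notation params := (parameters m).

Lemma mpow1 : mpow 1 = m.
Proof. exact: ideal_exp1. Qed.

Lemma mpow2_mul r s : m r -> m s -> mpow 2 (r * s).
Proof. by move=> mr ms; apply: (@ideal_exp_mul _ m 1 1); rewrite mpow1. Qed.

Lemma parameters_exist : exists x y, params x y.
Proof.
case: R_reg => _ _ _ [e ->]; exists (e ord0), (e (lift ord0 ord0)) => r.
split=> [/ideal_span_rangeP [c ->]|[a [b ->]]].
  by exists (c ord0), (c (lift ord0 ord0)); rewrite big_ord_recl big_ord1.
apply: (idealD (ideal_spanP _)); apply: (idealM _ (ideal_spanP _));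
  by apply: sub_ideal_span; eexists.
Qed.

Lemma parameters_sym x y : params x y -> params y x.
Proof.
move=> xy r; apply: (iff_trans (xy r)).
by split=> -[a [b ->]]; exists b, a; rewrite addrC.
Qed.

Lemma parameters_l x y : params x y -> m x.
Proof. by move=> xy; apply/xy; exists 1, 0; ring. Qed.

Lemma parameters_r x y : params x y -> m y.
Proof. by move=> xy; apply/xy; exists 0, 1; ring. Qed.

Lemma parameters_det x y a b c d :
  params x y -> ~ m (a * d - b * c) -> params (a * x + b * y) (c * x + d * y).
Proof.
move=> xy /(local_unit R_noeth R_loc) [e e1] r; apply: (iff_trans (xy r)).
split=> -[s [t ->]]; last first.
  by exists (s * a + t * c), (s * b + t * d); ring.
exists (e * (s * d - t * c)), (e * (t * a - s * b)).
have {}e1 : e * a * d = 1 + e * b * c by rewrite -e1; ring.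
by ring: e1.
Qed.

(* elements vanishing to order at least [n] on the regular curve [x = 0] *)
Definition transv (x : R) n := ideal_add (principal x) (mpow n).

Lemma transv_ideal x n : ideal (transv x n).
Proof. by apply: ideal_add_ideal => //; apply: principal_ideal. Qed.

Lemma transvD x n u v : transv x n u -> transv x n v -> transv x n (u + v).
Proof. exact: (idealD (transv_ideal x n)). Qed.

Lemma transvB x n u v : transv x n u -> transv x n v -> transv x n (u - v).
Proof. exact: (idealB (transv_ideal x n)). Qed.

Lemma transvM x n a u : transv x n u -> transv x n (a * u).
Proof. exact: (idealM a (transv_ideal x n)). Qed.

Lemma transv_mpow x n : mpow n `<=` transv x n.
Proof. by apply: ideal_add_r; apply: principal_ideal. Qed.

Lemma transv_principal x n : principal x `<=` transv x n.
Proof. exact: ideal_add_l. Qed.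

Lemma transv_sub x i j : (i <= j)%N -> transv x j `<=` transv x i.
Proof.
move=> ij r /ideal_addP [a [b [xa Pb ->]]]; apply/ideal_addP; exists a, b.
by split=> //; apply: ideal_exp_sub Pb.
Qed.

Lemma transv_mulx x n a : transv x n (a * x).
Proof. by apply: transv_principal; exists a. Qed.

Section Params.
Variables (x y : R) (xy : params x y).

Lemma mpowSP n r :
  mpow n.+1 r <-> exists a b, [/\ mpow n a, mpow n b & r = a * x + b * y].
Proof.
split; last first.
  case=> a [b [Pa Pb ->]]; apply: ideal_expD; rewrite mulrC.
    by apply: mem_ideal_mul => //; apply: parameters_l xy.
  by apply: mem_ideal_mul => //; apply: parameters_r xy.
suff: mpow n.+1 `<=` [set r | exists a b,
    [/\ mpow n a, mpow n b & r = a * x + b * y]] by apply.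
apply: ideal_mul_min.
  apply/idealP; split; first by exists 0, 0; split; [apply: ideal0|apply: ideal0|ring].
  move=> c _ _ [a [b [Pa Pb ->]]] [a' [b' [Pa' Pb' ->]]].
  exists (c * a + a'), (c * b + b'); split; last by ring.
    by apply: idealD => //; apply: idealM.
  by apply: idealD => //; apply: idealM.
move=> s t /xy [a [b ->]] Pt; exists (a * t), (b * t).
by split; [apply: idealM|apply: idealM|ring].
Qed.

Lemma mpowS_split n r : mpow n.+1 r ->
  exists a c, mpow n a /\ r = a * x + c * y ^+ n.+1.
Proof.
elim: n r => [|n IH] r /mpowSP [a [b [Pa Pb ->]]]; first by exists a, b.
have [a' [c [Pa' ->]]] := IH b Pb; exists (a + y * a'), c; split.
  by apply: ideal_expD => //; apply: mem_ideal_mul => //; apply: parameters_r xy.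
by rewrite [_ ^+ n.+2]exprS; ring.
Qed.

Lemma transvP n r : transv x n r <-> exists a c, r = a * x + c * y ^+ n.
Proof.
split=> [/ideal_addP [_ [b [[a ->] Pb ->]]]|[a [c ->]]]; last first.
  apply: transvD; first exact: transv_mulx.
  apply: transvM; apply: transv_mpow; apply: ideal_expX.
  exact: parameters_r xy.
case: n Pb => [|n] Pb; first by exists a, b; rewrite expr0 mulr1.
by have [a' [c [_ ->]]] := mpowS_split Pb; exists (a + a'), c; ring.
Qed.

(** Modulo [x] every element is a unit times a power of [y], up to a given precision. This is
    uniseriality of [R / (x)], available before it is known that the powers of [y] do not vanish
    there. *)
Lemma transv_dichotomy n r : transv x n r \/
  exists c a u, [/\ (c < n)%N, ~ m u & r = a * x + u * y ^+ c].
Proof.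
elim: n => [|n [/transvP [a [u rE]]|[c [a [u [cn nmu rE]]]]]].
- by left; apply/transvP; exists 0, r; rewrite expr0; ring.
- have [/xy [b [d uE]]|nmu] := pselect (m u); last by right; exists n, a, u.
  left; apply/transvP; exists (a + b * y ^+ n), d.
  by rewrite rE uE [y ^+ n.+1]exprS; ring.
- by right; exists c, a, u; split=> //; apply: leq_trans cn _.
Qed.

Lemma principal_of_transv n : transv x n.+1 (y ^+ n) -> principal x (y ^+ n).
Proof.
move=> /transvP [a [c yE]].
apply: (@maximal_mul_cancel _ _ R_noeth R_loc _ _ (c * y)).
- exact: principal_ideal.
- by apply: idealM => //; apply: parameters_r xy.
- by exists a; rewrite {1}yE exprS; ring.
Qed.

(* Otherwise [m] would be minimal over [(x)]: given primes [P0 < q < m], [q] is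
   [(g) + x q] because [R / (x)] is uniserial, hence [q = (g)] and [P0 = g P0 = 0].
   Some power of [g] lies in [(x)], and as [x] is not in the prime [(g)], the
   factors [g] can be cancelled one at a time until [1] is in [(x)]. *)
Lemma param_pow_notin_transv n : ~ transv x n.+1 (y ^+ n).
Proof.
move=> /principal_of_transv xyn.
have [P0 [q [P0_pr q_pr [P0q [z qz nP0z]] qm [t mt nqt]]]] :
  exists P0 q : set R, [/\ prime_ideal P0, prime_ideal q,
    P0 `<=` q /\ (exists2 z, q z & ~ P0 z), q `<=` m & exists2 t, m t & ~ q t].
  case: R_reg => _ _ [[P [P_pr P_lt]] _] _.
  pose i0 : 'I_3 := ord0; pose i1 : 'I_3 := lift ord0 ord0; pose i2 : 'I_3 := ord_max.
  have P_m i : P i `<=` m.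
    case/prime_idealP: (P_pr i) => Pi_id Pi1 _; apply: (proper_sub_maximal R_noeth R_loc).
    by split=> // PT; apply: Pi1; rewrite PT.
  have sep (i j : 'I_3) : (i < j)%N -> P i `<=` P j /\ exists2 z, P j z & ~ P i z.
    move=> /P_lt [sub nsub]; split=> //; apply: contrapT => no; apply: nsub.
    by move=> z Pz; apply: contrapT => nPz; apply: no; exists z.
  exists (P i0), (P i1); split=> //; first exact: sep.
  have [|_ [s Ps nPs]] := @sep i1 i2; first by [].
  by exists s => //; apply: P_m Ps.
case/prime_idealP: P0_pr => P0_id P01 P0M.
case/prime_idealP: q_pr => q_id q1 qM.
have q_pow a k : q (a ^+ k) -> q a.
  by elim: k => [|k IH]; [rewrite expr0|rewrite exprS => /qM []].
have nqx : ~ q x.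
  move=> qx; apply: nqt; have [a [b ->]] := proj1 (xy t) mt.
  apply: idealD => //; apply: idealM => //; apply: (q_pow _ n).
  by case: xyn => c ->; apply: idealM.
have mx := parameters_l xy.
have xN r : transv x n r -> principal x r.
  move=> /transvP [a [c ->]]; apply: (idealD (principal_ideal x)); first by exists a.
  exact: (idealM _ (principal_ideal x)).
have [g qg gP] : exists2 g, q g & forall r, q r -> exists s, principal x (r - s * g).
  (* The generator [g] is an element of [q] of least [y]-order modulo [x]. If no element of [q] has
     such an order, [q] lies in [(x)] and [g = 0] serves. *)
  pose ex c := exists g, [/\ q g & exists a u, ~ m u /\ g = a * x + u * y ^+ c].
  case: (pselect (exists c, ex c)) => [exc|noc]; last first.
    exists 0 => [|r qr]; first exact: ideal0.
    exists 0; rewrite mul0r subr0; apply: xN.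
    case: (transv_dichotomy n r) => // -[c [a [u [_ nmu rE]]]].
    by case: noc; exists c, r; split=> //; exists a, u.
  have exb : exists c, `[< ex c >] by case: exc => c ec; exists c; apply/asboolP.
  have [c /asboolP [g [qg [a [u [nmu gE]]]]] c_min] := ex_minnP exb.
  exists g => // r qr.
  case: (transv_dichotomy c r) => [/transvP [b [d rE]]|[c' [b [d [lt nmd rE]]]]].
    have [v v1] := local_unit R_noeth R_loc nmu.
    exists (d * v), (b - d * v * a); by rewrite rE gE; ring: v1.
  have : `[< ex c' >] by apply/asboolP; exists r; split=> //; exists b, d.
  by move/c_min; rewrite leqNgt lt.
have qE : q `<=` principal g.
  apply: (nakayama R_noeth R_loc q_id (principal_ideal g)) => r qr.
  have [s [b rE]] := gP r qr; exists (s * g); first by exists s.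
  rewrite rE mulrC; apply: mem_ideal_mul => //.
  have : q (b * x) by rewrite -rE; apply: idealB => //; apply: idealM.
  by case/qM.
have nP0g : ~ P0 g.
  by move=> P0g; apply: nP0z; have [s ->] := qE z qz; apply: idealM.
have zero_id : ideal [set (0 : R)].
  by apply/idealP; split=> // a _ _ -> ->; rewrite mulr0 addr0.
have P00 : P0 `<=` [set 0].
  apply: (nakayama R_noeth R_loc P0_id zero_id) => r P0r; exists 0 => //.
  have [s rE] := qE _ (P0q _ P0r); rewrite subr0 rE mulrC.
  apply: mem_ideal_mul; first exact: qm.
  by move: P0r; rewrite rE => /P0M [].
have : principal x (g ^+ n).
  by apply: xN; apply: transv_mpow; apply: ideal_expX; apply: qm.
elim: n {xyn xN} => [|k IH].
  rewrite expr0 => -[a a1]; apply: (maximal1 R_loc); rewrite a1.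
  exact: idealM.
case=> s gE; apply: IH.
have qsx : q (s * x) by rewrite -gE exprS mulrC; apply: idealM.
have qs : q s by case: (qM _ _ qsx).
have [s' sE] := qE s qs.
have /P0M [] // : P0 (g * (g ^+ k - s' * x)).
  rewrite (_ : _ * _ = 0); first exact: ideal0.
  by rewrite mulrBr -exprS gE sE; ring.
by move=> /P00 /eqP; rewrite subr_eq0 => /eqP ->; exists s'.
Qed.

Lemma unit_param_pow_notin_transv u n : ~ m u -> ~ transv x n.+1 (u * y ^+ n).
Proof.
move=> /(local_unit R_noeth R_loc) [v v1] uy; apply: (@param_pow_notin_transv n).
rewrite -[y ^+ n]mul1r -v1 -mulrA; apply: idealM => //; exact: transv_ideal.
Qed.

Lemma transv_cancel n r : transv x n.+1 (r * y) -> transv x n r.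
Proof.
case: (transv_dichotomy n r) => // -[c [a [u [cn nmu ->]]]] ry.
case: (@unit_param_pow_notin_transv u c.+1) => //.
rewrite (_ : _ * _ = (a * x + u * y ^+ c) * y - (a * y) * x); last by rewrite exprS; ring.
apply: transvB; last exact: transv_mulx.
by apply: transv_sub ry.
Qed.

(** The intersection [D] satisfies [D <= (x) + y D], because [y] can be cancelled in the conditions
    that define [D]; Nakayama's lemma concludes. *)
Lemma transv_bigcap r : (forall n, transv x n r) -> principal x r.
Proof.
pose D := [set r | forall n, transv x n r]; suff: D `<=` principal x by apply.
have D_id : ideal D.
  apply/idealP; split=> [n|a u v Du Dv n]; first exact: (ideal0 (transv_ideal _ _)).
  by apply: transvD; first exact: transvM.
apply: (nakayama R_noeth R_loc D_id (principal_ideal x)) => {}r Dr.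
have [a [c rE]] := proj1 (transvP 1 r) (Dr 1%N).
exists (a * x); first by exists a.
rewrite rE expr1 addrC addKr mulrC; apply: mem_ideal_mul; first exact: parameters_r xy.
move=> n; apply: transv_cancel.
rewrite (_ : c * y = r - a * x); last by rewrite rE; ring.
by apply: transvB => //; apply: transv_mulx.
Qed.

Lemma notin_principal r : ~ principal x r ->
  exists c a u, ~ m u /\ r = a * x + u * y ^+ c.
Proof.
move=> nxr; have [n nr] : exists n, ~ transv x n r.
  by apply: contrapT => no; apply/nxr/transv_bigcap => n; apply: contrapT => nr; apply: no; exists n.
by case: (transv_dichotomy n r) => // -[c [a [u [_ nmu rE]]]]; exists c, a, u.
Qed.

(** Outside [(x)] the [y]-orders modulo [x] are finite and add up under multiplication. *)
Lemma principal_prime r s : principal x (r * s) -> principal x r \/ principal x s.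
Proof.
move=> xrs; apply: contrapT => /not_orP [/notin_principal [i [a [u [nmu rE]]]]].
move=> /notin_principal [j [b [v [nmv sE]]]].
apply: (@unit_param_pow_notin_transv (u * v) (i + j)).
  by move=> /(maximal_prime R_noeth R_loc) [].
rewrite (_ : _ * _ = r * s - (a * b * x + a * v * y ^+ j + b * u * y ^+ i) * x).
  apply: transvB; last exact: transv_mulx.
  exact: transv_principal.
by rewrite rE sE exprD; ring.
Qed.

Lemma param_notin_principal : ~ principal x y.
Proof.
move=> xy'; apply: (@param_pow_notin_transv 1); rewrite expr1.
exact: transv_principal.
Qed.

Lemma mpow_sub_of_pow (E : set R) k l :
  ideal E -> E (x ^+ k) -> E (y ^+ l) -> mpow (k + l) `<=` E.
Proof.
elim: k E => [|k IH] E E_id Ex Ey r.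
  by move=> _; rewrite -[r]mulr1; apply: idealM.
rewrite addSn => /mpowS_split [a [c [Pa ->]]]; apply: idealD => //; last first.
  by rewrite -addSn exprD mulrA; apply: idealM.
apply: (IH (colon E x)) Pa; first exact: colon_ideal.
  by rewrite /colon /= -exprSr.
by rewrite /colon /=; apply: idealMC.
Qed.

End Params.

(* Krull's intersection theorem, by an ideal [E] maximal with [E `&` D = m D] *)
Lemma mpow_bigcap r : (forall n, mpow n r) -> r = 0.
Proof.
pose D := [set r | forall n, mpow n r]; suff: D `<=` [set 0] by apply.
have D_id : ideal D.
  apply/idealP; split=> [n|a u v Du Dv n]; first exact: ideal0.
  by apply: ideal_expD; [apply: ideal_expM|].
have mD_id := ideal_mul_ideal m D.
pose P E := ideal E /\ E `&` D `<=` ideal_mul m D.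
have [|//|E [[E_id ED] mDE E_max]] := @noetherian_max _ R_noeth P (ideal_mul m D).
  by move=> J [].
(* Let the ideals [(E : t^k)] be stationary from [N] on. If [d = e + a t^N] lies in [D], then [t d]
   lies in [m D <= E], so [a t^(N+1)], hence [a t^N], is in [E]. Thus [E + (t^N)] satisfies [P] as
   well and equals [E]. *)
have E_pow t : m t -> exists k, E (t ^+ k).
  move=> mt; have [|k|N NP] := @noetherian_chain _ R_noeth (fun k => colon E (t ^+ k)).
  - by move=> k; apply: colon_ideal.
  - by move=> s; rewrite /colon /= exprSr mulrA => /(idealMC _ E_id).
  exists N; apply: (E_max (ideal_add E (principal (t ^+ N)))).
  - split; first by apply: ideal_add_ideal => //; apply: principal_ideal.
    move=> d [/ideal_addP [e [_ [Ee [a ->] dE]]] Dd]; apply: ED; split=> //.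
    rewrite dE; apply: idealD => //; apply: (NP N.+1).
    rewrite /colon /= exprSr mulrA (_ : _ * t = t * d - t * e); last by rewrite dE; ring.
    exact: (idealB E_id (mDE _ (mem_ideal_mul mt Dd)) (idealM _ E_id Ee)).
  - by apply: ideal_add_l; apply: principal_ideal.
  - by apply: ideal_add_r => //; exists 1; rewrite mul1r.
have [x [y xy]] := parameters_exist.
have [k Ex] := E_pow x (parameters_l xy); have [l Ey] := E_pow y (parameters_r xy).
have zero_id : ideal [set (0 : R)].
  by apply/idealP; split=> // a _ _ -> ->; rewrite mulr0 addr0.
apply: (nakayama R_noeth R_loc) => // d Dd; exists 0 => //; rewrite subr0.
apply: ED; split=> //; exact: (mpow_sub_of_pow xy E_id Ex Ey).
Qed.

Lemma order_exists r : r <> 0 -> exists n, mpow n r /\ ~ mpow n.+1 r.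
Proof.
move=> r0; have [n nr] : exists n, ~ mpow n r.
  by apply: contrapT => no; apply/r0/mpow_bigcap => n; apply: contrapT => nr; apply: no; exists n.
elim: n nr => [|n IH] nr; first by case: nr.
by have [rn|/IH //] := pselect (mpow n r); exists n.
Qed.

Lemma param_notin_mpow2 x y : params x y -> ~ mpow 2 x.
Proof.
move=> /parameters_sym yx x2; apply: (param_pow_notin_transv yx (n := 1)).
by rewrite expr1; apply: transv_mpow.
Qed.

(** In coordinates for generators [p], [q] the determinant of [x], [y] must be a unit. Were it in
    [m], eliminating [p] or [q] would put [u * y - v * x] in [m^2] with [u] a unit coordinate of
    [x]. *)
Lemma parameters_pair x y : m x -> ~ mpow 2 x -> m y -> ~ transv x 2 y -> params x y.
Proof.
have [p [q pq]] := parameters_exist.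
move=> /pq [a [b xE]] nx2 /pq [c [d yE]] nxy; rewrite xE yE.
apply: parameters_det => // mdet.
have m2 := mpow2_mul.
have [mp mq] := (parameters_l pq, parameters_r pq).
have key u v : ~ m u -> mpow 2 (u * y - v * x) -> False.
  move=> /(local_unit R_noeth R_loc) [u' u1] H; apply: nxy.
  rewrite (_ : y = u' * (u * y - v * x) + (u' * v) * x).
    apply: transvD; last exact: transv_mulx.
    by apply: transvM; apply: transv_mpow.
  by ring: u1.
have [ma|nma] := pselect (m a).
  have [mb|nmb] := pselect (m b).
    by apply: nx2; rewrite xE; apply: ideal_expD; apply: m2.
  apply: (key b d) => //; rewrite (_ : _ - _ = - ((a * d - b * c) * p)).
    by apply: (idealN (ideal_exp_ideal m 2)); apply: m2.
  by rewrite xE yE; ring.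
apply: (key a c) => //; rewrite (_ : _ - _ = (a * d - b * c) * q).
  exact: m2.
by rewrite xE yE; ring.
Qed.

Lemma parameters_complete x : m x -> ~ mpow 2 x -> exists y, params x y.
Proof.
move=> mx nx2; have [p [q pq]] := parameters_exist.
have [mp mq] := (parameters_l pq, parameters_r pq).
have [xp|nxp] := pselect (transv x 2 p); last by exists p; apply: parameters_pair.
have [xq|nxq] := pselect (transv x 2 q); last by exists q; apply: parameters_pair.
have xm : m `<=` principal x.
  apply: (nakayama R_noeth R_loc m_id (principal_ideal x)) => r /pq [a [b ->]].
  have : transv x 2 (a * p + b * q).
    by apply: transvD; apply: transvM.
  case/ideal_addP => s [t [xs t2 ->]]; exists s => //.
  by rewrite addrC addKr; move: t2; rewrite -[mpow 2]/(ideal_mul m (mpow 1)) mpow1.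
(* In this case [m = (x)], and the pair [(x, 0)] already generates [m]. *)
exists 0 => r; split=> [/xm [a ->]|[a [b ->]]]; first by exists a, 0; ring.
by rewrite mulr0 addr0; apply: idealM.
Qed.

End RegularLocal.

(** * Transversal lines and the order function *)

Section InfiniteResidueField.
Variables (R : comNzRingType) (m : set R) (R_reg : regular_local_ring m 2).
Hypothesis R_inf : infinite_residue_field m.

Let R_noeth : noetherian R. Proof. by case: R_reg. Qed.
Let R_loc : local_ring m. Proof. by case: R_reg. Qed.
Let m_id : ideal m. Proof. exact: maximal_is_ideal R_loc. Qed.

Local Notation mpow := (ideal_exp m).
Local Notation params := (parameters m).
Local Notation transv := (transv m).

Lemma residue_sequence : exists lam : nat -> R,
  forall i j, i <> j -> ~ m (lam i - lam j).
Proof.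
have /infiniteP/pcard_leP[f] := R_inf.
have /choice[lam lamP] : forall i, exists x : R, [set y | m (y - x)] = f i.
  by move=> i; have [x _ xE] := 'funS_f (I : [set: nat] i); exists x.
exists lam => i j ij mij; apply: ij.
have f_inj : set_inj [set: nat] f by exact: 'inj_f.
apply: f_inj; rewrite ?in_setT //.
rewrite -!lamP; apply/seteqP; split=> y /= my.
  by rewrite -(subrK (lam i) y) -addrA; apply: idealD.
rewrite -(subrK (lam j) y) -addrA; apply: idealD => //.
by rewrite -opprB; apply: idealN.
Qed.

Definition is_residue_sequence (lam : nat -> R) :=
  forall i j, i <> j -> ~ m (lam i - lam j).

Section Sequence.
Variables (lam : nat -> R) (lamP : is_residue_sequence lam).
Variables (x y : R) (xy : params x y).

Definition line i := x - lam i * y.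

Lemma line_params i : params (line i) y.
Proof.
have := @parameters_det _ _ R_reg x y 1 (- lam i) 0 1 xy.
rewrite !mul1r !mul0r add0r mulNr mulr0 oppr0 subr0 mulNr; apply.
exact: maximal1 R_loc.
Qed.

Lemma line_params2 i j : i <> j -> params (line i) (line j).
Proof.
move=> ij; have := @parameters_det _ _ R_reg x y 1 (- lam i) 1 (- lam j) xy.
by rewrite !mul1r !mulNr mulr1 opprK addrC; apply; apply: lamP.
Qed.

(** The leading form of [f] has finitely many roots. If the line [a] is one, then [f = g * line a]
    modulo [m^(n+2)] with [g] of order exactly [n], and any other line tangent to [f] is tangent to
    [g]. *)
Lemma transversal_eventually n f : mpow n f -> ~ mpow n.+1 f ->
  exists i0, forall i, (i0 <= i)%N -> ~ transv (line i) n.+1 f.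
Proof.
elim: n f => [|n IH] f fn nfn.
  exists 0%N => i _ /ideal_addP [_ [b [[a ->] mb fE]]]; apply: nfn.
  rewrite mpow1 in mb * => //; rewrite fE; apply: idealD => //.
  by apply: idealM => //; apply: parameters_l (line_params i).
have [[a fa]|none] := pselect (exists a, transv (line a) n.+2 f); last first.
  by exists 0%N => i _ fi; apply: none; exists i.
have [g [c [gn fE]]] := mpowS_split (line_params a) fn.
have mc : m c.
  apply: contrapT => /(unit_param_pow_notin_transv R_reg (line_params a)) nc.
  apply: (nc n.+1); rewrite (_ : _ * _ = f - g * line a); last by rewrite fE; ring.
  by apply: (idealB (transv_ideal _ _ _)) => //; apply: transv_mulx.
have cn : mpow n.+2 (c * y ^+ n.+1).
  by apply: mem_ideal_expS => //; apply: ideal_expX; apply: parameters_r xy.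
have ngn : ~ mpow n.+1 g.
  move=> gn1; apply: nfn; rewrite fE mulrC; apply: ideal_expD => //.
  by apply: mem_ideal_expS => //; apply: parameters_l (line_params a).
have [i0 Hi0] := IH g gn ngn.
exists (maxn i0 a.+1) => i; rewrite geq_max => /andP[i0i ai] fi.
apply: (Hi0 i i0i); apply: (@transv_cancel _ _ R_reg _ (line a)).
  by apply: line_params2 => ia; move: ai; rewrite ia ltnn.
rewrite (_ : _ * _ = f - c * y ^+ n.+1); last by rewrite fE; ring.
apply: (idealB (transv_ideal _ _ _)) => //; exact: transv_mpow.
Qed.

End Sequence.

Lemma transversal_form x y n f : params x y -> mpow n f -> ~ transv x n.+1 f ->
  exists a u, ~ m u /\ f = a * x + u * y ^+ n.
Proof.
move=> xy fn nf; have /(transvP xy) [a [u fE]] := transv_mpow x fn.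
exists a, u; split=> // mu; apply: nf; rewrite fE.
apply: (idealD (transv_ideal _ _ _)); first exact: transv_mulx.
apply: transv_mpow; apply: mem_ideal_expS => //; apply: ideal_expX.
exact: parameters_r xy.
Qed.

(** A line [z] transversal to both [f] and [g] exists, since each excludes only finitely many lines.
    Modulo [z] the orders become exponents of [y], and these add up. *)
Lemma order_mul_exact i j f g : mpow i f -> ~ mpow i.+1 f ->
  mpow j g -> ~ mpow j.+1 g -> ~ mpow (i + j).+1 (f * g).
Proof.
move=> fi nfi gj ngj.
have [lam lamP] := residue_sequence; have [x [y xy]] := parameters_exist R_reg.
have [k kP] := transversal_eventually lamP xy fi nfi.
have [l lP] := transversal_eventually lamP xy gj ngj.
pose z := line lam x y (maxn k l); have zy : params z y by apply: line_params.
have [a [u [nmu fE]]] := transversal_form zy fi (kP _ (leq_maxl k l)).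
have [b [v [nmv gE]]] := transversal_form zy gj (lP _ (leq_maxr k l)).
move=> /(transv_mpow z) fg.
apply: (@unit_param_pow_notin_transv _ _ R_reg z y zy (u * v) (i + j)).
  by move=> /(maximal_prime R_noeth R_loc) [].
rewrite (_ : _ * _ = f * g - (a * b * z + a * v * y ^+ j + b * u * y ^+ i) * z).
  by apply: (idealB (transv_ideal _ _ _)) => //; apply: transv_mulx.
by rewrite fE gE exprD; ring.
Qed.

Lemma order_split i f : ~ mpow i.+1 f ->
  exists2 j, (j <= i)%N & mpow j f /\ ~ mpow j.+1 f.
Proof.
elim: i => [|i IH] nf; first by exists 0%N.
have [fi|/IH [j ji jf]] := pselect (mpow i.+1 f); first by exists i.+1.
by exists j => //; apply: leqW.
Qed.

Lemma order_mul i j f g :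
  ~ mpow i.+1 f -> ~ mpow j.+1 g -> ~ mpow (i + j).+1 (f * g).
Proof.
move=> /order_split [k ki [fk nfk]] /order_split [l lj [gl ngl]] fg.
apply: (order_mul_exact fk nfk gl ngl); apply: ideal_exp_sub fg.
by rewrite ltnS leq_add.
Qed.

Lemma regular_integral (a b : R) : a * b = 0 -> a = 0 \/ b = 0.
Proof.
move=> ab0; apply: contrapT => /not_orP [/(order_exists R_reg) [i [_ ai]]].
move=> /(order_exists R_reg) [j [_ bj]]; apply: (order_mul ai bj).
by rewrite ab0; apply: ideal0.
Qed.

Lemma mulfI_regular (a b c : R) : a <> 0 -> a * b = a * c -> b = c.
Proof.
move=> a0 /eqP; rewrite -subr_eq0 -mulrBr => /eqP /regular_integral [] // /eqP.
by rewrite subr_eq0 => /eqP.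
Qed.

Lemma regular_prod_neq0 (T : Type) (s : seq T) (F : T -> R) :
  (forall i, F i <> 0) -> \prod_(i <- s) F i <> 0.
Proof.
move=> F0; elim: s => [|i s IH]; first by rewrite big_nil; apply/eqP/oner_neq0.
by rewrite big_cons => /regular_integral [/F0|/IH].
Qed.

Lemma regular_expr_neq0 (a : R) n : a <> 0 -> a ^+ n <> 0.
Proof.
move=> a0; elim: n => [|n IH]; first exact/eqP/oner_neq0.
by rewrite exprS => /regular_integral [/a0|/IH].
Qed.

Lemma mpow_cancel n s x : ~ mpow 2 x -> mpow n.+1 (s * x) -> mpow n s.
Proof.
move=> nx; case: n => // n sx; apply: contrapT => ns.
by apply: (order_mul ns nx); rewrite addn1.
Qed.

Lemma param_neq0 x y : params x y -> x <> 0.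
Proof. by move=> /(param_notin_mpow2 R_reg) nx x0; apply: nx; rewrite x0; apply: ideal0. Qed.

Lemma params_regular x y a b : params x y -> a * x = b * y ->
  exists c, a = c * y /\ b = c * x.
Proof.
move=> xy ab; have [|[c bE]|/(param_notin_principal R_reg xy) //] :=
  principal_prime R_reg xy (r := b) (s := y); first by exists a.
exists c; split=> //; apply: (mulfI_regular (param_neq0 xy)).
by rewrite mulrC ab bE; ring.
Qed.

Lemma params_regular_exp x y k a b : params x y -> a * x ^+ k = b * y ->
  exists c, a = c * y.
Proof.
move=> xy; elim: k b => [|k IH] b; first by rewrite mulr1 => ->; exists b.
rewrite exprS mulrCA mulrC => /(params_regular xy) [c [aE _]].
exact: IH aE.
Qed.

Lemma params_regular_exp2 x y k l a b : params x y -> a * x ^+ k = b * y ^+ l ->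
  exists c, a = c * y ^+ l.
Proof.
move=> xy; elim: l a b => [|l IH] a b; first by move=> _; exists a; rewrite mulr1.
move=> ab; have [|a' aE] := @params_regular_exp x y k a (b * y ^+ l) xy.
  by rewrite ab exprS; ring.
have [|c a'E] := IH a' b; last by exists c; rewrite aE a'E exprSr mulrA.
apply: (mulfI_regular (param_neq0 (parameters_sym xy))).
transitivity (a * x ^+ k); first by rewrite aE; ring.
by rewrite ab exprS; ring.
Qed.

Section Primary.
Variables (I : set R) (I_prim : primary_to m I).

Lemma primary_ideal_ideal : ideal I.
Proof. by case: I_prim => -[[]]. Qed.

Lemma primary_pow x : m x -> exists n, I (x ^+ n).
Proof. by move=> mx; case: I_prim => _ IE; move: mx; rewrite -IE. Qed.

Lemma primary_mpow : exists n, mpow n `<=` I.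
Proof.
have [x [y xy]] := parameters_exist R_reg.
have [k Ik] := primary_pow (parameters_l xy).
have [l Il] := primary_pow (parameters_r xy).
by exists (k + l)%N; apply: (mpow_sub_of_pow xy primary_ideal_ideal).
Qed.

Lemma primary_nonzero : exists2 a, I a & a <> 0.
Proof.
have [x [y xy]] := parameters_exist R_reg.
have [k Ik] := primary_pow (parameters_l xy); exists (x ^+ k) => //.
exact/regular_expr_neq0/param_neq0/xy.
Qed.

End Primary.
End InfiniteResidueField.

(** * Integral dependence *)

Definition subring (B : comNzRingType) (S : set B) :=
  [/\ S 1, forall a b, S a -> S b -> S (a - b)
    & forall a b, S a -> S b -> S (a * b)].

Section Subring.
Variables (B : comNzRingType) (S : set B) (S_ring : subring S).

Lemma subring0 : S 0.
Proof. by case: S_ring => S1 SB _; rewrite -(subrr 1); apply: SB. Qed.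

Lemma subringN a : S a -> S (- a).
Proof. by move=> Sa; case: S_ring => _ SB _; rewrite -sub0r; apply/SB/Sa/subring0. Qed.

Lemma subringD a b : S a -> S b -> S (a + b).
Proof.
by move=> Sa Sb; case: S_ring => _ SB _; rewrite -[b]opprK; apply/SB => //; apply: subringN.
Qed.

Lemma subringM a b : S a -> S b -> S (a * b).
Proof. by case: S_ring => _ _; apply. Qed.

Lemma subring1 : S 1.
Proof. by case: S_ring. Qed.

Lemma subring_sum (T : Type) (s : seq T) (P : pred T) (F : T -> B) :
  (forall i, P i -> S (F i)) -> S (\sum_(i <- s | P i) F i).
Proof. by move=> SF; apply: big_ind => //; [apply: subring0 | apply: subringD]. Qed.

Lemma subring_poly : subring [set p : {poly B} | forall i, S p`_i].
Proof.
split=> [i|p q Sp Sq i|p q Sp Sq i] /=.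
- by rewrite coef1; case: (i == 0%N); [apply: subring1|apply: subring0].
- by rewrite coefB; case: S_ring => _ SB _; apply: SB.
- by rewrite coefM; apply: subring_sum => j _; apply: subringM.
Qed.

End Subring.

Lemma subring_prod (B : comNzRingType) (S : set B) (T : Type) (s : seq T) (P : pred T) (F : T -> B) :
  subring S -> (forall i, P i -> S (F i)) -> S (\prod_(i <- s | P i) F i).
Proof.
by move=> S_ring SF; apply: big_ind => //; [apply: subring1 | apply: subringM].
Qed.

Lemma subring_det (B : comNzRingType) (S : set B) n (A : 'M[B]_n) :
  subring S -> (forall i j, S (A i j)) -> S (\det A).
Proof.
move=> S_ring SA; apply: subring_sum => // s _; apply: subringM => //.
  rewrite -signr_odd; case: (odd _); rewrite /= ?expr0 ?expr1; last exact: subring1.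
  by apply: subringN => //; apply: subring1.
by apply: subring_prod.
Qed.

(** Only the matrix entries have to lie in [S]; the [d i] may be anywhere in [B]. The adjugate of
    [b - A] shows that the characteristic polynomial at [b] kills every [d i], and one of them is a
    nonzerodivisor. Both the Rees algebra of an ideal and the algebra of forms of a module are used
    as [S]. *)
Lemma determinant_trick (B : comNzRingType) (S : set B) n (d : 'I_n -> B)
    (b : B) (s : 'I_n -> 'I_n -> B) :
  subring S -> (forall i j, S (s i j)) ->
  (forall i, b * d i = \sum_j s i j * d j) ->
  (exists i, forall p, p * d i = 0 -> p = 0) ->
  exists p : {poly B}, [/\ p \is monic, forall i, S p`_i & root p b].
Proof.
move=> S_ring Ss bd [i0 di0].
pose A : 'M[B]_n := \matrix_(i, j) s i j.
exists (char_poly A); split; first exact: char_poly_monic.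
  apply: (subring_det (subring_poly S_ring)) => i j k.
  rewrite !mxE coefB coefC coefMn coefX.
  have [S1 SB SM] := S_ring; have S0 := subring0 S_ring; apply: SB.
    by case: (i == j); case: (k == 1%N); rewrite ?mulr1n ?mulr0n.
  by case: (k == 0%N).
apply/eqP; rewrite /char_poly.
have -> : (\det (char_poly_mx A)).[b] = \det (b%:M - A).
  rewrite -/(horner_eval b _) -det_map_mx; congr (\det _).
  by apply/matrixP => i j; rewrite !mxE /= /horner_eval hornerD hornerN hornerMn hornerX hornerC.
apply: di0; pose D : 'cV[B]_n := \col_i d i.
have : (b%:M - A) *m D = 0.
  apply/matrixP => i j; rewrite mulmxBl mul_scalar_mx !mxE bd.
  by apply/eqP; rewrite subr_eq0; apply/eqP; apply: eq_bigr => k _; rewrite !mxE.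
move=> /(congr1 (mulmx (\adj (b%:M - A)))).
rewrite mulmxA mul_adj_mx mulmx0 mul_scalar_mx => /matrixP /(_ i0 0).
by rewrite !mxE.
Qed.

(** * Integral dependence on an ideal through its Rees algebra *)

Section IntegralIdeal.
Variable R : comNzRingType.
Implicit Types I J A : set R.

(** The Rees algebra inside [R[T]]: integrality of [a] over [I] becomes integrality of [a T] over
    this subring. *)
Definition rees I : set {poly R} := [set q | forall i, ideal_exp I i q`_i].

Lemma rees_subring I : subring (rees I).
Proof.
split=> [i|p q Ip Iq i|p q Ip Iq i].
- by rewrite coef1; case: i => [|i] //; apply: (ideal0 (ideal_exp_ideal I i.+1)).
- by rewrite coefB; exact: (idealB (ideal_exp_ideal _ _) (Ip i) (Iq i)).
- rewrite coefM; apply: ideal_sum => [|j _]; first exact: ideal_exp_ideal.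
  by have := ideal_exp_mul (Ip j) (Iq (i - j)%N); rewrite subnKC // -ltnS.
Qed.

Lemma rees_monomial I a : ideal I -> I a -> rees I (a%:P * 'X).
Proof.
move=> I_id Ia i; rewrite coefMX coefC; case: i => [|[|i]] //=.
  by rewrite -[X in X _]/(ideal_exp I 1) ideal_exp1.
exact: (ideal0 (ideal_exp_ideal I i.+2)).
Qed.

Lemma rees_polyC I a : rees I a%:P.
Proof.
by move=> [|i]; rewrite coefC //=; apply: (ideal0 (ideal_exp_ideal I i.+1)).
Qed.

(* The coefficient of ['X^n] in a monic equation of degree [n] for [a 'X] over
   the Rees algebra is an equation of integral dependence for [a]. *)
Lemma rees_integral I a (p : {poly {poly R}}) :
  p \is monic -> (forall i, rees I p`_i) -> root p (a%:P * 'X) ->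
  integral_over_ideal I a.
Proof.
move=> p_monic Ip /eqP pa.
have p0 : (0 < size p)%N by rewrite size_poly_gt0 monic_neq0.
pose n := (size p).-1; have sp : size p = n.+1 by rewrite prednK.
have n0 : (0 < n)%N.
  rewrite lt0n; apply/eqP => n0; move: pa.
  have p1 : p = 1.
    have := p_monic; rewrite (size1_polyC (p := p)) ?sp ?n0 // monicE lead_coefC.
    by move/eqP ->.
  by rewrite p1 hornerC => /eqP; rewrite oner_eq0.
exists n => //; exists (fun i => (p`_(n - i))`_i) => [i _|]; first exact: Ip.
move: pa => /(congr1 (fun q : {poly R} => q`_n)).
rewrite horner_coef sp coef0 big_ord_recr /= coefD coef_sum.
have term i : (i <= n)%N -> (p`_i * (a%:P * 'X) ^+ i)`_n = (p`_i)`_(n - i) * a ^+ i.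
  move=> lein; rewrite exprMn -polyC_exp mulrA coefMXn ltnNge lein /=.
  by rewrite mulrC coefCM mulrC.
have -> : p`_n = 1 by move/monicP: p_monic; rewrite /lead_coef.
rewrite mul1r exprMn -polyC_exp coefCM coefXn eqxx mulr1 addrC => pa; rewrite -[RHS]pa.
congr (_ + _); rewrite big_add1 /= -(big_mkord xpredT (fun i => (p`_i * (a%:P * 'X) ^+ i)`_n)).
rewrite big_nat_rev [LHS]big_nat [RHS]big_nat; apply: eq_bigr => i /= lt_in.
rewrite add0n term; last by lia.
have -> : (n - (n - i.+1).+1 = i)%N by lia.
by have -> : ((n - i.+1).+1 = n - i)%N by lia.
Qed.

Lemma ideal_mul_fg I A n (d : 'I_n -> R) z : ideal I ->
  (forall r, A r -> exists c : 'I_n -> R, r = \sum_i c i * d i) ->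
  ideal_mul I A z -> exists2 c : 'I_n -> R, (forall i, I (c i)) & z = \sum_i c i * d i.
Proof.
move=> I_id Ad; suff: ideal_mul I A `<=`
  [set z | exists2 c : 'I_n -> R, (forall i, I (c i)) & z = \sum_i c i * d i] by apply.
apply: ideal_mul_min => [|a r Ia /Ad [c ->]]; last first.
  exists (fun i => a * c i) => [i|]; first exact: idealMC.
  by rewrite mulr_sumr; apply: eq_bigr => i _; rewrite mulrA.
apply/idealP; split=> [|a _ _ [c Ic ->] [c' Ic' ->]].
  exists (fun=> 0) => [i|]; first exact: ideal0.
  by rewrite big1 // => i _; rewrite mul0r.
exists (fun i => a * c i + c' i) => [i|]; first by apply: idealD => //; apply: idealM.
by rewrite mulr_sumr -big_split; apply: eq_bigr => i _ /=; ring.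
Qed.

(** On generators [d] of [A], multiplication by [r] has a matrix with entries in [I], so
    multiplication by [r T] has one over the Rees algebra. A nonzero [A] over a domain supplies the
    regular [d i]. *)
Lemma integral_of_stable I A r : noetherian R ->
  (forall a b : R, a * b = 0 -> a = 0 \/ b = 0) ->
  ideal I -> ideal A -> (exists2 a, A a & a <> 0) ->
  (forall a, A a -> ideal_mul I A (r * a)) -> integral_over_ideal I r.
Proof.
move=> R_noeth dom I_id A_id [a0 Aa0 a0N] rA.
have [n [d [Ad dA]]] := noetherian_fg R_noeth A_id.
have /choice[s sP] : forall i, exists s : 'I_n -> R,
    (forall j, I (s j)) /\ r * d i = \sum_j s j * d j.
  by move=> i; have [s Is E] := ideal_mul_fg I_id dA (rA _ (Ad i)); exists s.
have [|i j|i||p [p_monic Ip pr]] := @determinant_trick _ (rees I) n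
  (fun i => (d i)%:P) (r%:P * 'X) (fun i j => (s i j)%:P * 'X).
- exact: rees_subring.
- by apply: rees_monomial => //; case: (sP i).
- rewrite mulrAC -polyCM (proj2 (sP i)) rmorph_sum mulr_suml.
  by apply: eq_bigr => j _; rewrite /= polyCM mulrAC.
- apply: contrapT => no; apply: a0N; have [c ->] := dA _ Aa0.
  rewrite big1 // => i _; have [->|/eqP di] := eqVneq (d i) 0; first by rewrite mulr0.
  case: no; exists i => p pd; apply/polyP => k; rewrite coef0.
  have : (p * (d i)%:P)`_k = 0 by rewrite pd coef0.
  by rewrite coefMC => /dom [].
exact: rees_integral pr.
Qed.

End IntegralIdeal.

(** * Integrally closed ideals are contracted *)

Section Contracted.
Variables (R : comNzRingType) (m : set R) (R_reg : regular_local_ring m 2).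
Hypothesis R_inf : infinite_residue_field m.

Let R_noeth : noetherian R. Proof. by case: R_reg. Qed.
Let R_loc : local_ring m. Proof. by case: R_reg. Qed.

Local Notation mpow := (ideal_exp m).

Section Lines.
Variable mu : nat -> R.
Hypothesis mu_params : forall i j, i <> j -> parameters m (mu i) (mu j).

Let mmu i : m (mu i).
Proof. by apply: (parameters_l (y := mu i.+1)); apply: mu_params; lia. Qed.

(** These [N + 1] products behave like a Lagrange basis of the binary forms of degree [N]: modulo
    the line [mu i] with [i <= N], only the one omitting it survives. *)
Definition omit N j := \prod_(0 <= i < N.+1 | i != j) mu i.

Lemma omitS N j : j != N.+1 -> omit N.+1 j = omit N j * mu N.+1.
Proof.
by move=> jN; rewrite /omit big_mkcond big_nat_recr //= -big_mkcond eq_sym jN.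
Qed.

Lemma omit_last N j : (j <= N)%N -> omit N.+1 N.+1 = mu j * omit N j.
Proof.
move=> jN; rewrite /omit big_mkcond big_nat_recr //= eqxx mulr1 -big_mkcond.
transitivity (\prod_(0 <= i < N.+1) mu i).
  by rewrite big_nat_cond [RHS]big_nat; apply: eq_bigl => i; lia.
by rewrite (bigD1_seq j) ?mem_index_iota ?iota_uniq.
Qed.

Lemma omit_mpow N j : (j <= N)%N -> mpow N (omit N j).
Proof.
elim: N j => [|N IH] j jN; first by [].
have [->|jN1] := eqVneq j N.+1.
  by rewrite (@omit_last N 0) //; apply: mem_ideal_expS => //; apply: IH.
by rewrite omitS // mulrC; apply: mem_ideal_expS => //; apply: IH; lia.
Qed.

(** The induction runs through the quotients [(E : z)]. Writing [z] in terms of [mu j] and [mu N.+1]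
    turns [z * omit N j] into a combination of the products of level [N + 1] omitting [N + 1] and
    [j]. *)
Lemma mpow_sub_of_omit N (E : set R) : ideal E ->
  (forall j, (j <= N)%N -> E (omit N j)) -> mpow N `<=` E.
Proof.
elim: N E => [|N IH] E E_id Eo.
  have := Eo 0%N isT; rewrite /omit big_mkcond big_nat1 /= => E1 r _.
  by rewrite -[r]mulr1; apply: idealM.
apply: ideal_mul_min => // z r mz; rewrite mulrC.
suff: mpow N `<=` colon E z by apply.
apply: IH => [|j jN]; first exact: colon_ideal.
have jN1 : j <> N.+1 by lia.
have [a [b ->]] := proj1 (mu_params jN1 z) mz.
rewrite /colon /= (_ : _ * _ =
  a * (mu j * omit N j) + b * (omit N j * mu N.+1)); last by ring.
rewrite -omit_last // -omitS; last exact/eqP.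
by apply: idealD => //; apply: idealM => //; apply: Eo; lia.
Qed.

End Lines.

Variables (I : set R) (I_prim : primary_to m I) (I_closed : integrally_closed_ideal I).

Definition colon_max : set R := [set r | forall z, m z -> I (r * z)].

Lemma colon_max_ideal : ideal colon_max.
Proof.
have I_id := primary_ideal_ideal I_prim.
apply/idealP; split=> [z _|a u v Lu Lv z mz].
  by rewrite mul0r; apply: ideal0.
rewrite mulrDl -mulrA; apply: idealD => //; first by apply: idealM => //; apply: Lu.
exact: Lv.
Qed.

(* If every line [mu i] has a [v i] with [v i * mu i] in [I] but [v i] not in
   [I : m], then some [v N] lies in [(I : m) + (v 0, ..., v (N - 1))]. The products
   omitting one line span [m ^ N], so [v N m m^N <= I m^N] and [v N m] is integral
   over [I]. *)
Lemma contracted_line lam x y i0 : is_residue_sequence m lam -> parameters m x y ->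
  exists2 i, (i0 <= i)%N & forall v, I (v * line lam x y i) -> colon_max v.
Proof.
move=> lamP xy; apply: contrapT => no.
have I_id := primary_ideal_ideal I_prim; have L_id := colon_max_ideal.
pose mu j := line lam x y (i0 + j).
have mu_params i j : i <> j -> parameters m (mu i) (mu j).
  by move=> ij; apply: line_params2 => //; lia.
have /choice[v vP] : forall j, exists v, I (v * mu j) /\ ~ colon_max v.
  move=> j; apply: contrapT => nov; apply: no; exists (i0 + j)%N; first exact: leq_addr.
  by move=> v Iv; apply: contrapT => Lv; apply: nov; exists v.
pose F n := [set r | exists l (c : nat -> R), colon_max l /\
   r = l + \sum_(0 <= i < n) c i * v i].
have [n|n r [l [c [Ll ->]]]|N NP] := @noetherian_chain _ R_noeth F.
- apply/idealP; split.
    exists 0, (fun=> 0); split; first exact: (ideal0 L_id).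
    by rewrite add0r big1 // => i _; rewrite mul0r.
  move=> a _ _ [l [c [Ll ->]]] [l' [c' [Ll' ->]]].
  exists (a * l + l'), (fun i => a * c i + c' i); split.
    exact: (idealD L_id (idealM _ L_id Ll) Ll').
  rewrite mulrDr mulr_sumr addrACA -big_split; congr (_ + _).
  by apply: eq_bigr => i _ /=; ring.
- exists l, (fun i => if (i < n)%N then c i else 0); split=> //.
  rewrite big_nat_recr //= ltnn mul0r addr0; congr (_ + _).
  by apply: eq_big_nat => i /= ->.
have [l [c [Ll vE]]] : F N (v N).
  apply: (NP N.+1); exists 0, (fun i => (i == N)%:R); split; first exact: (ideal0 L_id).
  rewrite big_nat_recr //= eqxx mul1r big_nat big1 ?add0r // => i /= iN.
  by rewrite (ltn_eqF iN) mul0r.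
case: (vP N) => _; apply=> z mz; case: (I_closed) => _ <-.
have mN_nz : exists2 a, mpow N a & a <> 0.
  have [x' [y' xy']] := parameters_exist R_reg.
  exists (x' ^+ N); first by apply: ideal_expX; apply: parameters_l xy'.
  exact/(regular_expr_neq0 R_reg R_inf)/(param_neq0 R_reg xy').
apply: (@integral_of_stable _ I (mpow N)) => //.
  exact: regular_integral R_reg R_inf.
have E_id := ideal_mul_ideal I (mpow N).
have mE : forall a b, I a -> mpow N b -> ideal_mul I (mpow N) (a * b).
  by move=> a b; apply: mem_ideal_mul.
suff: mpow N `<=` colon (ideal_mul I (mpow N)) (v N * z).
  by move=> sub a /sub; rewrite /colon /= mulrC.
apply: (mpow_sub_of_omit mu_params) => [|j jN]; first exact: colon_ideal.
rewrite /colon /=.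
(* A product omitting another line still contains [mu N], which carries [v N] into [I]. *)
have small k : (k < N)%N -> ideal_mul I (mpow N) (v N * z * omit mu N N) ->
    ideal_mul I (mpow N) (v N * z * omit mu N k).
  move=> kN _; case: N {NP vE mN_nz E_id jN} kN mE => // N kN mE.
  rewrite omitS; last by apply/eqP; lia.
  rewrite (_ : _ * _ = (v N.+1 * mu N.+1) * (z * omit mu N k)); last by ring.
  by apply: mE; [case: (vP N.+1)|apply: mem_ideal_expS => //; apply: omit_mpow].
(* Here [mu N] is missing, so [v N] is replaced by its expression in [F N]: each [v i] with [i < N]
   meets its own factor [mu i], and the part in [I : m] meets [z]. *)
have last : ideal_mul I (mpow N) (v N * z * omit mu N N).
  rewrite vE !mulrDl !mulr_suml; apply: (idealD E_id).
    by apply: mE; [apply: Ll|apply: omit_mpow].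
  rewrite big_nat; apply: (@ideal_sum _ _ _ _ _ _ E_id) => i /= iN.
  case: N {NP vE mN_nz E_id jN small} iN mE => // N iN mE.
  rewrite (@omit_last mu N i) //.
  rewrite (_ : _ * _ = c i * ((v i * mu i) * (z * omit mu N i))); last by ring.
  apply: (idealM _ (ideal_mul_ideal _ _)); apply: mE; first by case: (vP i).
  by apply: mem_ideal_expS => //; apply: omit_mpow.
rewrite mulrC; have [jN'|jN'] := ltnP j N; first exact: small.
by have -> : j = N by apply/eqP; rewrite eqn_leq jN.
Qed.

End Contracted.

(** * Submodules of the plane and their minors *)

Section Plane.
Variable R : comNzRingType.
Implicit Types (u v w : 'cV[R]_2) (N : set 'cV[R]_2).

Definition vec (a b : R) : 'cV[R]_2 := \col_i (if i == 0 then a else b).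

Lemma vec0E a b : vec a b 0 0 = a. Proof. by rewrite mxE. Qed.
Lemma vec1E a b : vec a b 1 0 = b. Proof. by rewrite mxE. Qed.

Lemma ord2P (i : 'I_2) : i = 0 \/ i = 1.
Proof. by case: i => [[|[|//]] ?]; [left|right]; apply: val_inj. Qed.

Lemma vecP u v : u 0 0 = v 0 0 -> u 1 0 = v 1 0 -> u = v.
Proof.
move=> uv0 uv1; apply/matrixP => i j; rewrite (ord1 j).
by case: (ord2P i) => ->.
Qed.

Definition det2 u v : R := u 0 0 * v 1 0 - u 1 0 * v 0 0.

Lemma det2vv v : det2 v v = 0.
Proof. by rewrite /det2; ring. Qed.

Lemma det2N u v : det2 u v = - det2 v u.
Proof. by rewrite /det2; ring. Qed.

Lemma det2Zl a u w : det2 (a *: u) w = a * det2 u w.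
Proof. by rewrite /det2 !mxE; ring. Qed.

Lemma det2Dr u v w : det2 w (u + v) = det2 w u + det2 w v.
Proof. by rewrite /det2 !mxE; ring. Qed.

Lemma det2Zr a u w : det2 w (a *: u) = a * det2 w u.
Proof. by rewrite /det2 !mxE; ring. Qed.

Lemma cramer2 u v w : det2 u v *: w = det2 w v *: u + det2 u w *: v.
Proof. by apply: vecP; rewrite !mxE /det2; ring. Qed.

Lemma det_mx2 (M : 'M[R]_2) : \det M = M 0 0 * M 1 1 - M 1 0 * M 0 1.
Proof.
rewrite (expand_det_row _ 0) big_ord_recl big_ord1 /cofactor !det_mx11 !mxE.
have -> : lift 0 0 = 1 :> 'I_2 by apply: val_inj.
have -> : lift 1 0 = 0 :> 'I_2 by apply: val_inj.
by rewrite /= expr0 expr1; ring.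
Qed.

(** Formed from all pairs of elements, hence independent of generators; [max_minors_idealE] compares
    it with the minors of a matrix. *)
Definition minors_ideal N : set R :=
  ideal_span [set d | exists u w, [/\ N u, N w & d = det2 u w]].

Lemma mem_minors N u w : N u -> N w -> minors_ideal N (det2 u w).
Proof. by move=> Nu Nw; apply: sub_ideal_span; exists u, w. Qed.

Lemma minors_min N I : ideal I -> (forall u w, N u -> N w -> I (det2 u w)) ->
  minors_ideal N `<=` I.
Proof. by move=> I_id NI; apply: ideal_span_min => // _ [u [w [Nu Nw ->]]]; apply: NI. Qed.

(** The orthogonal of [N] for the alternating form [det2] read modulo [I]. It contains [N] when [I]
    is the ideal of minors, so the inclusion in [N] says that [N] is its own orthogonal. *)
Definition isotropic_to I N : set 'cV[R]_2 :=
  [set v | forall w, N w -> I (det2 v w)].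

Lemma isotropic_to_span I (X : set 'cV[R]_2) v : ideal I ->
  (forall w, X w -> I (det2 v w)) -> forall w, submod_span X w -> I (det2 v w).
Proof.
move=> I_id Xv; suff: submod_span X `<=` [set w | I (det2 v w)] by [].
apply: submod_span_min => //; apply/submoduleP; split=> [|a u w /= Iu Iw].
  by rewrite /= /det2 !mxE !mulr0 subr0; apply: ideal0.
by rewrite /= det2Dr det2Zr; apply: idealD => //; apply: idealM.
Qed.

Lemma max_minors_idealE n (A : 'M[R]_(2, n)) :
  max_minors_ideal A = minors_ideal (submod_span (range (fun j => col j A))).
Proof.
have I_id := ideal_spanP [set d | exists2 f : 'I_2 -> 'I_n,
    {homo f : i j / (i < j)%N} & d = \det (colsub f A)].
have detE (f : 'I_2 -> 'I_n) : \det (colsub f A) = det2 (col (f 0) A) (col (f 1) A).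
  by rewrite det_mx2 /det2 !mxE; ring.
apply/seteqP; split.
  apply: ideal_span_min; first exact: ideal_spanP.
  move=> _ [f _ ->]; rewrite detE; apply: mem_minors; apply: sub_submod_span.
    by exists (f 0).
  by exists (f 1).
apply: minors_min => // u w Xu Xw.
apply: (isotropic_to_span I_id _ Xw) => _ [j _ <-].
rewrite det2N; apply: (idealN I_id); apply: (isotropic_to_span I_id _ Xu) => _ [i _ <-].
have lt_minor (i' j' : 'I_n) : (i' < j')%N -> max_minors_ideal A (det2 (col i' A) (col j' A)).
  move=> ij; apply: sub_ideal_span; exists (fun k : 'I_2 => if k == 0 then i' else j').
    by move=> [[|[|//]] ?] [[|[|//]] ?].
  by rewrite detE.
case: (ltngtP i j) => [ij|ij|/val_inj ->]; last by rewrite det2vv; apply: (ideal0 I_id).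
  by rewrite det2N; apply: (idealN I_id); apply: lt_minor.
exact: lt_minor.
Qed.

(** The counterpart of [form_algebra] for a submodule given directly in the plane. *)
Definition forms_algebra N : set (mpoly 2 R) :=
  smallest (fun S : set (mpoly 2 R) => subalg_closed [in S]) (@linear_form R 2 @` N).

Lemma subalg_closedP (S : set (mpoly 2 R)) : subalg_closed [in S] <->
  [/\ S 1, forall a p q, S p -> S q -> S (a *: p + q) &
      forall p q, S p -> S q -> S (p * q)].
Proof.
split=> -[S1 SL SM]; split.
- by move: S1; rewrite in_setE.
- by move=> a p q Sp Sq; have := SL a p q; rewrite !in_setE; apply.
- by move=> p q Sp Sq; have := SM p q; rewrite !in_setE; apply.
- by rewrite in_setE.
- by move=> a p q; rewrite !in_setE; apply: SL.
- by move=> p q; rewrite !in_setE; apply: SM.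
Qed.

Lemma forms_algebra_subalg N : subalg_closed [in forms_algebra N].
Proof.
apply/subalg_closedP; split=> [S [/subalg_closedP [] //]|a p q Sp Sq S NS|p q Sp Sq S NS].
  have := NS => -[/subalg_closedP [_ SL _] _]; apply: SL; [exact: Sp|exact: Sq].
have := NS => -[/subalg_closedP [_ _ SM] _]; apply: SM; [exact: Sp|exact: Sq].
Qed.

Lemma forms_algebra_subring N : subring (forms_algebra N).
Proof.
have /subalg_closedP [S1 SL SM] := forms_algebra_subalg N.
split=> // a b Sa Sb; rewrite addrC -scaleN1r; exact: SL.
Qed.

Lemma linear_formD u v : linear_form (u + v) = linear_form u + linear_form v.
Proof. by rewrite -big_split; apply: eq_bigr => i _; rewrite mxE scalerDl. Qed.

Lemma linear_formZ a v : linear_form (a *: v) = a *: linear_form v.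
Proof. by rewrite scaler_sumr; apply: eq_bigr => i _; rewrite mxE scalerA. Qed.

Lemma linear_form_sum n (F : 'I_n -> 'cV[R]_2) :
  linear_form (\sum_i F i) = \sum_i linear_form (F i).
Proof.
elim: n F => [|n IH] F; last by rewrite !big_ord_recl linear_formD IH.
by rewrite !big_ord0; apply: big1 => i _; rewrite mxE scale0r.
Qed.

Definition integral_over_forms N v := exists p : {poly mpoly 2 R},
  [/\ p \is monic, forall i, forms_algebra N p`_i & root p (linear_form v)].

(* By Cramer's rule [I v <= I N], so the determinant trick applies. *)
Lemma integral_of_isotropic N v : noetherian R ->
  (forall a b : R, a * b = 0 -> a = 0 \/ b = 0) -> submodule N ->
  (exists2 a, minors_ideal N a & a <> 0) ->
  isotropic_to (minors_ideal N) N v -> integral_over_forms N v.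
Proof.
move=> R_noeth dom N_sub [a0 Ia0 a0N] Nv.
have [n [d [Id dI]]] := noetherian_fg R_noeth (ideal_spanP _ : ideal (minors_ideal N)).
pose E := [set a : R | exists2 s : 'I_n -> 'cV[R]_2, (forall j, N (s j)) &
  a *: v = \sum_j d j *: s j].
have E_id : ideal E.
  apply/idealP; split=> [|a b c [s Ns bE] [t Nt cE]].
    exists (fun=> 0) => [j|]; first exact: submod0.
    by rewrite scale0r big1 // => j _; rewrite scaler0.
  exists (fun j => a *: s j + t j) => [j|].
    by apply: submodD => //; apply: submodZ.
  rewrite scalerDl -scalerA bE cE scaler_sumr -big_split; apply: eq_bigr => j _ /=.
  by rewrite scalerDr !scalerA mulrC.
have IE : minors_ideal N `<=` E.
  apply: minors_min => // u w Nu Nw; rewrite /E /= cramer2.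
  have [b bE] := dI _ (Nv w Nw); have [c cE] := dI _ (Nv u Nu).
  exists (fun j => b j *: u - c j *: w) => [j|].
    by apply: submodB => //; apply: submodZ.
  rewrite bE (det2N u v) cE scaleNr !scaler_suml -sumrN -big_split.
  by apply: eq_bigr => j _ /=; rewrite scalerBr !scalerA ![d j * _]mulrC.
have /choice[s sP] : forall i, exists s : 'I_n -> 'cV[R]_2,
    (forall j, N (s j)) /\ d i *: v = \sum_j d j *: s j.
  by move=> i; have [s Ns E'] := IE _ (Id i); exists s.
apply: (@determinant_trick _ (forms_algebra N) n (fun i => mpolyC 2 (d i))
  (linear_form v) (fun i j => linear_form (s i j))).
- exact: forms_algebra_subring.
- move=> i j; apply: sub_gen_smallest; exists (s i j) => //; exact: (proj1 (sP i)).
- move=> i; rewrite mulrC mul_mpolyC -linear_formZ (proj2 (sP i)) linear_form_sum.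
  by apply: eq_bigr => j _; rewrite linear_formZ mulrC mul_mpolyC.
- apply: contrapT => no; apply: a0N; have [c ->] := dI _ Ia0.
  rewrite big1 // => i _; have [->|/eqP di] := eqVneq (d i) 0; first by rewrite mulr0.
  case: no; exists i => p pd; apply/mpolyP => k; rewrite mcoeff0.
  have : mcoeff k (p * mpolyC 2 (d i)) = 0 by rewrite pd mcoeff0.
  by rewrite mulrC mul_mpolyC mcoeffZ => /dom [].
Qed.

(* The functional [det2 _ w] extends to a ring morphism from [R[X_1, X_2]] to
   [R[T]] carrying the algebra of forms of [N] into the Rees algebra of [I]. *)
Lemma isotropic_of_integral N v w : integral_over_forms N v -> N w ->
  integral_over_ideal (minors_ideal N) (det2 v w).
Proof.
case=> p [p_monic Np pv] Nw; have I_id : ideal (minors_ideal N) := ideal_spanP _.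
pose h (i : 'I_2) : {poly R} := (if i == 0 then w 1 0 else - w 0 0)%:P * 'X.
pose psi := mmap (@polyC R) h.
have psiE u : psi (linear_form u) = (det2 u w)%:P * 'X.
  have l1 : lift ord0 ord0 = 1 :> 'I_2 by apply: val_inj.
  rewrite /linear_form big_ord_recl big_ord1 l1 /psi mmapD !mmapZ !mmapX !mmap1U /h /=.
  by rewrite /det2 !polyCB !polyCM polyCN; ring.
have sub : forms_algebra N `<=` [set q | rees (minors_ideal N) (psi q)].
  apply: smallest_sub => [|_ [u Nu <-] /=]; last first.
    by rewrite psiE; apply: rees_monomial => //; apply: mem_minors.
  have S_ring := rees_subring (minors_ideal N).
  apply/subalg_closedP; split=> [|a q r /= Iq Ir|q r /= Iq Ir].
  - by rewrite /= /psi rmorph1; apply: (subring1 S_ring).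
  - rewrite /psi mmapD mmapZ; apply: (subringD S_ring) => //.
    by apply: (subringM S_ring) => //; apply: rees_polyC.
  - by rewrite /psi rmorphM; apply: (subringM S_ring).
apply: (@rees_integral _ _ _ (map_poly psi p)).
- by rewrite (monic_map psi).
- by move=> i; rewrite (coef_map psi) /=; apply: sub; apply: Np.
- by rewrite -psiE; apply: (rmorph_root psi).
Qed.

End Plane.

(** * Torsion-free modules of rank two as submodules of the plane *)

Section SubmoduleType.
Variables (R : comNzRingType) (V : lmodType R) (N : set V) (N_sub : submodule N).

(** Takes the proof of closure as an argument, so that the submodule structure can be attached to
    the predicate. *)
Definition submodule_pred of submodule N : {pred V} := [in N].

HB.instance Definition _ :=
  GRing.isSubmodClosed.Build R V (submodule_pred N_sub) (GRing.submod_closed_semi N_sub).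

Record submodule_type := SubmoduleType {
  submodule_val : V;
  submodule_valP : submodule_val \in submodule_pred N_sub }.

HB.instance Definition _ := [isSub for submodule_val].
HB.instance Definition _ := [Choice of submodule_type by <:].
HB.instance Definition _ := [SubChoice_isSubLmodule of submodule_type by <:].

Lemma submodule_typeP (x : submodule_type) : N (val x).
Proof. by have := submodule_valP x; rewrite in_setE. Qed.

Definition submodule_sub v (Nv : N v) : submodule_type :=
  SubmoduleType (mem_set Nv : v \in submodule_pred N_sub).

End SubmoduleType.

Section PlaneSubmodule.
Variables (R : comNzRingType) (R_noeth : noetherian R).

(** The first projection reduces this to two ideals: generators of the ideal [A] of first
    coordinates are lifted to [N], and the kernel is the ideal [B] in the second coordinate. *)
Lemma plane_fg (N : set 'cV[R]_2) : submodule N ->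
  exists n (e : 'I_n -> 'cV[R]_2), submod_span (range e) = N.
Proof.
move=> N_sub.
pose A := [set a | exists b, N (vec a b)]; pose B := [set b | N (vec 0 b)].
have vecL a b c a' b' : vec (c * a + a') (c * b + b') = c *: vec a b + vec a' b' :> 'cV[R]_2.
  by apply: vecP; rewrite !mxE.
have vec00 : vec 0 0 = 0 :> 'cV[R]_2 by apply: vecP; rewrite !mxE.
have A_id : ideal A.
  apply/idealP; split; first by exists 0; rewrite vec00; apply: submod0.
  move=> c a a' [b Nb] [b' Nb']; exists (c * b + b'); rewrite vecL.
  by apply: submodD => //; apply: submodZ.
have B_id : ideal B.
  apply/idealP; rewrite /B /=; split; first by rewrite vec00; apply: submod0.
  move=> c b b' Nb Nb'; rewrite -[0](addr0 (0 : R)) -{1}(mulr0 c) vecL.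
  by apply: submodD => //; apply: submodZ.
have [n [d [Ad dA]]] := noetherian_fg R_noeth A_id.
have [k [g [Bg gB]]] := noetherian_fg R_noeth B_id.
have /choice[b bP] := Ad.
pose e (i : 'I_(n + k)) := match fintype.split i with
  | inl j => vec (d j) (b j) | inr j => vec 0 (g j) end.
exists (n + k)%N, e; apply/seteqP; split.
  apply: submod_span_min => // _ [i _ <-]; rewrite /e; case: (fintype.split i) => j; first exact: bP.
  exact: Bg.
move=> v Nv; have [|c cE] := dA (v 0 0).
  by exists (v 1 0); rewrite (_ : vec _ _ = v) //; apply: vecP; rewrite !mxE.
pose w := v - \sum_j c j *: vec (d j) (b j).
have Nw : N w by apply: submodB => //; apply: submod_sum => // j _; apply: submodZ.
have w0 : w 0 0 = 0.
  rewrite !mxE summxE cE; apply/eqP; rewrite subr_eq0; apply/eqP.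
  by apply: eq_bigr => j _; rewrite !mxE.
have [|c' c'E] := gB (w 1 0).
  by rewrite /B /= (_ : vec _ _ = w) //; apply: vecP; rewrite ?vec0E ?vec1E ?w0.
have wE : w = \sum_j c' j *: vec 0 (g j).
  apply: vecP; rewrite summxE; first by rewrite w0 big1 // => j _; rewrite !mxE mulr0.
  by rewrite c'E; apply: eq_bigr => j _; rewrite !mxE.
have S_sub := submod_span_submodule (range e).
rewrite -[v](subrK (\sum_j c j *: vec (d j) (b j))) -/w wE.
apply: (submodD S_sub); apply: (submod_sum S_sub) => j _; apply: (submodZ S_sub);
  apply: sub_submod_span.
  by exists (unsplit (inr j)) => //; rewrite /e unsplitK.
by exists (unsplit (inl j)) => //; rewrite /e unsplitK.
Qed.

Lemma vec_eta (v : 'cV[R]_2) : v = v 0 0 *: vec 1 0 + v 1 0 *: vec 0 1.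
Proof. by apply: vecP; rewrite !mxE /=; ring. Qed.

(** Cramer's relation between three vectors makes their determinants vanish; then
    [e i1 k 0 *: e i0 - e i0 k 0 *: e i1] is zero for both coordinates [k], so [e i0] is zero. *)
Lemma plane_dependent n (e : 'I_n -> 'cV[R]_2) : lin_indep e -> (n <= 2)%N.
Proof.
move=> e_ind; rewrite leqNgt; apply/negP => n3.
pose i0 := Ordinal (ltn_trans (ltn_trans (ltn0Sn 0) (ltnSn 1)) n3).
pose i1 := Ordinal (ltn_trans (ltnSn 1) n3); pose i2 := Ordinal n3.
have rel a b c : a *: e i0 + b *: e i1 + c *: e i2 = 0 -> [/\ a = 0, b = 0 & c = 0].
  move=> abc; pose f i := if i == i0 then a else if i == i1 then b else
    if i == i2 then c else 0.
  suff E : \sum_i f i *: e i = 0.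
    by split; [have := e_ind f E i0|have := e_ind f E i1|have := e_ind f E i2].
  rewrite (bigD1 i0) //= (bigD1 i1) //= (bigD1 i2) //= big1 ?addr0 => [|i].
    by rewrite /f /= addrA.
  by move=> /andP [/andP [/negPf i0' /negPf i1'] /negPf i2']; rewrite /f i0' i1' i2' scale0r.
have [|_ _ D] := rel (det2 (e i1) (e i2)) (det2 (e i2) (e i0)) (det2 (e i0) (e i1)).
  by apply: vecP; rewrite !mxE /det2; ring.
have [|_ /eqP D0 _] := rel (e i1 0 0) (- e i0 0 0) 0.
  by apply: vecP; rewrite !mxE; first ring; rewrite -[RHS]oppr0 -[in RHS]D /det2; ring.
have [|_ /eqP D1 _] := rel (e i1 1 0) (- e i0 1 0) 0.
  by apply: vecP; rewrite !mxE; last ring; rewrite -[RHS]D /det2; ring.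
rewrite !oppr_eq0 in D0 D1.
have [|/eqP one0 _ _] := rel 1 0 0; last by rewrite oner_eq0 in one0.
by apply: vecP; rewrite !mxE (eqP D0, eqP D1); ring.
Qed.

End PlaneSubmodule.

(** * Passage between modules of rank two and submodules of the plane *)

Section ModulesAndPlaneSubmodules.
Variables (R : comNzRingType) (m : set R) (R_reg : regular_local_ring m 2).
Hypothesis R_inf : infinite_residue_field m.

Let R_noeth : noetherian R. Proof. by case: R_reg. Qed.
Let dom : forall a b : R, a * b = 0 -> a = 0 \/ b = 0.
Proof. exact: regular_integral R_reg R_inf. Qed.

Definition decomposable_in (V : lmodType R) (N : set V) :=
  exists P Q, [/\ submodule P /\ P <> [set 0], submodule Q /\ Q <> [set 0],
    set_add P Q = N & P `&` Q = [set 0]].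

(** For a submodule this means that the quotient of the plane by [N] has finite length. *)
Definition contains_pow_mult (N : set 'cV[R]_2) :=
  forall z, m z -> exists k, forall v, N (z ^+ k *: v).

Section Cofinite.
Variables (N : set 'cV[R]_2) (N_sub : submodule N) (N_cof : contains_pow_mult N).

(** A depth two argument. Computing [f] on [x^k y^l v] in two ways gives
    [y^l f(x^k v) = x^k f(y^l v)], so [x^k] divides [f(x^k v)]; the quotient is the value at [v] of
    the extension of [f] to the plane. *)
Lemma plane_functional (f : 'cV[R]_2 -> R) :
  (forall a u v, N u -> N v -> f (a *: u + v) = a * f u + f v) ->
  exists a b, forall v, N v -> f v = a * v 0 0 + b * v 1 0.
Proof.
move=> f_lin; have [x [y xy]] := parameters_exist R_reg.
have [k Nx] := N_cof (parameters_l xy); have [l Ny] := N_cof (parameters_r xy).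
have fZ a v : N v -> f (a *: v) = a * f v.
  have f0 : f 0 = 0.
    have := f_lin 1 0 0 (submod0 N_sub) (submod0 N_sub).
    rewrite scale1r addr0 mul1r => /eqP; rewrite -subr_eq0 opprD addrA subrr add0r oppr_eq0.
    by move/eqP.
  by move=> Nv; rewrite -[a *: v]addr0 f_lin ?f0 ?addr0 //; apply: submod0.
have coeff v : exists a, f (x ^+ k *: v) = a * x ^+ k.
  apply: (params_regular_exp2 R_reg R_inf (x := y) (k := l) (b := f (y ^+ l *: v))).
    exact: parameters_sym.
  by rewrite mulrC -fZ // [RHS]mulrC -fZ // !scalerA mulrC.
have [a aE] := coeff (vec 1 0); have [b bE] := coeff (vec 0 1).
exists a, b => v Nv.
have xk0 : x ^+ k <> 0 by exact/(regular_expr_neq0 R_reg R_inf)/(param_neq0 R_reg xy).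
apply: (mulfI_regular R_reg R_inf xk0); rewrite -fZ // {1}[v]vec_eta scalerDr.
rewrite !scalerA ![x ^+ k * _]mulrC -!scalerA f_lin //; last exact: (submodZ N_sub).
by rewrite aE fZ // bE; ring.
Qed.

Lemma plane_functional_unique a b c d :
  (forall v, N v -> a * v 0 0 + b * v 1 0 = c * v 0 0 + d * v 1 0) -> a = c /\ b = d.
Proof.
move=> abcd; have [x [y xy]] := parameters_exist R_reg.
have [k Nx] := N_cof (parameters_l xy).
have xk0 : x ^+ k <> 0 by exact/(regular_expr_neq0 R_reg R_inf)/(param_neq0 R_reg xy).
split; apply: (mulfI_regular R_reg R_inf xk0).
  by have := abcd _ (Nx (vec 1 0)); rewrite !mxE /= !mulr1 !mulr0 !addr0 ![_ * x ^+ k]mulrC.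
by have := abcd _ (Nx (vec 0 1)); rewrite !mxE /= !mulr1 !mulr0 !add0r ![_ * x ^+ k]mulrC.
Qed.

Local Notation M := (submodule_type N_sub).

Definition sub_coord (i : 'I_2) (x : M) : R^o := val x i 0.

Lemma sub_coord_is_linear i : linear (sub_coord i).
Proof. by move=> a u v; rewrite /sub_coord (linearP (\val : M -> 'cV[R]_2)) !mxE. Qed.

HB.instance Definition _ i :=
  GRing.isLinear.Build R M R^o _ (sub_coord i) (sub_coord_is_linear i).

Definition coord_form (i : 'I_2) : dual M := (sub_coord i : {linear M -> R^o}).

Lemma dual_coord (f : dual M) : exists a b,
  f = a *: coord_form 0 + b *: coord_form 1.
Proof.
(* The functional extended by 0 outside [N]; [plane_functional] asks for linearity on [N] only. *)
pose g (v : 'cV[R]_2) : R := if pselect (N v) is left Nv then dual_app f (submodule_sub N_sub Nv) else 0.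
have gE (x : M) : g (val x) = dual_app f x.
  rewrite /g; case: pselect => [Nx|[]]; last exact: submodule_typeP.
  by congr (dual_app f _); apply: val_inj.
have [|a [b fE]] := plane_functional (f := g).
  move=> a u v Nu Nv.
  rewrite -[u]/(val (submodule_sub N_sub Nu)) -[v]/(val (submodule_sub N_sub Nv)).
  by rewrite -linearP !gE linearP.
by exists a, b; apply: dualP => x; rewrite -gE fE //; apply: submodule_typeP.
Qed.

Definition bidual_coord (al : bidual M) : 'cV[R]_2 :=
  \col_i dual_app al (coord_form i).

Lemma bidual_coord_is_linear : linear bidual_coord.
Proof. by move=> a u v; apply/matrixP => i j; rewrite !mxE. Qed.

HB.instance Definition _ :=
  GRing.isLinear.Build R (bidual M) 'cV[R]_2 _ bidual_coord bidual_coord_is_linear.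

Lemma bidual_coord_map (x : M) : bidual_coord (bidual_map x) = val x.
Proof. by apply/matrixP => i j; rewrite !mxE (ord1 j). Qed.

Lemma bidual_coord_inj : injective bidual_coord.
Proof.
move=> al be ab; apply: dualP => f; have [a [b ->]] := dual_coord f.
rewrite !linearD !linearZ /=.
have := congr1 (fun v : 'cV_2 => v 0 0) ab; have := congr1 (fun v : 'cV_2 => v 1 0) ab.
by rewrite !mxE => -> ->.
Qed.

(** A vector acts on a functional through the coefficients of the latter in the coordinate forms;
    uniqueness of these coefficients makes the action linear. *)
Lemma bidual_coord_surj v : exists al, bidual_coord al = v.
Proof.
have /choice[ab abP] : forall f : dual M, exists ab : R * R,
    f = ab.1 *: coord_form 0 + ab.2 *: coord_form 1.
  by move=> f; have [a [b ->]] := dual_coord f; exists (a, b).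
have ab_uniq (f : dual M) a b : f = a *: coord_form 0 + b *: coord_form 1 ->
    (ab f).1 = a /\ (ab f).2 = b.
  move=> fE; apply: plane_functional_unique => u Nu.
  have := congr1 (fun g => dual_app g (submodule_sub N_sub Nu)) (abP f).
  by rewrite {1}fE.
pose al (f : dual M) : R^o := (ab f).1 * v 0 0 + (ab f).2 * v 1 0.
have al_lin : linear al.
  move=> a f g; rewrite /al.
  have [|-> ->] := ab_uniq (a *: f + g) (a * (ab f).1 + (ab g).1) (a * (ab f).2 + (ab g).2).
    rewrite {1}(abP f) {1}(abP g) scalerDr !scalerA !scalerDl addrACA; congr (_ + _).
  by rewrite /GRing.scale /=; ring.
pose alL : {linear dual M -> R^o} :=
  HB.pack al (GRing.isLinear.Build R (dual M) R^o _ al al_lin).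
exists (alL : bidual M); apply: vecP; rewrite !mxE.
  have [|a1 a2] := ab_uniq (coord_form 0) 1 0; first by rewrite scale1r scale0r addr0.
  by rewrite /= /al a1 a2; ring.
have [|a1 a2] := ab_uniq (coord_form 1) 0 1; first by rewrite scale1r scale0r add0r.
by rewrite /= /al a1 a2; ring.
Qed.

Lemma bidual_coord_bij : bijective bidual_coord.
Proof.
have /choice[g gK] := bidual_coord_surj.
by exists g => [al|v]; [apply: bidual_coord_inj; rewrite gK|rewrite gK].
Qed.

Lemma image_in_free_sub : image_in_free (M := M) bidual_coord = N.
Proof.
apply/seteqP; split=> [_ [x _ <-]|v Nv].
  by rewrite /= bidual_coord_map; apply: submodule_typeP.
by exists (submodule_sub N_sub Nv) => //=; rewrite bidual_coord_map.
Qed.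

Lemma plane_to_module (I : set R) : integrally_closed_ideal I ->
  (exists2 a, I a & a <> 0) -> minors_ideal N = I -> isotropic_to I N `<=` N ->
  ~ decomposable_in N ->
  [/\ finitely_generated M, torsion_free M & has_rank M 2] /\
  [/\ indecomposable M, integrally_closed_module M 2 & is_minors_ideal M 2 I].
Proof.
move=> [I_id I_closed] I_nz NI N_iso N_indec.
have [n [e eN]] := plane_fg R_noeth N_sub.
have Ne i : N (e i) by rewrite -eN; apply: sub_submod_span; exists i.
have [x [y xy]] := parameters_exist R_reg.
have [k Nx] := N_cof (parameters_l xy).
have xk0 : x ^+ k <> 0 by exact/(regular_expr_neq0 R_reg R_inf)/(param_neq0 R_reg xy).
have val_lin a (u v : M) : val (a *: u + v) = a *: val u + val v.
  exact: (linearP (\val : {linear M -> 'cV[R]_2})).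
have val0 : val (0 : M) = 0 by exact: (raddf0 (\val : M -> 'cV[R]_2)).
have valD (u v : M) : val (u + v) = val u + val v by exact: (raddfD (\val : M -> 'cV[R]_2)).
have valZ a (u : M) : val (a *: u) = a *: val u.
  exact: (linearZ_LR (\val : {linear M -> 'cV[R]_2})).
have val_sum (T : Type) (s : seq T) (F : T -> M) : val (\sum_(i <- s) F i) = \sum_(i <- s) val (F i).
  exact: (raddf_sum (\val : M -> 'cV[R]_2)).
split; split.
- exists n, (fun i => submodule_sub N_sub (Ne i)); apply/seteqP; split=> // u _.
  apply/submod_span_rangeP; have := submodule_typeP u.
  rewrite -{1}eN => /submod_span_rangeP [c uE]; exists c; apply: val_inj.
  by rewrite val_sum [LHS]uE; apply: eq_bigr => i _; rewrite valZ.
- move=> a u au; have [|a0] := pselect (a = 0); [by left|right].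
  apply: val_inj; rewrite val0; have := congr1 val au; rewrite valZ val0 => auE.
  by apply: vecP; [have := congr1 (fun v : 'cV_2 => v 0 0) auE
                  |have := congr1 (fun v : 'cV_2 => v 1 0) auE];
     rewrite !mxE => /dom [].
- split.
    exists (fun i : 'I_2 => submodule_sub N_sub (Nx (if i == 0 then vec 1 0 else vec 0 1))).
    move=> c /(congr1 val); rewrite val_sum val0 big_ord_recl big_ord1 !valZ /= => cE.
    have l1 : lift ord0 ord0 = 1 :> 'I_2 by apply: val_inj.
    rewrite l1 in cE => i; case: (ord2P i) => ->.
      have := congr1 (fun v : 'cV_2 => v 0 0) cE; rewrite !mxE /=.
      by rewrite !mulr0 addr0 mulr1 => /dom [].
    have := congr1 (fun v : 'cV_2 => v 1 0) cE; rewrite !mxE /=.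
    by rewrite !mulr0 add0r mulr1 => /dom [].
  move=> l f f_ind; suff: lin_indep (fun i => val (f i) : 'cV[R]_2) by apply: plane_dependent.
  move=> c cE.
  by apply: f_ind; apply: val_inj; rewrite val_sum val0 -[RHS]cE; apply: eq_bigr => i _.
- split.
    move=> M0; have : [set: M] (submodule_sub N_sub (Nx (vec 1 0))) by [].
    rewrite M0 => u0; have : x ^+ k *: vec 1 0 = 0 by rewrite -val0 -[X in val X]u0.
    by move/(congr1 (fun v : 'cV_2 => v 0 0)); rewrite !mxE /= mulr1.
  case=> P [Q [[P_sub P0] [Q_sub Q0] [PQ PQ0]]]; apply: N_indec.
  have img_sub (A : set M) : submodule A -> submodule (val @` A).
    move=> A_sub; apply/submoduleP; split.
      by exists 0; [apply: submod0|rewrite val0].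
    move=> a _ _ [u Au <-] [v Av <-]; exists (a *: u + v); last exact: val_lin.
    by apply: (submodD A_sub) => //; apply: (submodZ A_sub).
  have img_nz (A : set M) : A <> [set 0] -> val @` A <> [set 0].
    move=> A0 vA0; apply: A0; apply/seteqP; split=> [u Au|_ ->].
      have : [set val a | a in A] (val u) by exists u.
      by rewrite vA0 => u0; apply: val_inj; rewrite val0.
    have : [set val a | a in A] 0 by rewrite vA0.
    by case=> u Au u0; rewrite (_ : 0 = u) //; apply: val_inj; rewrite val0.
  exists (val @` P), (val @` Q); split.
  + by split; [apply: img_sub|apply: img_nz].
  + by split; [apply: img_sub|apply: img_nz].
  + apply/seteqP; split=> [_ [_ [u Pu <-] [_ [v Qv <-] <-]]|v Nv].
      by apply: submodD => //; apply: submodule_typeP.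
    have : [set: M] (submodule_sub N_sub Nv) by [].
    rewrite -PQ => -[u Pu [w Qw uw]]; exists (val u); first by exists u.
    exists (val w); first by exists w.
    by rewrite -valD uw.
  + apply/seteqP; split=> [_ [[u Pu <-] [w Qw wu]]|_ ->]; last first.
      by split; exists 0; rewrite ?val0 //; apply: submod0.
    have /val_inj uw : val u = val w by rewrite wu.
    have : (P `&` Q) u by split; rewrite // uw.
    by rewrite PQ0 => ->; exact: val0.
- exists bidual_coord; first exact: bidual_coord_bij.
  apply/seteqP; split=> [v vN|_ [u _ <-]].
    have Nv : N (bidual_coord v).
      apply: N_iso => w Nw; rewrite -I_closed /= -NI.
      apply: isotropic_of_integral Nw; rewrite -{1}image_in_free_sub; exact: vN.
    exists (submodule_sub N_sub Nv) => //; apply: bidual_coord_inj.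
    by rewrite bidual_coord_map.
  have : integral_over_forms N (val u).
    apply: integral_of_isotropic => //; first by rewrite NI.
    by move=> w Nw; apply: mem_minors => //; apply: submodule_typeP.
  by rewrite -{1}image_in_free_sub -bidual_coord_map.
- exists bidual_coord; first exact: bidual_coord_bij.
  exists n, (\matrix_(i, j) e j i 0).
  have eE : (fun j => col j (\matrix_(i, j) e j i 0)) = e.
    by apply/funext => j; apply/matrixP => i k'; rewrite !mxE (ord1 k').
  by rewrite max_minors_idealE eE eN image_in_free_sub NI.
Qed.

End Cofinite.

(** * A torsion-free module of rank two embedded in the plane by its bidual *)

Section Restrict.
Variables (M : lmodType R).
Hypotheses (M_fg : finitely_generated M) (M_tf : torsion_free M) (M_rank : has_rank M 2).

(** By the rank, each generator has a nonzero multiple in the span of the independent [e 0], [e 1].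
    A common denominator [C] carries all of [M] into that span, and the two coordinates of [C *: z]
    are functionals that detect [z]. *)
Lemma bidual_map_inj (x : M) : (forall f : dual M, dual_app f x = 0) -> x = 0.
Proof.
move=> x0; have [[e e_ind] M2] := M_rank; have [n [g gM]] := M_fg.
have rel (z : M) : exists c, c <> 0 /\ exists a b, c *: z = a *: e 0 + b *: e 1.
  apply: contrapT => no; suff : (3 <= 2)%N by [].
  pose h (i : 'I_3) := if i == 0 :> nat then z else if i == 1%N :> nat then e 0 else e 1.
  apply: (M2 3%N h) => c; rewrite !big_ord_recl big_ord0 /h /= addr0 => cE.
  have c0 : c ord0 = 0.
    apply: contrapT => c0; apply: no; exists (c ord0); split=> //.
    exists (- c (lift ord0 ord0)), (- c (lift ord0 (lift ord0 ord0))).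
    by apply/eqP; rewrite -subr_eq0 !scaleNr -opprD opprK; apply/eqP.
  rewrite c0 scale0r add0r in cE.
  pose d (i : 'I_2) := if i == 0 then c (lift ord0 ord0) else c (lift ord0 (lift ord0 ord0)).
  have d0 : forall i, d i = 0.
    apply: e_ind; rewrite big_ord_recl big_ord1 /d /= -[RHS]cE.
    by have -> : lift ord0 ord0 = 1 :> 'I_2 by apply: val_inj.
  move=> i; have := d0 0; have := d0 1; rewrite /d /= => c2 c1.
  case: (unliftP ord0 i) => [j ->|-> //]; case: (ord2P j) => ->; first by rewrite -[RHS]c1.
  by rewrite -[RHS]c2; congr c; apply: val_inj.
have /choice[c cP] : forall i, exists c, c <> 0 /\ exists a b, c *: g i = a *: e 0 + b *: e 1.
  by move=> i; apply: rel.
pose C := \prod_i c i.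
have C0 : C <> 0 by apply: (regular_prod_neq0 R_reg R_inf) => i; case: (cP i).
have CM z : exists ab : R * R, C *: z = ab.1 *: e 0 + ab.2 *: e 1.
  have : submod_span (range g) z by rewrite gM.
  suff : submod_span (range g) `<=` [set z | exists ab : R * R, C *: z = ab.1 *: e 0 + ab.2 *: e 1] by apply.
  apply: submod_span_min => [|_ [i _ <-]].
    apply/submoduleP; split; first by exists (0, 0); rewrite /= scaler0 !scale0r addr0.
    move=> r u v [ab uE] [ab' vE]; exists (r * ab.1 + ab'.1, r * ab.2 + ab'.2) => /=.
    by rewrite scalerDr scalerA mulrC -scalerA uE vE scalerDr !scalerA !scalerDl addrACA.
  have [_ [a [b gE]]] := cP i; pose D := \prod_(j | j != i) c j.
  exists (D * a, D * b) => /=.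
  by rewrite /C (bigD1 i) //= mulrC -scalerA gE scalerDr !scalerA.
have e_uniq a b a' b' : a *: e 0 + b *: e 1 = a' *: e 0 + b' *: e 1 -> a = a' /\ b = b'.
  move=> /eqP; rewrite -subr_eq0 opprD addrACA -!scalerBl => /eqP ab.
  have d0 := e_ind (fun i => if i == 0 then a - a' else b - b').
  have {}d0 : forall i : 'I_2, (if i == 0 then a - a' else b - b') = 0.
    apply: d0; rewrite big_ord_recl big_ord1 /= -[RHS]ab.
    by have -> : lift ord0 ord0 = 1 :> 'I_2 by apply: val_inj.
  by split; apply/eqP; rewrite -subr_eq0; apply/eqP; [apply: (d0 0)|apply: (d0 1)].
have /choice[ab abP] := CM.
have ab_lin a u v : (ab (a *: u + v)).1 = a * (ab u).1 + (ab v).1 /\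
                    (ab (a *: u + v)).2 = a * (ab u).2 + (ab v).2.
  apply: e_uniq; rewrite -abP scalerDr scalerA mulrC -scalerA !abP scalerDr !scalerA.
  by rewrite !scalerDl addrACA.
pose f1 (u : M) : R^o := (ab u).1; pose f2 (u : M) : R^o := (ab u).2.
have f1_lin : linear f1 by move=> a u v; case: (ab_lin a u v).
have f2_lin : linear f2 by move=> a u v; case: (ab_lin a u v).
pose F1 : {linear M -> R^o} := HB.pack f1 (GRing.isLinear.Build R M R^o _ f1 f1_lin).
pose F2 : {linear M -> R^o} := HB.pack f2 (GRing.isLinear.Build R M R^o _ f2 f2_lin).
have [] := M_tf (a := C) (x := x) => //.
rewrite abP; have -> : (ab x).1 = 0 := x0 (F1 : dual M).
by have -> : (ab x).2 = 0 := x0 (F2 : dual M); rewrite !scale0r addr0.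
Qed.

(** Integral closure and minors may be given in different bases [phi1] and [phi2] of the bidual. The
    change of basis [g] multiplies [det2] by a nonzero constant [D], so isotropy to [range iota]
    becomes isotropy to its image [N1], whose minors contain [D * I]. *)
Lemma module_to_plane (I : set R) : integrally_closed_ideal I -> (exists2 a, I a & a <> 0) ->
  indecomposable M -> integrally_closed_module M 2 -> is_minors_ideal M 2 I ->
  exists N : set 'cV[R]_2, [/\ submodule N, minors_ideal N = I,
    isotropic_to I N `<=` N & ~ decomposable_in N].
Proof.
move=> [I_id I_closed] I_nz [_ M_indec] [phi1 phi1_bij phi1P] [phi2 [psi2 psi2K phi2K]].
case=> n [A [AN IE]].
pose iota (x : M) : 'cV[R]_2 := phi2 (bidual_map x).
have bm_lin a (u v : M) : bidual_map (a *: u + v) = a *: bidual_map u + bidual_map v.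
  by apply: dualP => f; rewrite /= /dual_eval linearP.
have iota_lin a u v : iota (a *: u + v) = a *: iota u + iota v.
  by rewrite /iota bm_lin linearP.
have iota0 : iota 0 = 0.
  have := iota_lin 1 0 0; rewrite scale1r addr0 scale1r => /eqP.
  by rewrite -subr_eq0 opprD addrA subrr add0r oppr_eq0 => /eqP.
have iotaB u v : iota (u - v) = iota u - iota v.
  by rewrite addrC -scaleN1r iota_lin scaleN1r addrC.
have iota_inj u v : iota u = iota v -> u = v.
  move=> uv; apply/eqP; rewrite -subr_eq0; apply/eqP; apply: bidual_map_inj => f.
  have : iota (u - v) = phi2 0 by rewrite iotaB uv subrr linear0.
  by move/(can_inj psi2K) => /(congr1 (fun al => dual_app al f)).
have NE : image_in_free phi2 = range iota by [].
have IN : minors_ideal (range iota) = I by rewrite IE max_minors_idealE AN.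
have iota_sub (P : set M) : submodule P -> submodule (iota @` P).
  move=> P_sub; apply/submoduleP; split; first by exists 0; [apply: submod0|].
  move=> a _ _ [u Pu <-] [v Pv <-]; exists (a *: u + v); last exact: iota_lin.
  by apply: (submodD P_sub) => //; apply: (submodZ P_sub).
have N_sub : submodule (range iota).
  by apply: iota_sub; apply/submoduleP.
exists (range iota); split=> //.
- move=> v vI.
  have psi2_lin a u w : psi2 (a *: u + w) = a *: psi2 u + psi2 w.
    by apply: (can_inj psi2K); rewrite linearP !phi2K.
  pose g v := phi1 (psi2 v).
  have g_lin a u w : g (a *: u + w) = a *: g u + g w by rewrite /g psi2_lin linearP.
  have g0 : g 0 = 0.
    have := g_lin 1 0 0; rewrite scale1r addr0 scale1r => /eqP.
    by rewrite -subr_eq0 opprD addrA subrr add0r oppr_eq0 => /eqP.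
  have gZ a u : g (a *: u) = a *: g u by rewrite -[a *: u]addr0 g_lin g0 addr0.
  have gE u : g u = u 0 0 *: g (vec 1 0) + u 1 0 *: g (vec 0 1).
    by rewrite {1}[u]vec_eta g_lin gZ.
  pose D := det2 (g (vec 1 0)) (g (vec 0 1)).
  have g_det u w : det2 (g u) (g w) = D * det2 u w.
    by rewrite (gE u) (gE w) /D /det2 !mxE; ring.
  have g_inj u : g u = 0 -> u = 0.
    move=> gu; apply: (can_inj phi2K); apply: (bij_inj phi1_bij).
    by rewrite -/(g u) gu -/(g 0) g0.
  have D0 : D <> 0.
    move=> D0; pose u := g (vec 1 0); pose w := g (vec 0 1).
    have {}D0 : det2 u w = 0 by exact: D0.
    have coord a b : a *: u + b *: w = 0 -> a = 0 /\ b = 0.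
      move=> ab; have /g_inj /[dup] v0 : g (vec a b) = 0 by rewrite gE vec0E vec1E.
      move=> /(congr1 (fun v : 'cV_2 => v 1 0)); move: v0 => /(congr1 (fun v : 'cV_2 => v 0 0)).
      by rewrite vec0E vec1E !mxE.
    have [|_ /eqP u0] := coord (w 0 0) (- u 0 0).
      by apply: vecP; rewrite !mxE; first ring; rewrite -[RHS]oppr0 -[in RHS]D0 /det2; ring.
    have [|_ /eqP u1] := coord (w 1 0) (- u 1 0).
      by apply: vecP; rewrite !mxE; last ring; rewrite -[RHS]D0 /det2; ring.
    rewrite !oppr_eq0 in u0 u1.
    have [|/eqP] := coord 1 0; last by rewrite oner_eq0.
    by apply: vecP; rewrite !mxE (eqP u0, eqP u1); ring.
  pose N1 := image_in_free phi1.
  have N1E w : N1 w <-> exists x, w = g (iota x).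
    by split=> [[x _ <-]|[x ->]]; exists x; rewrite // /g /iota psi2K.
  have N1_sub : submodule N1.
    apply/submoduleP; split; first by apply/N1E; exists 0; rewrite iota0 g0.
    move=> a u w /N1E [x ->] /N1E [y ->]; apply/N1E; exists (a *: x + y).
    by rewrite iota_lin g_lin.
  have DI a : I a -> minors_ideal N1 (D * a).
    rewrite -IN; pose J := [set a | minors_ideal N1 (D * a)].
    have N1_id : ideal (minors_ideal N1) := ideal_spanP _.
    suff : minors_ideal (range iota) `<=` J by apply.
    apply: minors_min => [|u w [x _ <-] [y _ <-]].
      apply/idealP; rewrite /J /=; split; first by rewrite mulr0; apply: (ideal0 N1_id).
      move=> r b c Jb Jc; rewrite mulrDr mulrCA.
      by apply: (idealD N1_id) => //; apply: (idealM _ N1_id).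
    by rewrite /J /= -g_det; apply: mem_minors; apply/N1E; eexists.
  have : integral_over_forms N1 (g v).
    apply: integral_of_isotropic => //.
      have [a Ia a0] := I_nz; exists (D * a); first exact: DI.
      by move/dom => [].
    by move=> w /N1E [x ->]; rewrite g_det; apply: DI; apply: vI; exists x.
  move=> gv; have : [set v | integral_over_module phi1 v] (psi2 v) by exact: gv.
  by rewrite phi1P => -[x _ xE]; exists x; rewrite // /iota xE phi2K.
- case=> P [Q [[P_sub P0] [Q_sub Q0] PQ PQ0]]; apply: M_indec.
  have pre_sub (B : set 'cV[R]_2) : submodule B -> submodule (iota @^-1` B).
    move=> A_sub; apply/submoduleP; split; first by rewrite /preimage /= iota0; apply: submod0.
    move=> a u v Au Av; rewrite /preimage /= iota_lin.
    by apply: (submodD A_sub) => //; apply: (submodZ A_sub).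
  have PN v : P v -> exists x, iota x = v.
    move=> Pv; suff [x _ xv] : range iota v by exists x.
    by rewrite -PQ; exists v => //; exists 0; [apply: submod0|rewrite addr0].
  have QN v : Q v -> exists x, iota x = v.
    move=> Qv; suff [x _ xv] : range iota v by exists x.
    by rewrite -PQ; exists 0; [apply: submod0|exists v => //; rewrite add0r].
  have pre_nz (B : set 'cV[R]_2) : submodule B -> (forall v, B v -> exists x, iota x = v) ->
      B <> [set 0] -> iota @^-1` B <> [set 0].
    move=> A_sub BN A0 pA0; apply: A0; apply/seteqP; split=> [v Av|_ ->]; last exact: submod0.
    have [x xv] := BN v Av; have : (iota @^-1` B) x by rewrite /preimage /= xv.
    by rewrite pA0 => x0; rewrite /= -xv x0 iota0.
  exists (iota @^-1` P), (iota @^-1` Q); split; [by split; auto|by split; auto|split].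
    apply/seteqP; split=> // x _; have : range iota (iota x) by exists x.
    rewrite -PQ => -[u Pu [w Qw uw]].
    have [a aE] := PN u Pu; have [b bE] := QN w Qw.
    exists a; first by rewrite /preimage /= aE.
    exists b; first by rewrite /preimage /= bE.
    by apply: iota_inj; rewrite -[a]scale1r iota_lin scale1r aE bE.
  apply/seteqP; split=> [x [Px Qx]|_ ->]; last by split; rewrite /preimage /= iota0; apply: submod0.
  have : (P `&` Q) (iota x) by [].
  by rewrite PQ0 => x0; apply: iota_inj; rewrite iota0.
Qed.

End Restrict.
End ModulesAndPlaneSubmodules.

(** * Splittings of plane modules *)

Section PlaneModules.
Variables (R : comNzRingType) (m : set R) (R_reg : regular_local_ring m 2).
Hypothesis R_inf : infinite_residue_field m.

Let R_noeth : noetherian R. Proof. by case: R_reg. Qed.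
Let R_loc : local_ring m. Proof. by case: R_reg. Qed.
Let m_id : ideal m. Proof. exact: maximal_is_ideal R_loc. Qed.
Let dom : forall a b : R, a * b = 0 -> a = 0 \/ b = 0.
Proof. exact: regular_integral R_reg R_inf. Qed.

Local Notation mpow := (ideal_exp m).
Local Notation params := (parameters m).

Lemma proper_maximal (J : set R) : ideal_proper J -> J `<=` m.
Proof. exact: proper_sub_maximal. Qed.

Lemma unit_mul_mem (J : set R) a b : ideal J -> ~ m a -> J (a * b) -> J b.
Proof.
move=> J_id /(local_unit R_noeth R_loc) [c c1] Jab.
by rewrite -[b]mul1r -c1 -mulrA; apply: idealM.
Qed.

Lemma params_lin_indep x y a b : params x y -> mpow 2 (a * x + b * y) -> m a /\ m b.
Proof.
have half x' y' a' b' : params x' y' -> mpow 2 (a' * x' + b' * y') -> m b'.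
  move=> xy ab; apply: contrapT => nb.
  apply: (unit_param_pow_notin_transv R_reg xy (n := 1) nb).
  rewrite expr1 (_ : _ * _ = (a' * x' + b' * y') - a' * x'); last by ring.
  by apply: transvB; [apply: transv_mpow|apply: transv_mulx].
move=> xy ab; split; last exact: half xy ab.
by apply: (half y x b a); [apply: parameters_sym|rewrite addrC].
Qed.

Lemma not_mpow_sub (J : set R) n : ~ J `<=` mpow n -> exists2 x, J x & ~ mpow n x.
Proof.
move=> nJ; apply: contrapT => no; apply: nJ => x Jx.
by apply: contrapT => nx; apply: no; exists x.
Qed.

Lemma mul_mpow_sub (J K : set R) i j :
  J `<=` mpow i -> K `<=` mpow j -> ideal_mul J K `<=` mpow (i + j).
Proof.
move=> Ji Kj; apply: ideal_mul_min; first exact: ideal_exp_ideal.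
by move=> x y /Ji xi /Kj yj; apply: ideal_exp_mul.
Qed.

(* A splitting [N = P + Q] is given by a projection, which extends to an
   idempotent 2x2 matrix over [R]; its trace is 1, so a diagonal entry is a unit. *)
Lemma decomposable_split (N : set 'cV[R]_2) : submodule N -> contains_pow_mult m N ->
  decomposable_in N -> exists e f (J K : set R), [/\ ~ m (det2 e f), ideal J, ideal K &
    forall v, N v <-> exists a b, [/\ J a, K b & v = a *: e + b *: f]].
Proof.
move=> N_sub N_cof [P [Q [[P_sub P0] [Q_sub Q0] PQ PQ0]]].
have PN v : P v -> N v.
  by move=> Pv; rewrite -PQ; exists v => //; exists 0; [apply: submod0|rewrite addr0].
have QN v : Q v -> N v.
  by move=> Qv; rewrite -PQ; exists 0; [apply: submod0|exists v => //; rewrite add0r].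
have uniq p p' q q' : P p -> P p' -> Q q -> Q q' -> p + q = p' + q' -> p = p'.
  move=> Pp Pp' Qq Qq' E; apply/eqP; rewrite -subr_eq0; apply/eqP.
  have : (P `&` Q) (p - p').
    split; first exact: submodB.
    rewrite (_ : p - p' = q' - q); first exact: submodB.
    by apply/eqP; rewrite subr_eq addrAC -subr_eq opprK E addrC.
  by rewrite PQ0.
suff [e [f [nmd Pe Qf]]] : exists e f, [/\ ~ m (det2 e f),
    forall p, P p -> exists t, p = t *: e & forall q, Q q -> exists t, q = t *: f].
  exists e, f, [set t | P (t *: e)], [set t | Q (t *: f)].
  have line_id (S : set 'cV[R]_2) u : submodule S -> ideal [set t | S (t *: u)].
    move=> S_sub; apply/idealP; split; first by rewrite /= scale0r; apply: submod0.
    move=> a s t /= Ss St; rewrite scalerDl -scalerA.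
    by apply: (submodD S_sub) => //; apply: (submodZ S_sub).
  split=> [//||| v]; [exact: line_id|exact: line_id|].
  split=> [|[a [b [Pa Qb ->]]]]; last by apply: submodD => //; [apply: PN|apply: QN].
  rewrite -{1}PQ => -[p Pp [q Qq <-]]; have [a pE] := Pe p Pp; have [b qE] := Qf q Qq.
  by exists a, b; rewrite /= -pE -qE.
(* The projection onto [P] along [Q], made total by the value 0 off [N]. *)
have /choice[pr prP] : forall v, exists p, N v -> P p /\ Q (v - p).
  move=> v; have [Nv|] := pselect (N v); last by exists 0.
  have : set_add P Q v by rewrite PQ.
  by case=> p Pp [q Qq pq]; exists p => _; split; rewrite // -pq addrAC subrr add0r.
have prL a u v : N u -> N v -> pr (a *: u + v) = a *: pr u + pr v.
  move=> Nu Nv; have [Pu Qu] := prP u Nu; have [Pv Qv] := prP v Nv.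
  have Nuv : N (a *: u + v) by apply: submodD => //; apply: submodZ.
  have [Puv Quv] := prP _ Nuv.
  apply: (uniq _ _ _ (a *: (u - pr u) + (v - pr v)) Puv _ Quv).
  - by apply: submodD => //; apply: submodZ.
  - by apply: submodD => //; apply: submodZ.
  - by apply: vecP; rewrite !mxE; ring.
have prPid p : P p -> pr p = p.
  move=> Pp; have [Ppr Qpr] := prP p (PN p Pp).
  apply: (uniq _ _ _ _ Ppr Pp Qpr (submod0 Q_sub)).
  by rewrite addrC subrK addr0.
have prQ0 q : Q q -> pr q = 0.
  move=> Qq; have [Ppr Qpr] := prP q (QN q Qq).
  apply: (uniq _ _ _ _ Ppr (submod0 P_sub) Qpr Qq).
  by rewrite addrC subrK add0r.
have [|a [b prE0]] := plane_functional R_reg R_inf N_sub N_cof (f := fun v => pr v 0 0).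
  by move=> r u v Nu Nv; rewrite prL // !mxE.
have [|c [d prE1]] := plane_functional R_reg R_inf N_sub N_cof (f := fun v => pr v 1 0).
  by move=> r u v Nu Nv; rewrite prL // !mxE.
have prpr v : N v -> pr (pr v) = pr v by move=> Nv; apply: prPid; case: (prP v Nv).
have Npr v : N v -> N (pr v) by move=> Nv; apply: PN; case: (prP v Nv).
have [E1 E2] : a * a + b * c = a /\ a * b + b * d = b.
  apply: (plane_functional_unique R_reg R_inf N_cof) => v Nv.
  rewrite -prE0 // -[in RHS](prpr v) // prE0; last exact: Npr.
  by rewrite prE0 // prE1 //; ring.
have [E3 E4] : c * a + d * c = c /\ c * b + d * d = d.
  apply: (plane_functional_unique R_reg R_inf N_cof) => v Nv.
  rewrite -prE1 // -[in RHS](prpr v) // prE1; last exact: Npr.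
  by rewrite prE0 // prE1 //; ring.
(* The determinant of the idempotent matrix is idempotent, hence 0 or 1. If it is 1, the matrix is
   the identity and [Q] vanishes. *)
have D2 : (a * d - b * c) * (a * d - b * c - 1) = 0.
  transitivity ((a * a + b * c) * (c * b + d * d) - (a * b + b * d) * (c * a + d * c)
                - (a * d - b * c)); first by ring.
  by rewrite E1 E2 E3 E4; ring.
have D0 : a * d - b * c = 0.
  have [//|/eqP] := dom D2; rewrite subr_eq0 => /eqP D1.
  have a1 : a = 1.
    apply/eqP; rewrite -subr_eq0 -[a - 1]mul1r -{1}D1; apply/eqP.
    transitivity (d * ((a * a + b * c) - a) - b * ((c * a + d * c) - c)); first by ring.
    by rewrite E1 E3; ring.
  have d1 : d = 1.
    apply/eqP; rewrite -subr_eq0 -[d - 1]mul1r -{1}D1; apply/eqP.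
    transitivity (a * ((c * b + d * d) - d) - c * ((a * b + b * d) - b)); first by ring.
    by rewrite E2 E4; ring.
  have b0 : b = 0.
    rewrite -[b]mul1r -D1.
    transitivity (d * ((a * b + b * d) - b) - b * ((c * b + d * d) - d)); first by ring.
    by rewrite E2 E4; ring.
  have c0 : c = 0.
    rewrite -[c]mul1r -D1.
    transitivity (a * ((c * a + d * c) - c) - c * ((a * a + b * c) - a)); first by ring.
    by rewrite E1 E3; ring.
  case: Q0; apply/seteqP; split=> [q Qq|_ ->]; last exact: submod0.
  rewrite /= -(prQ0 q Qq); apply: vecP.
    by rewrite prE0 ?a1 ?b0; [ring|apply: QN].
  by rewrite prE1 ?c0 ?d1; [ring|apply: QN].
have bc : b * c = a * d by apply/eqP; rewrite eq_sym -subr_eq0 D0.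
(* With determinant 0, Cayley-Hamilton turns idempotence into [(a + d - 1)] times the matrix being
   0. If the trace were not 1, the projection and with it [P] would vanish. *)
have tr : a + d = 1.
  apply: contrapT => tr.
  have z r : r * (a + d - 1) = 0 -> r = 0.
    by move=> /dom [//|/eqP]; rewrite subr_eq0 => /eqP.
  have a0 : a = 0.
    apply: z; transitivity ((a * a + b * c) - a + (a * d - b * c)); first by ring.
    by rewrite E1 D0; ring.
  have d0 : d = 0.
    apply: z; transitivity ((c * b + d * d) - d + (a * d - b * c)); first by ring.
    by rewrite E4 D0; ring.
  have b0 : b = 0.
    by apply: z; transitivity ((a * b + b * d) - b); [ring|rewrite E2; ring].
  have c0 : c = 0.
    by apply: z; transitivity ((c * a + d * c) - c); [ring|rewrite E3; ring].
  case: P0; apply/seteqP; split=> [p Pp|_ ->]; last exact: submod0.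
  rewrite /= -(prPid p Pp); apply: vecP.
    by rewrite prE0 ?a0 ?b0 ?mxE; [ring|apply: PN].
  by rewrite prE1 ?c0 ?d0 ?mxE; [ring|apply: PN].
(* The vector [e] is the column of the matrix through a unit diagonal entry and [f] spans the
   kernel; their determinant is that entry up to sign. *)
have [ma|nma] := pselect (m a).
  have nmd : ~ m d.
    by move=> md; apply: (maximal1 R_loc); rewrite -tr; apply: idealD.
  have [d' d1] := local_unit R_noeth R_loc nmd.
  exists (vec b d), (vec d (- c)); split=> [|p Pp|q Qq].
  - rewrite /det2 !mxE /= (_ : _ - _ = - (c * b + d * d)); [rewrite E4|by ring].
    by move=> /(idealN m_id); rewrite opprK.
  - exists (p 1 0 + d' * c * p 0 0); rewrite -{1}(prPid p Pp).
    apply: vecP; rewrite ?prE0 ?prE1 ?mxE /=; try exact: PN.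
      transitivity (d' * d * (a * p 0 0 + b * p 1 0)); first by rewrite d1 mul1r.
      transitivity (d' * (a * d) * p 0 0 + d' * d * b * p 1 0); first by ring.
      by rewrite -bc d1; ring.
    transitivity (d' * d * c * p 0 0 + d * p 1 0); first by rewrite d1; ring.
    by ring.
  - have := prE1 q (QN q Qq); rewrite prQ0 // mxE => q0.
    exists (d' * q 0 0); apply: vecP; rewrite !mxE /=.
      by transitivity (d' * d * q 0 0); [rewrite d1; ring|ring].
    transitivity (d' * (0 - c * q 0 0)); last by ring.
    rewrite q0; transitivity (d' * d * q 1 0); last by ring.
    by rewrite d1; ring.
have [a' a1] := local_unit R_noeth R_loc nma.
exists (vec a c), (vec (- b) a); split=> [|p Pp|q Qq].
- by rewrite /det2 !mxE /= (_ : _ - _ = a * a + b * c); [rewrite E1|ring].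
- exists (p 0 0 + a' * b * p 1 0); rewrite -{1}(prPid p Pp).
  apply: vecP; rewrite ?prE0 ?prE1 ?mxE /=; try exact: PN.
    transitivity (a * p 0 0 + a' * a * b * p 1 0); first by rewrite a1; ring.
    by ring.
  transitivity (a' * a * (c * p 0 0 + d * p 1 0)); first by rewrite a1 mul1r.
  transitivity (a' * a * c * p 0 0 + a' * (a * d) * p 1 0); first by ring.
  by rewrite -bc a1; ring.
- have := prE0 q (QN q Qq); rewrite prQ0 // mxE => q0.
  exists (a' * q 1 0); apply: vecP; rewrite !mxE /=.
    transitivity (a' * (0 - b * q 1 0)); last by ring.
    rewrite q0; transitivity (a' * a * q 0 0); last by ring.
    by rewrite a1; ring.
  by transitivity (a' * a * q 1 0); [rewrite a1; ring|ring].
Qed.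

Definition in_maximal (N : set 'cV[R]_2) := forall v, N v -> m (v 0 0) /\ m (v 1 0).

Lemma det2_maximal (u v : 'cV[R]_2) : m (u 0 0) -> m (u 1 0) -> m (det2 u v).
Proof. by move=> m0 m1; apply: idealB => //; apply: idealMC. Qed.

Lemma decomposable_ideals (N : set 'cV[R]_2) : submodule N -> contains_pow_mult m N ->
  in_maximal N -> decomposable_in N -> exists e f (J K : set R),
  [/\ ~ m (det2 e f), ideal_proper J, ideal_proper K,
      forall v, N v <-> exists a b, [/\ J a, K b & v = a *: e + b *: f] &
      minors_ideal N = ideal_mul J K].
Proof.
move=> N_sub N_cof N_max /(decomposable_split N_sub N_cof) [e [f [J [K [nmd J_id K_id NP]]]]].
have JN a : J a -> N (a *: e).
  by move=> Ja; apply/NP; exists a, 0; rewrite scale0r addr0; split=> //; apply: ideal0.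
have KN b : K b -> N (b *: f).
  by move=> Kb; apply/NP; exists 0, b; rewrite scale0r add0r; split=> //; apply: ideal0.
exists e, f, J, K; split=> //.
- split=> // JT; have : N (1 *: e) by apply: JN; rewrite JT.
  by rewrite scale1r => /N_max [m0 m1]; apply/nmd/det2_maximal.
- split=> // KT; have : N (1 *: f) by apply: KN; rewrite KT.
  rewrite scale1r => /N_max [m0 m1]; apply: nmd; rewrite det2N.
  by apply: idealN => //; apply: det2_maximal.
- have JK_id := ideal_mul_ideal J K; apply/seteqP; split.
    apply: minors_min => // _ _ /NP [a [b [Ja Kb ->]]] /NP [a' [b' [Ja' Kb' ->]]].
    rewrite (_ : det2 _ _ = det2 e f * (a * b' - a' * b)).
      by apply: (idealM _ JK_id); apply: (idealB JK_id); apply: mem_ideal_mul.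
    by rewrite /det2 !mxE; ring.
  have M_id : ideal (minors_ideal N) := ideal_spanP _.
  apply: ideal_mul_min => // a b /JN Na /KN Nb.
  apply: (unit_mul_mem M_id nmd).
  rewrite (_ : _ * _ = det2 (a *: e) (b *: f)); first exact: mem_minors.
  by rewrite /det2 !mxE; ring.
Qed.

End PlaneModules.

(** * Two integrally closed modules with a given ideal of minors *)

Section ContractedModule.
Variables (R : comNzRingType) (m : set R) (R_reg : regular_local_ring m 2).
Hypothesis R_inf : infinite_residue_field m.

Let R_noeth : noetherian R. Proof. by case: R_reg. Qed.
Let R_loc : local_ring m. Proof. by case: R_reg. Qed.
Let m_id : ideal m. Proof. exact: maximal_is_ideal R_loc. Qed.

Local Notation mpow := (ideal_exp m).
Local Notation params := (parameters m).
Local Notation transv := (transv m).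

Variables (I : set R) (I_prim : primary_to m I) (I_closed : integrally_closed_ideal I).

Let I_id : ideal I. Proof. exact: primary_ideal_ideal I_prim. Qed.

Local Notation L := (colon_max m I).

Let L_id : ideal L. Proof. exact: colon_max_ideal I_prim. Qed.

Lemma isotropic_contains_pow (N : set 'cV[R]_2) :
  isotropic_to I N `<=` N -> contains_pow_mult m N.
Proof.
move=> N_iso z mz; have [k Iz] := primary_pow I_prim mz; exists k => v.
by apply: N_iso => w Nw; rewrite det2Zl; apply: idealMC.
Qed.

(** The socle of [R / I] is nonzero: otherwise an inclusion [m^N <= I] would descend to [N = 0]. *)
Lemma colon_max_not_sub : ~ L `<=` I.
Proof.
move=> LI; have [N mN] := primary_mpow R_reg I_prim.
elim: N mN => [|N IH] mN.
  by case: I_prim => -[I_prop _] _; apply: (proper_ideal1 I_prop); apply: mN.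
by apply: IH => a aN; apply: LI => z mz; apply: mN; rewrite mulrC; apply: mem_ideal_mul.
Qed.

Lemma is_order_elem n : is_order m I n -> exists2 f, I f & ~ mpow n.+1 f.
Proof. by case=> _ I_max; apply: not_mpow_sub => /I_max; rewrite ltnn. Qed.

(** The line [p] is chosen transversal to an [f] in [I] of least order and contracted at once.
    Modulo [p], [f] is a unit times [y^(n+1)] and so generates the image of [I]; the remaining
    multiple [s * p] lies in [I], and contraction gives [s] in [I : m]. *)
Lemma contracted_generators n : is_order m I n.+1 -> exists p q f,
  [/\ params p q, I f, forall r, I r -> exists c s, L s /\ r = c * f + s * p
    & L `<=` mpow n].
Proof.
move=> I_ord; have [f If nf] := is_order_elem I_ord; case: (I_ord) => In _.
have [lam lamP] := residue_sequence R_reg R_inf; have [x [y xy]] := parameters_exist R_reg.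
have [i0 i0P] := transversal_eventually R_reg lamP xy (In f If) nf.
have [i i0i iL] := contracted_line R_reg R_inf I_prim I_closed i0 lamP xy.
pose p := line lam x y i; have py : params p y by apply: line_params.
have [a [u [nmu fE]]] := transversal_form py (In f If) (i0P i i0i).
have [u' u1] := local_unit R_noeth R_loc nmu.
exists p, y, f; split=> // [r Ir|s Ls].
  have [b [c rE]] := proj1 (transvP py n.+1 r) (transv_mpow p (In r Ir)).
  exists (c * u'), (b - c * u' * a).
  have E : r = c * u' * f + (b - c * u' * a) * p.
    transitivity (b * p + c * (u' * u) * y ^+ n.+1); first by rewrite u1 rE; ring.
    by rewrite fE; ring.
  split=> //; apply: iL; rewrite -/p (_ : _ * p = r - c * u' * f).
    by apply: idealB => //; apply: idealM.
  by rewrite {1}E; ring.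
apply: (mpow_cancel R_reg R_inf (param_notin_mpow2 R_reg py)).
by apply: In; apply: Ls; apply: parameters_l py.
Qed.

Section Module1.
Variables (n : nat) (p q g h : R).
Let f := h * p - g * q.
Hypotheses (n_gt0 : (0 < n)%N) (pq : params p q) (If : I f).
Hypothesis I_gen : forall r, I r -> exists c s, L s /\ r = c * f + s * p.
Hypotheses (L_n : L `<=` mpow n) (gn : mpow n g) (hn : mpow n h).

Definition module1 : set 'cV[R]_2 := [set v | exists c d l,
  L l /\ v = vec (c * p + d * q) (c * g + d * h + l)].

Lemma module1_submodule : submodule module1.
Proof.
apply/submoduleP; split.
  exists 0, 0, 0; split; first exact: (ideal0 L_id).
  by apply: vecP; rewrite !mxE; ring.
move=> a _ _ [c [d [l [Ll ->]]]] [c' [d' [l' [Ll' ->]]]].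
exists (a * c + c'), (a * d + d'), (a * l + l'); split.
  exact: (idealD L_id (idealM _ L_id Ll) Ll').
by apply: vecP; rewrite !mxE /=; ring.
Qed.

Lemma module1_p : module1 (vec p g).
Proof.
exists 1, 0, 0; split; first exact: (ideal0 L_id).
by apply: vecP; rewrite !mxE /=; ring.
Qed.

Lemma module1_q : module1 (vec q h).
Proof.
exists 0, 1, 0; split; first exact: (ideal0 L_id).
by apply: vecP; rewrite !mxE /=; ring.
Qed.

Lemma module1_l l : L l -> module1 (vec 0 l).
Proof. by move=> Ll; exists 0, 0, l; split=> //; apply: vecP; rewrite !mxE /=; ring. Qed.

Lemma module1_snd v : module1 v -> mpow n (v 1 0).
Proof.
case=> c [d [l [Ll ->]]]; rewrite vec1E.
by apply: ideal_expD; [apply: ideal_expD; apply: ideal_expM|apply: L_n].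
Qed.

Lemma module1_maximal : in_maximal m module1.
Proof.
move=> v v1; split; last first.
  by rewrite -(mpow1 R_reg); apply: (ideal_exp_sub n_gt0); apply: module1_snd.
by case: v1 => c [d [l [_ ->]]]; rewrite vec0E; apply/pq; exists c, d.
Qed.

Lemma module1_minors : minors_ideal module1 = I.
Proof.
apply/seteqP; split.
  apply: minors_min => // _ _ [c [d [l [Ll ->]]]] [c' [d' [l' [Ll' ->]]]].
  rewrite (_ : det2 _ _ = (c * d' - d * c') * f + l' * (c * p + d * q)
                        - l * (c' * p + d' * q)); last by rewrite /det2 !mxE /f /=; ring.
  apply: idealB => //; last by apply: Ll; apply/pq; exists c', d'.
  apply: idealD => //; first exact: idealM.
  by apply: Ll'; apply/pq; exists c, d.
have M_id : ideal (minors_ideal module1) := ideal_spanP _.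
move=> r /I_gen [c [s [Ls ->]]]; apply: (idealD M_id).
  apply: (idealM _ M_id); rewrite (_ : f = det2 (vec p g) (vec q h)).
    by apply: mem_minors; [apply: module1_p|apply: module1_q].
  by rewrite /det2 !mxE /f /=; ring.
rewrite (_ : _ * _ = det2 (vec p g) (vec 0 s)).
  by apply: mem_minors; [apply: module1_p|apply: module1_l].
by rewrite /det2 !mxE /=; ring.
Qed.

(** Testing [v] against [0 x L] puts its first coordinate in [m], since [L] is not inside [I]. After
    subtraction of a combination of [(p, g)] and [(q, h)], testing against these two leaves [(0, l)]
    with [l * p] and [l * q] in [I]. *)
Lemma module1_isotropic : isotropic_to I module1 `<=` module1.
Proof.
move=> v vI.
have /pq [a [b v0E]] : m (v 0 0).
  apply: contrapT => nv0; apply: colon_max_not_sub => l Ll.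
  apply: (unit_mul_mem R_reg I_id nv0).
  have := vI _ (module1_l Ll); rewrite /det2 vec0E vec1E mulr0 subr0; exact.
pose l := v 1 0 - (a * g + b * h).
exists a, b, l; split; last by apply: vecP; rewrite !mxE /= -?v0E /l //; ring.
have lp : I (l * p).
  rewrite (_ : _ * _ = - (det2 v (vec p g) + b * f)).
    by apply: idealN => //; apply: idealD => //; [apply/vI/module1_p|apply: idealM].
  by rewrite /det2 !mxE /= v0E /l /f; ring.
have lq : I (l * q).
  rewrite (_ : _ * _ = a * f - det2 v (vec q h)).
    by apply: idealB => //; [apply: idealM|apply/vI/module1_q].
  by rewrite /det2 !mxE /= v0E /l /f; ring.
move=> z /pq [c [d ->]]; rewrite (_ : _ * _ = c * (l * p) + d * (l * q)); last by ring.
by apply: idealD => //; apply: idealM.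
Qed.

Let N1_cof := isotropic_contains_pow module1_isotropic.

(* Modulo [m^2] the module is [(p, 0), (q, 0)], so one of the two factors is [m]. *)
Lemma module1_indecomposable : (1 < n)%N ->
  ~ (forall r, I r -> exists l1 l2, [/\ L l1, L l2 & r = l1 * p + l2 * q]) ->
  ~ decomposable_in module1.
Proof.
move=> n1 I_mL dec.
have [e [f' [J [K [nmd J_prop K_prop NP IE]]]]] :=
  decomposable_ideals R_reg R_inf module1_submodule N1_cof module1_maximal dec.
rewrite module1_minors in IE.
have snd2 v : module1 v -> mpow 2 (v 1 0).
  by move=> /module1_snd; apply: ideal_exp_sub.
(* If the second coordinate of [e2] is a unit, then [J2 <= m^2]. The first coordinates, which fill
   [m], then come from [J1] modulo [m^2], so [J1 = m], [J2 <= L] and [I = m J2] is inside [m L]. *)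
have key (e1 e2 : 'cV[R]_2) (J1 J2 : set R) : ideal_proper J1 -> ideal_proper J2 ->
    I = ideal_mul J1 J2 ->
    (forall v, module1 v <-> exists a b, [/\ J1 a, J2 b & v = a *: e1 + b *: e2]) ->
    m (e2 1 0).
  move=> [J1_id J1_prop] [J2_id _] IE' NP'; apply: contrapT => ne2; apply: I_mL.
  have J2_2 b : J2 b -> mpow 2 b.
    move=> J2b; apply: (unit_mul_mem R_reg (ideal_exp_ideal m 2) ne2).
    have := snd2 (b *: e2); rewrite !mxE mulrC; apply; apply/NP'.
    by exists 0, b; rewrite scale0r add0r; split=> //; apply: ideal0.
  have mJ1 : m `<=` J1.
    apply: (nakayama R_noeth R_loc m_id J1_id) => r /pq [a [b rE]].
    have : module1 (a *: vec p g + b *: vec q h).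
      apply: (submodD module1_submodule); apply: (submodZ module1_submodule).
        exact: module1_p.
      exact: module1_q.
    move=> /NP' [c [d [J1c J2d]]] /(congr1 (fun v : 'cV_2 => v 0 0)).
    rewrite !mxE /= -rE => rE'; exists (c * e1 0 0); first exact: idealMC.
    rewrite (_ : r - _ = d * e2 0 0); last by rewrite rE'; ring.
    by rewrite -{2}(mpow1 R_reg); apply: (idealMC _ (ideal_exp_ideal m 2)); exact: J2_2.
  move=> r; have -> : I r = ideal_mul J1 J2 r by rewrite -IE'.
  suff : ideal_mul J1 J2 `<=` [set r | exists l1 l2, [/\ L l1, L l2 & r = l1 * p + l2 * q]].
    by apply.
  apply: ideal_mul_min => [|z k J1z J2k].
    apply/idealP; split.
      by exists 0, 0; split; [exact: (ideal0 L_id)|exact: (ideal0 L_id)|ring].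
    move=> a _ _ [s [t [Ls Lt ->]]] [s' [t' [Ls' Lt' ->]]].
    exists (a * s + s'), (a * t + t'); split; last by ring.
      exact: (idealD L_id (idealM _ L_id Ls) Ls').
    exact: (idealD L_id (idealM _ L_id Lt) Lt').
  have Lk : L k by move=> y my; rewrite IE' mulrC; apply: mem_ideal_mul => //; apply: mJ1.
  have /pq [a [b ->]] : m z by apply: (proper_maximal R_reg (conj J1_id J1_prop)).
  exists (a * k), (b * k); split; last by ring.
    exact: (idealM _ L_id).
  exact: (idealM _ L_id).
apply: nmd; rewrite det2N; apply: idealN => //.
rewrite /det2; apply: idealB => //.
  apply: idealM => //; apply: (key f' e K J) => //; first by rewrite ideal_mulC.
  move=> v; apply: (iff_trans (NP v)).
  by split=> -[a [b [Ha Hb ->]]]; exists b, a; rewrite addrC.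
by apply: idealMC => //; apply: (key e f' J K).
Qed.

Lemma module1_simple : simple_ideal I -> ~ decomposable_in module1.
Proof.
case=> _ _ I_simple dec; apply: I_simple.
have [e [f' [J [K [_ J_prop K_prop _ IE]]]]] :=
  decomposable_ideals R_reg R_inf module1_submodule N1_cof module1_maximal dec.
by exists J, K; split=> //; rewrite -module1_minors.
Qed.

(* The factors of a splitting would have the tangent [x] too, hence it would lie in
   [x F + m^2 F], although its first coordinates fill [m]. *)
Lemma module1_tangent x y J0 K0 : params x y -> is_order m I 2 -> I = ideal_mul J0 K0 ->
  J0 `<=` transv x 2 -> K0 `<=` transv x 2 -> ~ decomposable_in module1.
Proof.
move=> xy I_ord IE0 J0x K0x dec.
have [e [f' [J [K [_ J_prop K_prop NP IE]]]]] :=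
  decomposable_ideals R_reg R_inf module1_submodule N1_cof module1_maximal dec.
rewrite module1_minors in IE.
have nx2 := param_notin_mpow2 R_reg xy.
have [mx my] := (parameters_l xy, parameters_r xy).
(* The quadratic part of every element of [I] is a multiple of [x^2]. *)
have Ix r : I r -> exists a, mpow 3 (r - a * (x * x)).
  rewrite IE0; suff : ideal_mul J0 K0 `<=` [set r | exists a, mpow 3 (r - a * (x * x))] by apply.
  apply: ideal_mul_min => [|j k /J0x /ideal_addP [_ [s [[a ->] s2 ->]]]].
    apply/idealP; split; first by exists 0; rewrite mul0r subr0; apply: (ideal0 (ideal_exp_ideal m 3)).
    move=> a u v [b ub] [c vc]; exists (a * b + c).
    rewrite (_ : _ - _ = a * (u - b * (x * x)) + (v - c * (x * x))); last by ring.
    by apply: ideal_expD => //; apply: ideal_expM.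
  move=> /K0x /ideal_addP [_ [t [[b ->] t2 ->]]]; exists (a * b).
  rewrite (_ : _ - _ = a * (x * t) + b * (x * s) + s * t); last by ring.
  apply: ideal_expD; first by apply: ideal_expD; apply: ideal_expM; apply: mem_ideal_mul.
  by apply: (ideal_exp_sub (i := 3) (j := 4)) => //; apply: (ideal_exp_mul (i := 2) (j := 2)).
have JK a b c d : J (a * x + b * y) -> K (c * x + d * y) ->
    m (b * d) /\ m (a * d + b * c).
  move=> Jj Kk; have [|s] := Ix ((a * x + b * y) * (c * x + d * y)).
    by rewrite IE; apply: mem_ideal_mul.
  rewrite (_ : _ - _ = ((a * c - s) * x + (a * d + b * c) * y) * x + b * d * y ^+ 2);
    last by ring.
  move=> E3.
  have mbd : m (b * d).
    apply: contrapT => nbd; apply: (unit_param_pow_notin_transv R_reg xy nbd (n := 2)).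
    rewrite -[b * d * _](addKr (((a * c - s) * x + (a * d + b * c) * y) * x)) addrC.
    by apply: transvB; [apply: transv_mpow|apply: transv_mulx].
  split=> //; apply: (proj2 (@params_lin_indep _ _ R_reg x y (a * c - s) _ xy _)).
  apply: (mpow_cancel R_reg R_inf nx2).
  rewrite -[_ * x](addrK (b * d * y ^+ 2)); apply: (idealB (ideal_exp_ideal m 3)) => //.
  by apply: (mem_ideal_expS (n := 2)) => //; apply: ideal_expX.
have JM := proper_maximal R_reg J_prop; have KM := proper_maximal R_reg K_prop.
have m2 r s : m r -> m s -> mpow 2 (r * s) := mpow2_mul R_reg (s := s).
(* Since [I] has order two, some product [j0 * k0] has order exactly two. Both factors then have
   tangent [x], and by [JK] pairing any other element with one of them forces its linear part to be
   a multiple of [x]. *)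
have [j0 [k0 [Jj0 Kk0 njk]]] : exists j k, [/\ J j, K k & ~ mpow 3 (j * k)].
  apply: contrapT => no; suff /(proj2 I_ord) : I `<=` mpow 3 by [].
  rewrite IE; apply: ideal_mul_min => // j k Jj Kk.
  by apply: contrapT => njk; apply: no; exists j, k.
have nj2 : ~ mpow 2 j0.
  by move=> j2; apply: njk; rewrite mulrC; apply: mem_ideal_mul => //; apply: KM.
have nk2 : ~ mpow 2 k0.
  by move=> k2; apply: njk; apply: mem_ideal_mul => //; apply: JM.
have /xy [a0 [b0 j0E]] := JM _ Jj0; have /xy [c0 [d0 k0E]] := KM _ Kk0.
rewrite j0E in Jj0 nj2; rewrite k0E in Kk0 nk2.
have unit1 a b : ~ mpow 2 (a * x + b * y) -> m b -> ~ m a.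
  by move=> n2 mb ma; apply: n2; apply: ideal_expD; apply: m2.
have [mbd mad] := JK _ _ _ _ Jj0 Kk0.
have [mb0 md0] : m b0 /\ m d0.
  have [mb|md] := maximal_prime R_noeth R_loc mbd; split=> //.
    have na := unit1 _ _ nj2 mb.
    have [] // : m a0 \/ m d0.
    apply: (maximal_prime R_noeth R_loc).
    by rewrite -[a0 * d0](addrK (b0 * c0)); apply: idealB => //; apply: idealMC.
  have nc := unit1 _ _ nk2 md.
  have [] // : m b0 \/ m c0.
  apply: (maximal_prime R_noeth R_loc).
  rewrite -[b0 * c0](addrK (a0 * d0)) [_ + a0 * d0]addrC; apply: idealB => //.
  exact: idealM.
have na0 := unit1 _ _ nj2 mb0; have nc0 := unit1 _ _ nk2 md0.
have tx a b : m b -> transv x 2 (a * x + b * y).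
  by move=> mb; apply: transvD; [apply: transv_mulx|apply: transv_mpow; apply: m2].
have Jx j : J j -> transv x 2 j.
  move=> Jj; have /xy [a [b jE]] := JM _ Jj; rewrite jE in Jj *; apply: tx.
  have [_ mE] := JK _ _ _ _ Jj Kk0.
  have [] // : m b \/ m c0.
  apply: (maximal_prime R_noeth R_loc).
  rewrite -[b * c0](addrK (a * d0)) [_ + a * d0]addrC; apply: idealB => //.
  exact: idealM.
have Kx k : K k -> transv x 2 k.
  move=> Kk; have /xy [c [d kE]] := KM _ Kk; rewrite kE in Kk *; apply: tx.
  have [_ mE] := JK _ _ _ _ Jj0 Kk.
  have [] // : m a0 \/ m d.
  apply: (maximal_prime R_noeth R_loc).
  by rewrite -[a0 * d](addrK (b0 * c)); apply: idealB => //; apply: idealMC.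
have fstx v : module1 v -> transv x 2 (v 0 0).
  move=> /NP [a [b [Ja Kb ->]]]; rewrite !mxE; apply: transvD; rewrite mulrC; apply: transvM.
    exact: Jx.
  exact: Kx.
apply: (param_pow_notin_transv R_reg xy (n := 1)); rewrite expr1.
have /pq [a [b ->]] := my; apply: transvD; apply: transvM.
  by have := fstx _ module1_p; rewrite vec0E.
by have := fstx _ module1_q; rewrite vec0E.
Qed.

End Module1.
End ContractedModule.

(** * The second module, for [I = m L], and the construction in all cases *)

Section ProductModule.
Variables (R : comNzRingType) (m : set R) (R_reg : regular_local_ring m 2).
Hypothesis R_inf : infinite_residue_field m.

Let R_loc : local_ring m. Proof. by case: R_reg. Qed.
Let m_id : ideal m. Proof. exact: maximal_is_ideal R_loc. Qed.

Local Notation mpow := (ideal_exp m).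
Local Notation params := (parameters m).
Local Notation transv := (transv m).

Variables (I : set R) (I_prim : primary_to m I) (I_closed : integrally_closed_ideal I).

Let I_id : ideal I. Proof. exact: primary_ideal_ideal I_prim. Qed.

Local Notation L := (colon_max m I).

Let L_id : ideal L. Proof. exact: colon_max_ideal I_prim. Qed.

Lemma ideal_sub_transv (J : set R) x y c : params x y -> ideal J -> J x ->
  J (y ^+ c) -> transv x c `<=` J.
Proof.
move=> xy J_id Jx Jy r /(transvP xy) [a [b ->]].
by apply: idealD => //; apply: idealM.
Qed.

Section Module2.
Variables (n : nat) (p q : R).
Hypotheses (n1 : (1 < n)%N) (pq : params p q) (L_n : L `<=` mpow n).
Hypothesis I_mL : forall r, I r -> exists l1 l2, [/\ L l1, L l2 & r = l1 * p + l2 * q].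

Definition module2 : set 'cV[R]_2 := [set v | exists c l1 l2,
  [/\ L l1, L l2 & v = vec (c * p + l1) (c * q + l2)]].

Let mp : m p. Proof. exact: parameters_l pq. Qed.
Let mq : m q. Proof. exact: parameters_r pq. Qed.
Let L2 l : L l -> mpow 2 l.
Proof. by move=> /L_n; apply: ideal_exp_sub. Qed.
Let Lm l : L l -> m l.
Proof. by move=> /L2 /(ideal_exp_sub (i := 1) (j := 2) isT); rewrite (mpow1 R_reg). Qed.

Lemma module2_submodule : submodule module2.
Proof.
apply/submoduleP; split.
  exists 0, 0, 0; split; [exact: (ideal0 L_id)|exact: (ideal0 L_id)|].
  by apply: vecP; rewrite !mxE; ring.
move=> a _ _ [c [s [t [Ls Lt ->]]]] [c' [s' [t' [Ls' Lt' ->]]]].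
exists (a * c + c'), (a * s + s'), (a * t + t'); split.
- exact: (idealD L_id (idealM _ L_id Ls) Ls').
- exact: (idealD L_id (idealM _ L_id Lt) Lt').
- by apply: vecP; rewrite !mxE /=; ring.
Qed.

Lemma module2_pq : module2 (vec p q).
Proof.
exists 1, 0, 0; split; [exact: (ideal0 L_id)|exact: (ideal0 L_id)|].
by apply: vecP; rewrite !mxE /=; ring.
Qed.

Lemma module2_l l1 l2 : L l1 -> L l2 -> module2 (vec l1 l2).
Proof. by move=> Ll1 Ll2; exists 0, l1, l2; split=> //; apply: vecP; rewrite !mxE /=; ring. Qed.

Lemma module2_maximal : in_maximal m module2.
Proof.
move=> _ [c [l1 [l2 [/Lm m1 /Lm m2 ->]]]]; rewrite vec0E vec1E.
by split; apply: idealD => //; apply: idealM.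
Qed.

Lemma module2_minors : minors_ideal module2 = I.
Proof.
apply/seteqP; split.
  apply: minors_min => // _ _ [c [s [t [Ls Lt ->]]]] [c' [s' [t' [Ls' Lt' ->]]]].
  rewrite (_ : det2 _ _ = (t' * (c * p + s) + s * (c' * q)) - (s' * (c * q + t) + t * (c' * p)));
    last by rewrite /det2 !mxE /=; ring.
  apply: idealB => //; apply: idealD => //.
  - by apply: Lt'; apply: idealD => //; [apply: idealM|apply: Lm].
  - by apply: Ls; apply: idealM.
  - by apply: Ls'; apply: idealD => //; [apply: idealM|apply: Lm].
  - by apply: Lt; apply: idealM.
move=> r /I_mL [l1 [l2 [Ll1 Ll2 ->]]].
rewrite (_ : _ + _ = det2 (vec p q) (vec (- l2) l1)); last by rewrite /det2 !mxE /=; ring.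
by apply: mem_minors; [apply: module2_pq|apply: module2_l => //; apply: (idealN L_id)].
Qed.

(** The single test vector [(p, q)] is enough: as [I = m L], the determinant is [l1 * p + l2 * q],
    and regularity of [p], [q] makes [v - (l2, - l1)] a multiple of [(p, q)]. *)
Lemma module2_isotropic : isotropic_to I module2 `<=` module2.
Proof.
move=> v /(_ _ module2_pq); rewrite /det2 vec0E vec1E => /I_mL [l1 [l2 [Ll1 Ll2 E]]].
have [|c [c1 c2]] := params_regular R_reg R_inf pq (a := v 1 0 + l1) (b := v 0 0 - l2).
  by apply/eqP; rewrite -subr_eq0; apply/eqP; transitivity (l1 * p + l2 * q -
    (v 0 0 * q - v 1 0 * p)); [ring|rewrite E; ring].
exists c, l2, (- l1); split=> //; first exact: (idealN L_id).
by apply: vecP; rewrite !mxE /= -?c1 -?c2; ring.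
Qed.

(* Modulo [m^2] the module is spanned by [(p, q)], a tensor of rank two, which
   rules out a splitting. *)
Lemma module2_indecomposable : ~ decomposable_in module2.
Proof.
move=> dec; have N_cof : contains_pow_mult m module2.
  exact (isotropic_contains_pow I_prim module2_isotropic).
have [e [f [J [K [nmd [J_id _] [K_id _] NP _]]]]] :=
  decomposable_ideals R_reg R_inf module2_submodule N_cof module2_maximal dec.
(* If a multiple of [e'] is a unit times [(p, q)] modulo [m^2], then [e' 1 0 * p - e' 0 0 * q] lies
   in [m^2], and independence of [p], [q] there puts both coordinates of [e'] in [m]. *)
have key u (t l1 l2 : R) (e' : 'cV[R]_2) : ~ m u -> L l1 -> L l2 ->
    t *: e' = vec (u * p + l1) (u * q + l2) -> m (e' 0 0) /\ m (e' 1 0).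
  move=> nu Ll1 Ll2 tE.
  have t0 := congr1 (fun v : 'cV_2 => v 0 0) tE; have t1 := congr1 (fun v : 'cV_2 => v 1 0) tE.
  rewrite !mxE /= in t0 t1.
  have [|m1 m0] := params_lin_indep R_reg (a := e' 1 0) (b := - e' 0 0) pq.
    apply: (unit_mul_mem R_reg (ideal_exp_ideal m 2) nu).
    rewrite (_ : _ * _ = e' 0 0 * l2 - e' 1 0 * l1).
      by apply: (idealB (ideal_exp_ideal m 2)); apply: ideal_expM; apply: L2.
    apply/eqP; rewrite -subr_eq0; apply/eqP.
    transitivity (e' 1 0 * (u * p + l1) - e' 0 0 * (u * q + l2)); first by ring.
    by rewrite -t0 -t1; ring.
  by split=> //; rewrite -[e' 0 0]opprK; apply: idealN.
(* The two components of [(p, q)] are [c (p, q)] and [(1 - c) (p, q)] modulo [L F], and one of [c],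
   [1 - c] is a unit. *)
have /NP [a [b [Ja Kb pqE]]] := module2_pq.
have [c [l1 [l2 [Ll1 Ll2 aE]]]] : module2 (a *: e).
  by apply/NP; exists a, 0; rewrite scale0r addr0; split=> //; apply: ideal0.
have [mc|nc] := pselect (m c); last first.
  have [m0 m1] := key c a l1 l2 e nc Ll1 Ll2 aE; by apply: nmd; apply: (det2_maximal R_reg).
have n1c : ~ m (1 - c).
  move=> m1c; apply: (maximal1 R_loc); rewrite -[1](subrK c); exact: idealD.
have [|m0 m1] := key (1 - c) b (- l1) (- l2) f n1c (idealN L_id Ll1) (idealN L_id Ll2).
  rewrite (_ : b *: f = vec p q - a *: e); last by rewrite pqE addrC addKr.
  by rewrite aE; apply: vecP; rewrite !mxE /=; ring.
apply: nmd; rewrite det2N; apply: idealN => //; exact: (det2_maximal R_reg).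
Qed.

End Module2.

Lemma exists_plane_module n : is_order m I n -> (1 < n)%N ->
  [\/ (2 < n)%N, simple_ideal I | n = 2 /\ exists J K x y,
     [/\ params x y, I = ideal_mul J K, J `<=` transv x 2 & K `<=` transv x 2]] ->
  exists N : set 'cV[R]_2, [/\ submodule N, minors_ideal N = I,
    isotropic_to I N `<=` N & ~ decomposable_in N].
Proof.
case: n => // n I_ord n_gt0 cases.
have [p [q [f [pq If I_gen L_n]]]] := contracted_generators R_reg R_inf I_prim I_closed I_ord.
have /(mpowSP pq) [h [g' [hn gn' fE]]] := proj1 I_ord _ If.
pose g := - g'; have gn : mpow n g by apply: (idealN (ideal_exp_ideal m n)).
have {}fE : f = h * p - g * q by rewrite fE /g; ring.
rewrite fE in If I_gen.
have N1 : ~ decomposable_in (module1 m I p q g h) ->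
  exists N : set 'cV[R]_2, [/\ submodule N, minors_ideal N = I,
    isotropic_to I N `<=` N & ~ decomposable_in N].
  move=> nd; exists (module1 m I p q g h); split=> //.
  - exact: module1_submodule.
  - exact: module1_minors.
  - exact: module1_isotropic.
case: cases => [n2|I_simple|[nE [J [K [x [y [xy IE Jx Kx]]]]]]].
- have [I_mL|nI_mL] := pselect (forall r, I r ->
    exists l1 l2, [/\ L l1, L l2 & r = l1 * p + l2 * q]); last first.
    by apply: N1; exact: (module1_indecomposable R_reg R_inf I_prim n_gt0 pq If I_gen L_n gn hn n2 nI_mL).
  exists (module2 p q); split.
  + exact: module2_submodule.
  + exact: (module2_minors n2 pq L_n I_mL).
  + exact: (module2_isotropic pq I_mL).
  + exact: (module2_indecomposable n2 pq L_n I_mL).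
- by apply: N1; exact: (module1_simple R_reg R_inf I_prim n_gt0 pq If I_gen L_n gn hn I_simple).
- rewrite nE in I_ord; apply: N1.
  by apply: (module1_tangent R_reg R_inf I_prim n_gt0 pq If I_gen L_n gn hn xy I_ord IE Jx Kx).
Qed.

End ProductModule.

(** * Necessity of the conditions *)

Section Necessity.
Variables (R : comNzRingType) (m : set R) (R_reg : regular_local_ring m 2).
Hypothesis R_inf : infinite_residue_field m.

Let R_noeth : noetherian R. Proof. by case: R_reg. Qed.
Let R_loc : local_ring m. Proof. by case: R_reg. Qed.
Let m_id : ideal m. Proof. exact: maximal_is_ideal R_loc. Qed.
Let dom : forall a b : R, a * b = 0 -> a = 0 \/ b = 0.
Proof. exact: regular_integral R_reg R_inf. Qed.

Local Notation mpow := (ideal_exp m).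
Local Notation params := (parameters m).
Local Notation transv := (transv m).

(** An ideal containing [x] is determined by its image in the discrete valuation ring [R / (x)]; the
    exponent is the least [a] with [m^a <= J]. *)
Lemma order_one_transv (J : set R) x y k : params x y -> ideal J -> J x ->
  mpow k `<=` J -> exists a, J = transv x a.
Proof.
move=> xy J_id Jx mJ; have exJ : exists a, `[< mpow a `<=` J >] by exists k; apply/asboolP.
have [a /asboolP aJ a_min] := ex_minnP exJ; exists a.
have sub c : J (y ^+ c) -> transv x c `<=` J by exact: ideal_sub_transv.
apply/seteqP; split; last first.
  by apply: sub; apply: aJ; apply: ideal_expX; apply: parameters_r xy.
move=> r Jr; case: (transv_dichotomy xy a r) => // -[c [b [u [ca nu rE]]]].
have Jy : J (y ^+ c).
  apply: (unit_mul_mem R_reg J_id nu); rewrite (_ : _ * _ = r - b * x); last by rewrite rE; ring.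
  by apply: idealB => //; apply: idealM.
have : `[< mpow c `<=` J >] by apply/asboolP => s /(transv_mpow x); apply: sub.
by move=> /a_min; rewrite leqNgt ca.
Qed.

Lemma transv_mul x y i j r s : params x y ->
  transv x i r -> transv x j s -> transv x (i + j) (r * s).
Proof.
move=> xy /(transvP xy) [a [b ->]] /(transvP xy) [c [d ->]].
apply/(transvP xy); exists (a * (c * x + d * y ^+ j) + b * y ^+ i * c), (b * d).
by rewrite exprD; ring.
Qed.

Lemma transv_exp x y a i : params x y ->
  ideal_exp (transv x a) i `<=` transv x (i * a).
Proof.
move=> xy; elim: i => [|i IH].
  by move=> r _; apply/(transvP xy); exists 0, r; rewrite mul0n; ring.
rewrite mulSn; apply: ideal_mul_min; first exact: transv_ideal.
by move=> r s ra /IH; apply: transv_mul.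
Qed.

(** A valuation argument modulo [x]. If [r] has [y]-order [c < a], then [r^k] has order exactly
    [k c], whereas the other terms of an equation have order at least [i a + (k - i) c], which is
    larger. *)
Lemma transv_integrally_closed x y a : params x y -> integrally_closed_ideal (transv x a).
Proof.
move=> xy; have J_id := transv_ideal m x a; split=> //.
apply/seteqP; split=> r; last first.
  move=> Jr; exists 1%N => //; exists (fun=> - r) => [i /andP [i0 i1]|].
    have -> : i = 1%N by apply/eqP; rewrite eqn_leq i1.
    by rewrite (ideal_exp1 J_id); apply: idealN.
  by rewrite big_nat1 subnn expr0 expr1 mulr1 subrr.
case=> k k0 [al al_J eq]; case: (transv_dichotomy xy a r) => // -[c [b [u [ca nu rE]]]].
have r_c j : transv x (j * c) (r ^+ j).
  elim: j => [|j IH]; first by apply/(transvP xy); exists 0, 1; rewrite mul0n; ring.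
  rewrite exprS mulSn; apply: (transv_mul xy) => //.
  by apply/(transvP xy); exists b, u.
have rk : transv x (k * c).+1 (r ^+ k).
  rewrite -[r ^+ k](addrK (\sum_(1 <= i < k.+1) al i * r ^+ (k - i))) eq sub0r.
  apply: (idealN (transv_ideal m x _)); rewrite big_nat.
  apply: (@ideal_sum _ _ _ _ _ _ (transv_ideal m x _)) => i /andP [i0 ik].
  have := transv_mul xy (transv_exp xy (al_J i _)) (r_c (k - i)%N).
  rewrite i0 -ltnS ik => /(_ isT); apply: transv_sub; nia.
have [s rkE] : exists s, r ^+ k = s * x + u ^+ k * y ^+ (k * c).
  elim: (k) => [|j [s sE]]; first by exists 0; rewrite mul0n; ring.
  exists (s * r + u ^+ j * y ^+ (j * c) * b).
  transitivity ((s * x + u ^+ j * y ^+ (j * c)) * r); first by rewrite exprSr sE.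
  transitivity (s * r * x + u ^+ j * y ^+ (j * c) * (b * x + u * y ^+ c)).
    by rewrite -rE; ring.
  by rewrite mulSn exprD exprS; ring.
have nuk : ~ m (u ^+ k).
  elim: (k) => [|j IH]; first by rewrite expr0; apply: (maximal1 R_loc).
  by rewrite exprS => /(maximal_prime R_noeth R_loc) [].
case: (unit_param_pow_notin_transv R_reg xy nuk (n := k * c)).
rewrite (_ : _ * _ = r ^+ k - s * x); last by rewrite rkE; ring.
by apply: transvB => //; apply: transv_mulx.
Qed.

Lemma order_one_simple (J : set R) : ideal_proper J -> ~ J `<=` mpow 2 -> simple_ideal J.
Proof.
move=> J_prop nJ2; split=> //; first by move=> J0; apply: nJ2; rewrite J0 => _ ->; apply: ideal0.
move=> [A [B [/(proper_maximal R_reg) Am /(proper_maximal R_reg) Bm JE]]]; apply: nJ2.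
by rewrite JE; apply: (@mul_mpow_sub _ m A B 1 1); rewrite (mpow1 R_reg).
Qed.

(** * Sufficient conditions for a plane module to split *)

Section Splitting.
Variables (I : set R) (N : set 'cV[R]_2).
Hypotheses (N_sub : submodule N) (I_nz : exists2 a, I a & a <> 0).
Hypotheses (NI : minors_ideal N = I).

Let I_id : ideal I. Proof. by rewrite -NI; apply: ideal_spanP. Qed.

Lemma line_submodule (J : set R) (e : 'cV[R]_2) : ideal J ->
  submodule [set v | exists2 a, J a & v = a *: e].
Proof.
move=> J_id; apply/submoduleP; split; first by exists 0; [apply: ideal0|rewrite scale0r].
move=> r _ _ [a Ja ->] [b Jb ->]; exists (r * a + b); last by rewrite scalerDl scalerA.
by apply: idealD => //; apply: idealM.
Qed.

Lemma det2_split (e f : 'cV[R]_2) : ~ m (det2 e f) ->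
  forall v, exists a b, v = a *: e + b *: f.
Proof.
move=> /(local_unit R_noeth R_loc) [d d1] v; exists (d * det2 v f), (d * det2 e v).
rewrite -!scalerA -scalerDr (_ : _ + _ = det2 e f *: v); last by rewrite -cramer2.
by rewrite scalerA d1 scale1r.
Qed.

Lemma unit_neq0 (a : R) : ~ m a -> a <> 0.
Proof. by move=> na a0; apply: na; rewrite a0; apply: ideal0. Qed.

Lemma det2_indep (e f : 'cV[R]_2) a b : ~ m (det2 e f) -> a *: e = b *: f -> a = 0.
Proof.
move=> nd ab; have : a * det2 e f = 0 by rewrite -det2Zl ab det2Zl det2vv mulr0.
by move=> /dom [//|/(unit_neq0 nd)].
Qed.

(** The vector [w] spans a free summand with complement the part of [N] on the line of [e]. That
    part is nonzero, since otherwise all minors of [N] would vanish. *)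
Lemma unit_vector_decomposable w e : N w -> ~ m (det2 w e) -> decomposable_in N.
Proof.
move=> Nw nd; have T_id := ideal_setT R.
have NQ_sub : submodule [set v | N v /\ exists b, v = b *: e].
  apply/submoduleP; split; first by split; [apply: submod0|exists 0; rewrite scale0r].
  move=> r u v [Nu [a ua]] [Nv [b vb]]; split; first by apply: submodD => //; apply: submodZ.
  by exists (r * a + b); rewrite ua vb scalerDl scalerA.
exists [set v | exists2 a, [set: R] a & v = a *: w], [set v | N v /\ exists b, v = b *: e].
have w0 : w <> 0 by move=> w0; apply: nd; rewrite w0 /det2 !mxE !mul0r subrr; apply: ideal0.
have dec v : N v -> exists a b, v = a *: w + b *: e /\ N (b *: e).
  move=> Nv; have [a [b vE]] := det2_split nd v; exists a, b; split=> //.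
  by rewrite (_ : b *: e = v - a *: w); [apply: submodB => //; apply: submodZ|rewrite vE addrC addKr].
split.
- split; first exact: line_submodule.
  move=> P0; apply: w0; have : [set v | exists2 a, [set: R] a & v = a *: w] w.
    by exists 1; rewrite // scale1r.
  by rewrite P0.
- split=> // Q0; have [a Ia a0] := I_nz; apply: a0; move: Ia; rewrite -NI.
  have zero_id : ideal [set (0 : R)].
    by apply/idealP; split=> // r _ _ -> ->; rewrite mulr0 addr0.
  have Nw' v : N v -> exists c, v = c *: w.
    move=> Nv; have [c [b [vE Nb]]] := dec v Nv; exists c.
    have : [set v | N v /\ exists b, v = b *: e] (b *: e) by split=> //; exists b.
    by rewrite Q0 vE => ->; rewrite addr0.
  suff : minors_ideal N `<=` [set 0] by apply.
  apply: minors_min => // u v /Nw' [c ->] /Nw' [d ->].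
  by rewrite /= det2Zl det2N det2Zl det2vv; ring.
- apply/seteqP; split=> [_ [_ [a _ ->] [v [Nv _] <-]]|v Nv].
    by apply: submodD => //; apply: submodZ.
  have [a [b [-> Nb]]] := dec v Nv; exists (a *: w); first by exists a.
  by exists (b *: e) => //; split=> //; exists b.
- apply/seteqP; split=> [v [[a _ ->] [_ [b ab]]]|_ ->].
    by rewrite (det2_indep nd ab) scale0r.
  split; last exact: (submod0 NQ_sub).
  by exists 0; rewrite ?scale0r.
Qed.

Lemma indecomposable_in_maximal : ~ decomposable_in N -> in_maximal m N.
Proof.
move=> nd v Nv; split; apply: contrapT => nv; apply: nd.
  by apply: (@unit_vector_decomposable v (vec 0 1)); rewrite // /det2 !mxE /= mulr1 mulr0 subr0.
apply: (@unit_vector_decomposable v (vec 1 0)); rewrite // /det2 !mxE /= mulr1 mulr0 sub0r.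
by move=> /(idealN m_id); rewrite opprK.
Qed.

(* If [x p + y q] is in [N], isotropy splits it into [x p] and [y q]; since [x y] is
   in [I], some [x e] and [y f] in [N] have [det2 e f] invertible, and then
   [N = J e + K f] by isotropy again. *)
Lemma transverse_decomposable x y a b : params x y ->
  I = ideal_mul (transv x a.+1) (transv y b.+1) ->
  isotropic_to I N `<=` N -> in_maximal m N -> decomposable_in N.
Proof.
move=> xy IE N_iso N_max; have yx := parameters_sym xy.
have [mx my] := (parameters_l xy, parameters_r xy).
have Jx : transv x a.+1 x by apply: transv_principal; exists 1; rewrite mul1r.
have Ky : transv y b.+1 y by apply: transv_principal; exists 1; rewrite mul1r.
have Jy : transv x a.+1 (y ^+ a.+1) by apply: transv_mpow; apply: ideal_expX.
have Kx : transv y b.+1 (x ^+ b.+1) by apply: transv_mpow; apply: ideal_expX.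
have IJK r s : transv x a.+1 r -> transv y b.+1 s -> I (r * s).
  by rewrite IE; apply: mem_ideal_mul.
have Ixy : I (x * y) by apply: IJK.
have Jsub : transv x a.+1 `<=` transv y 1.
  move=> r /(transvP xy) [c [d ->]]; apply/(transvP yx).
  by exists (d * y ^+ a), c; rewrite exprSr expr1; ring.
have Ksub : transv y b.+1 `<=` transv x 1.
  move=> r /(transvP yx) [c [d ->]]; apply/(transvP xy).
  by exists (d * x ^+ b), c; rewrite exprSr expr1; ring.
(* Modulo [y] the second factor is generated by [x^(b+1)] and the first contributes one more [x];
   hence the exponent [b + 2]. The bound [Ix] is symmetric. *)
have Iy : I `<=` transv y b.+2.
  rewrite IE; apply: ideal_mul_min; first exact: transv_ideal.
  by move=> r s /Jsub r1 s1; rewrite -add1n; apply: (transv_mul yx).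
have Ix : I `<=` transv x a.+2.
  rewrite IE; apply: ideal_mul_min; first exact: transv_ideal.
  by move=> r s r1 /Ksub s1; rewrite -addn1; apply: (transv_mul xy).
(* Modulo [y] only [al * x^2] survives, so [Iy] gives [al] in [(y, x^b)] after cancelling [x] twice.
   Then [al * x^2] is a combination of [x * y] and [x * x^(b+1)], both in [I]. *)
have sq_split al be : I (al * x ^+ 2 + be * y ^+ 2) -> I (al * x ^+ 2).
  move=> /Iy H; have : transv y b.+2 (al * x * x).
    rewrite (_ : _ * _ = al * x ^+ 2 + be * y ^+ 2 - be * y * y); last by ring.
    by apply: transvB => //; apply: transv_mulx.
  move=> /(transv_cancel R_reg yx) /(transv_cancel R_reg yx) /(transvP yx) [s [t ->]].
  rewrite (_ : _ * _ = s * x * (x * y) + t * (x * x ^+ b.+1)); last by rewrite [x ^+ b.+1]exprS; ring.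
  by apply: idealD => //; apply: idealM => //; apply: IJK.
pose P := [set p : 'cV[R]_2 | N (x *: p)]; pose Q := [set q : 'cV[R]_2 | N (y *: q)].
have coordP v : N v -> exists p q, v = x *: p + y *: q.
  move=> /N_max [/xy [c [d v0]] /xy [c' [d' v1]]]; exists (vec c c'), (vec d d').
  by apply: vecP; rewrite !mxE /= ?v0 ?v1; ring.
have detE p q p' q' : det2 (x *: p + y *: q) (x *: p' + y *: q') =
    det2 p p' * x ^+ 2 + (det2 p q' + det2 q p') * (x * y) + det2 q q' * y ^+ 2.
  by rewrite /det2 !mxE; ring.
have NPQ p q : N (x *: p + y *: q) -> P p /\ Q q.
  move=> Npq; suff Pp : P p.
    split=> //; rewrite /Q /= (_ : y *: q = (x *: p + y *: q) - x *: p); first exact: submodB.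
    by rewrite addrC addKr.
  apply: N_iso => w Nw; have [p' [q' wE]] := coordP w Nw; rewrite wE in Nw *.
  have := mem_minors Npq Nw; rewrite NI detE => H.
  have /sq_split Ip : I (det2 p p' * x ^+ 2 + det2 q q' * y ^+ 2).
    rewrite (_ : _ + _ = det2 p p' * x ^+ 2 + (det2 p q' + det2 q p') * (x * y)
      + det2 q q' * y ^+ 2 - (det2 p q' + det2 q p') * (x * y)); last by ring.
    by apply: idealB => //; apply: idealM.
  rewrite (_ : det2 _ _ = det2 p p' * x ^+ 2 + det2 p q' * (x * y)).
    by apply: idealD => //; apply: idealM.
  by rewrite /det2 !mxE; ring.
have [e [f [Pe Qf nd]]] : exists e f, [/\ P e, Q f & ~ m (det2 e f)].
  apply: contrapT => no.
  (* If no such pair exists, the coefficient of [x * y] in every minor is in [m], so all of [I] lies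
     in [E]. But [x * y] does not: [be] would be divisible by [x], and cancelling [x] would leave a
     unit multiple of [y] in [(x) + m^2]. *)
  pose E := [set r | exists al be ga, m ga /\ r = al * x ^+ 2 + ga * (x * y) + be * y ^+ 2].
  have E_id : ideal E.
    apply/idealP; split; first by exists 0, 0, 0; split; [apply: ideal0|ring].
    move=> c _ _ [al [be [ga [mg ->]]]] [al' [be' [ga' [mg' ->]]]].
    exists (c * al + al'), (c * be + be'), (c * ga + ga'); split; last by ring.
    by apply: idealD => //; apply: idealM.
  have mPQ p q : P p -> Q q -> m (det2 p q).
    by move=> Pp Qq; apply: contrapT => nd; apply: no; exists p, q.
  have : E (x * y).
    move: (x * y) Ixy; rewrite -NI; apply: minors_min => // u w Nu Nw.
    have [p [q uE]] := coordP u Nu; have [p' [q' wE]] := coordP w Nw.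
    rewrite uE wE in Nu Nw *; have [Pp Qq] := NPQ _ _ Nu; have [Pp' Qq'] := NPQ _ _ Nw.
    exists (det2 p p'), (det2 q q'), (det2 p q' + det2 q p'); split; last exact: detE.
    apply: idealD => //; first exact: mPQ.
    by rewrite det2N; apply: idealN => //; apply: mPQ.
  case=> al [be [ga [mg xyE]]].
  have n1g : ~ m (1 - ga).
    move=> m1g; apply: (maximal1 R_loc); rewrite -[1](subrK ga); exact: idealD.
  have xyE' : be * y * y = ((1 - ga) * y - al * x) * x.
    apply/eqP; rewrite -subr_eq0; apply/eqP.
    transitivity (al * x ^+ 2 + ga * (x * y) + be * y ^+ 2 - x * y); first by ring.
    by rewrite -xyE subrr.
  have [be' beE] : principal x be.
    have : principal x (be * y * y) by exists ((1 - ga) * y - al * x).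
    by case/(principal_prime R_reg xy) => [/(principal_prime R_reg xy) []|] //
      => /(param_notin_principal R_reg xy).
  apply: (unit_param_pow_notin_transv R_reg xy n1g (n := 1)).
  apply/(transvP xy); exists al, be'; apply: (mulfI_regular R_reg R_inf (param_neq0 R_reg xy)).
  transitivity (((1 - ga) * y - al * x) * x + al * x * x); first by ring.
  by rewrite -xyE' beE; ring.
(* Pairing [v] with [y *: f] gives [c * y], up to a unit, in [I]; the surplus exponent in [Ix]
   allows [y] to be cancelled. The same works for [d] with [x *: e]. *)
have eP v : N v -> exists c d, [/\ transv x a.+1 c, transv y b.+1 d & v = c *: e + d *: f].
  move=> Nv; have [c [d vE]] := det2_split nd v; exists c, d; split=> //.
    apply: (transv_cancel R_reg xy); apply: Ix; apply: (unit_mul_mem R_reg I_id nd).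
    rewrite (_ : _ * _ = det2 v (y *: f)); last by rewrite vE /det2 !mxE; ring.
    by rewrite -NI; apply: mem_minors.
  apply: (transv_cancel R_reg yx); apply: Iy; apply: (unit_mul_mem R_reg I_id nd).
  rewrite (_ : _ * _ = det2 (x *: e) v); last by rewrite vE /det2 !mxE; ring.
  by rewrite -NI; apply: mem_minors.
have eN c : transv x a.+1 c -> N (c *: e).
  move=> Jc; apply: N_iso => w /eP [c' [d [Jc' Kd ->]]].
  rewrite (_ : det2 _ _ = det2 e f * (c * d)); last by rewrite /det2 !mxE; ring.
  by apply: idealM => //; apply: IJK.
have fN d : transv y b.+1 d -> N (d *: f).
  move=> Kd; apply: N_iso => w /eP [c [d' [Jc Kd' ->]]].
  rewrite (_ : det2 _ _ = - det2 e f * (c * d)); last by rewrite /det2 !mxE; ring.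
  by apply: idealM => //; apply: IJK.
have [J_id K_id] := (transv_ideal m x a.+1, transv_ideal m y b.+1).
exists [set v | exists2 c, transv x a.+1 c & v = c *: e],
       [set v | exists2 d, transv y b.+1 d & v = d *: f].
have x0 := param_neq0 R_reg xy; have y0 := param_neq0 R_reg yx.
split.
- split; first exact: line_submodule.
  move=> P0; apply: x0; apply: (det2_indep (e := e) (f := f) (b := 0) nd).
  have : [set v | exists2 c, transv x a.+1 c & v = c *: e] (x *: e) by exists x.
  by rewrite P0 scale0r.
- split; first exact: line_submodule.
  have nd' : ~ m (det2 f e).
    by rewrite det2N => /(idealN m_id); rewrite opprK.
  move=> Q0; apply: y0; apply: (det2_indep (e := f) (f := e) (b := 0) nd').
  have : [set v | exists2 d, transv y b.+1 d & v = d *: f] (y *: f) by exists y.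
  by rewrite Q0 scale0r.
- apply/seteqP; split=> [_ [_ [c Jc ->] [_ [d Kd ->] <-]]|v /eP [c [d [Jc Kd ->]]]].
    by apply: submodD => //; [apply: eN|apply: fN].
  by exists (c *: e); [exists c|exists (d *: f) => //; exists d].
- apply/seteqP; split=> [v [[c _ ->] [d _ cd]]|_ ->].
    by rewrite (det2_indep nd cd) scale0r.
  split; first by exists 0; [apply: (ideal0 J_id)|rewrite scale0r].
  by exists 0; [apply: (ideal0 K_id)|rewrite scale0r].
Qed.

End Splitting.
End Necessity.

(** * Tangent directions of two ideals, and the order of an ideal *)

Section Tangents.
Variables (R : comNzRingType) (m : set R) (R_reg : regular_local_ring m 2).
Let R_loc : local_ring m. Proof. by case: R_reg. Qed.
Let m_id : ideal m. Proof. exact: maximal_is_ideal R_loc. Qed.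

Local Notation mpow := (ideal_exp m).
Local Notation params := (parameters m).
Local Notation transv := (transv m).

Lemma maximal_sub_of_params (J : set R) x y : params x y -> ideal J -> J x -> J y -> m `<=` J.
Proof. by move=> xy J_id Jx Jy r /xy [a [b ->]]; apply: idealD => //; apply: idealM. Qed.

(** Starting from [x] in [J] of order one, either [K] has an element with another tangent, or all
    tangents of [K] are [x]. In the latter case [J + K = m] forces an element [j] of [J] with
    another tangent, and [z] in [K] of order one completes it. *)
Lemma transverse_params (J K : set R) : ideal_proper J -> ideal_proper K ->
  ~ J `<=` mpow 2 -> ~ K `<=` mpow 2 -> ideal_add J K = m ->
  exists x y, [/\ params x y, J x & K y].
Proof.
move=> J_prop K_prop /not_mpow_sub [x Jx nx2] /not_mpow_sub [z Kz nz2] JKm.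
have Jm := proper_maximal R_reg J_prop; have Km := proper_maximal R_reg K_prop.
have [Kx|nKx] := pselect (K `<=` transv x 2); last first.
  have [y Ky nxy] : exists2 y, K y & ~ transv x 2 y.
    apply: contrapT => no; apply: nKx => y Ky; apply: contrapT => ny; apply: no.
    by exists y.
  exists x, y; split=> //; apply: (parameters_pair R_reg) => //; first exact: Jm.
  exact: Km.
have [t xt] := parameters_complete R_reg (Jm _ Jx) nx2.
have [j Jj nxj] : exists2 j, J j & ~ transv x 2 j.
  apply: contrapT => no; apply: (param_pow_notin_transv R_reg xt (n := 1)); rewrite expr1.
  have : ideal_add J K t by rewrite JKm; apply: parameters_r xt.
  move=> /ideal_addP [a [b [Ja /Kx xb ->]]].
  by apply: transvD => //; apply: contrapT => na; apply: no; exists a.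
have xj : params x j by apply: (parameters_pair R_reg) => //; apply: Jm.
exists j, z; split=> //; apply: (parameters_pair R_reg) => //.
- exact: Jm.
- exact: (param_notin_mpow2 R_reg (parameters_sym xj)).
- exact: Km.
case/ideal_addP => _ [w [[c ->] w2 zE]].
have /ideal_addP [_ [w' [[d ->] w'2 zE']]] := Kx z Kz.
have [|md _] := @params_lin_indep _ _ R_reg x j d (- c) xj.
  rewrite (_ : _ + _ = w - w'); first exact: (idealB (ideal_exp_ideal m 2)).
  by apply/eqP; rewrite -subr_eq0; apply/eqP;
     transitivity (d * x + w' - (c * j + w)); [ring|rewrite -zE -zE' subrr].
apply: nz2; rewrite zE'; apply: (idealD (ideal_exp_ideal m 2)) => //.
by apply: mpow2_mul => //; apply: Jm.
Qed.

(** An element of [J] or [K] outside [(x) + m^2] would generate [m] together with [x], and both lie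
    in [J + K]. *)
Lemma common_tangent (J K : set R) : ideal_proper J -> ideal_proper K ->
  ~ J `<=` mpow 2 -> ideal_add J K <> m ->
  exists x y, [/\ params x y, J `<=` transv x 2 & K `<=` transv x 2].
Proof.
move=> J_prop K_prop /not_mpow_sub [x Jx nx2] JKm.
have Jm := proper_maximal R_reg J_prop; have Km := proper_maximal R_reg K_prop.
have [J_id _] := J_prop; have [K_id _] := K_prop.
have [y xy] := parameters_complete R_reg (Jm _ Jx) nx2; exists x, y.
suff sub (A : set R) : A `<=` m -> A `<=` ideal_add J K -> A `<=` transv x 2.
  by split=> //; apply: sub => //; [apply: ideal_add_l|apply: ideal_add_r].
move=> Am AJK t At; apply: contrapT => nt; apply: JKm; apply/seteqP; split.
  by move=> r /ideal_addP [a [b [/Jm ma /Km mb ->]]]; apply: idealD.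
have xt : params x t by apply: (parameters_pair R_reg) => //; [apply: Jm|apply: Am].
apply: (maximal_sub_of_params xt); first exact: ideal_add_ideal.
  exact: ideal_add_l.
exact: AJK.
Qed.

Lemma ideal_order_exists (I : set R) : (exists2 a, I a & a <> 0) -> exists k, is_order m I k.
Proof.
case=> a Ia /(order_exists R_reg) [n [_ na]].
have ex : exists k, `[< ~ I `<=` mpow k >].
  by exists n.+1; apply/asboolP => /(_ a Ia).
have [k /asboolP nk k_min] := ex_minnP ex.
case: k nk k_min => [|k] nk k_min; first by case: nk.
exists k; split.
  by apply: contrapT => nIk; have := k_min k; rewrite ltnn => H; have /asboolP/H := nIk.
move=> j Ij; rewrite leqNgt; apply/negP => kj; apply: nk.
by move=> r /Ij; apply: ideal_exp_sub.
Qed.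

End Tangents.

Theorem theorem7 (R : comNzRingType) (m I : set R)
    (R_reg : regular_local_ring m 2)
    (R_inf : infinite_residue_field m)
    (I_prim : primary_to m I)
    (I_closed : integrally_closed_ideal I) :
  (exists M : lmodType R,
     [/\ finitely_generated M, torsion_free M & has_rank M 2] /\
     [/\ indecomposable M, integrally_closed_module M 2
        & is_minors_ideal M 2 I])
  <->
  [\/ exists2 k, is_order m I k & (3 <= k)%N,
      is_order m I 2 /\ (simple_ideal I /\ integrally_closed_ideal I)
    | is_order m I 2 /\
      exists J K : set R,
        [/\ simple_ideal J /\ integrally_closed_ideal J,
            simple_ideal K /\ integrally_closed_ideal K,
            I = ideal_mul J K
          & ideal_add J K <> m]].
Proof.
have I_nz := primary_nonzero R_reg R_inf I_prim.
(* Both factors lie in [m], so if one were inside [m^2] the product would be inside [m^3]. *)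
have factors J K : ideal_proper J -> ideal_proper K -> I = ideal_mul J K -> is_order m I 2 ->
    ~ J `<=` ideal_exp m 2 /\ ~ K `<=` ideal_exp m 2.
  move=> /(proper_maximal R_reg) Jm /(proper_maximal R_reg) Km IE [_ I_max].
  split=> H; suff /I_max : I `<=` ideal_exp m 3 by []; rewrite IE.
    by apply: (@mul_mpow_sub _ m J K 2 1) => //; rewrite (mpow1 R_reg).
  by apply: (@mul_mpow_sub _ m J K 1 2) => //; rewrite (mpow1 R_reg).
split.
  case=> M [[M_fg M_tf M_rank] [M_indec M_closed M_minors]].
  have [N [N_sub NI N_iso N_indec]] :=
    module_to_plane R_reg R_inf M_fg M_tf M_rank I_closed I_nz M_indec M_closed M_minors.
  have N_max := indecomposable_in_maximal R_reg R_inf N_sub I_nz NI N_indec.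
  have [k I_ord] := ideal_order_exists R_reg I_nz.
  have k2 : (1 < k)%N.
    apply: (proj2 I_ord); rewrite -NI; apply: minors_min; first exact: ideal_exp_ideal.
    move=> u w /N_max [u0 u1] /N_max [w0 w1].
    by apply: (idealB (ideal_exp_ideal m 2)); apply: (mpow2_mul R_reg).
  have [k3|] := ltnP 2 k; first by constructor 1; exists k.
  move=> k2'; have kE : k = 2 by apply/eqP; rewrite eqn_leq k2'.
  rewrite kE in I_ord.
  have [I_simple|I_nsimple] := pselect (simple_ideal I); first by constructor 2.
  constructor 3; split=> //.
  have [J [K [J_prop K_prop IE]]] : exists J K,
      [/\ ideal_proper J, ideal_proper K & I = ideal_mul J K].
    apply: contrapT => no; apply: I_nsimple; split=> //; first by case: I_prim => -[].
    by have [a Ia a0] := I_nz; move=> I0; rewrite I0 in Ia.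
  have [nJ2 nK2] := factors J K J_prop K_prop IE I_ord.
  have [[J_id _] [K_id _]] := (J_prop, K_prop).
  have [n mI] := primary_mpow R_reg I_prim.
  have mJ : ideal_exp m n `<=` J.
    by move=> r /mI; rewrite IE; apply: ideal_mul_subl.
  have mK : ideal_exp m n `<=` K.
    by move=> r /mI; rewrite IE; apply: ideal_mul_subr.
  (* Factors of order one contain a parameter [x], hence have the form [(x, y^a)]; this gives their
     integral closedness. *)
  have closed A : ideal_proper A -> ~ A `<=` ideal_exp m 2 -> ideal_exp m n `<=` A ->
      integrally_closed_ideal A.
    move=> A_prop /not_mpow_sub [x Ax nx2] mA.
    have mx := proper_maximal R_reg A_prop Ax.
    have [y xy] := parameters_complete R_reg mx nx2.
    have [a ->] := order_one_transv R_reg xy (proj1 A_prop) Ax mA.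
    exact: (transv_integrally_closed R_reg _ xy).
  exists J, K; split=> //.
  - by split; [exact: (order_one_simple R_reg)|apply: closed].
  - by split; [exact: (order_one_simple R_reg)|apply: closed].
  move=> JKm; apply: N_indec.
  have [x [y [xy Jx Ky]]] := transverse_params R_reg J_prop K_prop nJ2 nK2 JKm.
  have yx := parameters_sym xy.
  have [a JE] := order_one_transv R_reg xy J_id Jx mJ.
  have [b KE] := order_one_transv R_reg yx K_id Ky mK.
  (* Exponent 0 would make a factor the whole ring; this accounts for the successors in
     [transverse_decomposable]. *)
  have prop0 z : ~ ideal_proper (transv m z 0).
    by case=> _; apply; apply/seteqP; split=> // r _; apply: transv_mpow.
  case: a JE => [|a] JE; first by case: (prop0 x); rewrite -JE.
  case: b KE => [|b] KE; first by case: (prop0 y); rewrite -KE.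
  rewrite JE KE in IE.
  exact: (transverse_decomposable R_reg R_inf N_sub NI xy IE N_iso N_max).
move=> cases.
suff [N [N_sub NI N_iso N_indec]] : exists N : set 'cV[R]_2, [/\ submodule N,
    minors_ideal N = I, isotropic_to I N `<=` N & ~ decomposable_in N].
  exists (submodule_type N_sub); apply: (plane_to_module R_reg R_inf) => //.
  exact: (isotropic_contains_pow I_prim N_iso).
case: cases => [[k I_ord k3]|[I_ord [I_simple _]]|].
- apply: (exists_plane_module R_reg R_inf I_prim I_closed I_ord); first exact: ltn_trans k3.
  by constructor 1.
- apply: (exists_plane_module R_reg R_inf I_prim I_closed I_ord) => //.
  by constructor 2.
case=> I_ord [J [K [[[J_prop _ _] _] [[K_prop _ _] _] IE JKm]]].
have [nJ2 _] := factors J K J_prop K_prop IE I_ord.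
have [x [y [xy Jx Kx]]] := common_tangent R_reg J_prop K_prop nJ2 JKm.
apply: (exists_plane_module R_reg R_inf I_prim I_closed I_ord) => //.
by constructor 3; split=> //; exists J, K, x, y.
Qed.
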